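(* The Hilbert matrix operator $\mathcal{H}$ maps $H^\infty$ into $\mathrm{BMOA}$, and its operator norm is $$\|\mathcal{H}\|_{H^\infty\to \mathrm{BMOA}}=1+\frac{\pi}{\sqrt{2}}.$$
   Context: $\mathbb{D}$ is the open unit disc in $\mathbb{C}$ and $dA(z)=\pi^{-1}\,dx\,dy$ for $z=x+iy$. $H^p$ denotes the Hardy spaces of $\mathbb{D}$; $H^\infty$ is the space of bounded analytic functions on $\mathbb{D}$ with $\|f\|_{H^\infty}=\sup_{z\in\mathbb{D}}|f(z)|$. For $f(z)=\sum_{k\ge 0}a_kz^k$ in $H^1$, the Hilbert matrix operator is $$\mathcal{H}(f)(z)=\sum_{n=0}^{\infty}\left(\sum_{k=0}^{\infty}\frac{a_k}{k+n+1}\right)z^n=\int_0^1\frac{f(t)}{1-tz}\,dt,\qquad z\in\mathbb{D}.$$ $\mathrm{BMOA}$ is the space of all $f\in H^2$ such that $$\|f\|_{\mathrm{BMOA}}=|f(0)|+\left(\sup_{a\in\mathbb{D}}\int_{\mathbb{D}}|f'(z)|^2\log\left|\frac{1-\overline{a}z}{a-z}\right|^2dA(z)\right)^{1/2}<\infty.$$ The operator norm is $\|\mathcal{H}\|_{H^\infty\to \mathrm{BMOA}}=\sup\{\|\mathcal{H}(f)\|_{\mathrm{BMOA}}:\|f\|_{H^\infty}\le 1\}$. *)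

(* Defs.v *)
From HB Require Import structures.
From mathcomp Require Import all_boot all_order all_algebra.
From mathcomp Require Import complex.
From mathcomp Require Import all_classical all_reals all_analysis.

Set Implicit Arguments.
Unset Strict Implicit.
Unset Printing Implicit Defensive.

Import Order.TTheory GRing.Theory Num.Theory.
Import numFieldNormedType.Exports.

Local Open Scope classical_set_scope.
Local Open Scope ring_scope.

(* The regular module [R[i]^o] is the form of the complex numbers on which the
   topology, the norm and the complex derivative of MathComp-Analysis are
   inferred. *)
Notation Cplx R := (R[i]^o)%type.

(* The real-valued modulus: the norm [`|z|] takes its values in R[i]. *)
Notation cabs z := (ComplexField.Normc.normc z).

Section HilbertMatrix.
Context {R : realType}.
Implicit Types (f : Cplx R -> Cplx R) (z a : Cplx R).

Definition unit_disc : set (Cplx R) := [set z | cabs z < 1].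

(* Functions are total on C; only their values on the disc matter.  Since the
   scalars of [Cplx R] are complex, [derivable f z 1] is complex
   differentiability at z. *)
Definition analytic_on_disc f : Prop :=
  forall z, unit_disc z -> derivable f z 1.

Definition Hinfty_norm f : \bar R :=
  ereal_sup [set (cabs (f z))%:E | z in unit_disc].

Definition Hinfty : set (Cplx R -> Cplx R) :=
  [set f | analytic_on_disc f /\ (Hinfty_norm f < +oo)%E].

Definition circle_mean2 f (r : R) : \bar R :=
  (((2 * pi)^-1)%R%:E * \int[lebesgue_measure]_(t in `[0%R, (2 * pi)%R])
     (cabs (f (Complex (r * cos t) (r * sin t))) ^+ 2)%R%:E)%E.

Definition H2 : set (Cplx R -> Cplx R) :=
  [set f | analytic_on_disc f /\
     (ereal_sup [set circle_mean2 f r | r in `[0%R, 1%R[] < +oo)%E].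

Definition taylor_coef f (k : nat) : Cplx R := derive1n k f 0 / k`!%:R.

Definition hilbert_coef f (n : nat) : Cplx R :=
  limn (series (fun k => taylor_coef f k / (k + n + 1)%:R : Cplx R)).

Definition hilbert f : Cplx R -> Cplx R :=
  fun z => limn (series (fun n => hilbert_coef f n * z ^+ n : Cplx R)).

Definition disc_area_integral (h : Cplx R -> R) : \bar R :=
  ((pi^-1)%R%:E *
   \int[(lebesgue_measure \x lebesgue_measure)]_(w in
       [set w : R * R | unit_disc (Complex w.1 w.2)])
     (h (Complex w.1 w.2))%:E)%E.

(* The logarithm is infinite at z = a, where [ln] and [^-1] return junk values;
   this is a null set. *)
Definition BMOA_integral f a : \bar R :=
  disc_area_integral (fun z =>
    (cabs (derive1 f z)) ^+ 2 * ln (cabs ((1 - conjc a * z) / (a - z)) ^+ 2)).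

Definition BMOA_norm f : \bar R :=
  ((cabs (f 0))%:E +
   sqrte (ereal_sup [set BMOA_integral f a | a in unit_disc]))%E.

Definition BMOA : set (Cplx R -> Cplx R) :=
  [set f | H2 f /\ (BMOA_norm f < +oo)%E].

Definition Hinfty_BMOA_opnorm (T : (Cplx R -> Cplx R) -> Cplx R -> Cplx R) :
    \bar R :=
  ereal_sup [set BMOA_norm (T f) | f in
    [set f | Hinfty f /\ (Hinfty_norm f <= 1)%E]].

End HilbertMatrix.

(* Main.v *)
(** Write g = H f and suppose |f| <= 1 on the disc.  Deforming the path of
    integration in g'(z) = \int_0^1 t f(t) / (1 - t z)^2 dt to the curve
    phi(t) = t / (1 - (1 - t) z), along which (1 - z) phi' = (1 - z phi)^2, gives
    |(1 - z) g'(z)| <= 1; similarly |g(0)| <= 1.  So the BMOA integral at a is at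
    most the Green potential of |1 - z|^-2, and this potential is explicit:
    theta = arg (1 - z) satisfies Laplacian (theta^2) = 2 |1 - z|^-2 and
    |theta| = pi/2 on the unit circle, so the potential at a is
    pi^2/2 - 2 theta(a)^2 <= pi^2/2.  For f = 1, (1 - z) g'(z) tends to 1 as z
    tends to 1, and the bound is attained in the limit as a tends to 1 along the
    radius.  The logarithm of the Green function is replaced by polynomials, for
    which Green's formula on the disc is elementary. *)

(* Let phi be the disc automorphism exchanging 0 and a, and xi = 1 - |phi|^2. A polynomial P(xi)
   vanishing to second order at xi = 0 has Laplacian 4 |phi'|^2 ((1 - x) P')'(xi). P is chosen to
   make this a difference of two positive densities of equal mass: one, proportional to (1 - xi)^n,
   concentrates on the circle, the other, proportional to xi^n, at a. Testing against u thus gives a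
   boundary mean of u minus u(a) in the limit, without any boundary integral. The boundary value of
   theta = arg (1 - z) at exp(i t), 0 < t < 2 pi, has modulus |pi - t|/2, which tends to pi/2 only
   at the point 1. So pi^2/2 - 2 theta(a)^2 is only an upper bound for the potential, and the lower
   bound needs a harmonic majorant of the boundary gap pi^2/2 - 2 theta^2 that is small near 1. It
   comes from cos^2 theta, which equals (1 - x)/2 on the circle. As H is defined through Taylor
   coefficients, the path is deformed for polynomials only, where this is a matter of
   antiderivatives; dilated Taylor polynomials then reach every bounded f. *)
Require Import Defs.
From mathcomp Require Import all_boot all_order all_algebra.
From mathcomp Require Import complex.
From mathcomp Require Import all_classical all_reals all_analysis.
From mathcomp Require Import measurable_realfun.
From mathcomp Require Import ring lra.

Set Implicit Arguments.
Unset Strict Implicit.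
Unset Printing Implicit Defensive.

Import Order.TTheory GRing.Theory Num.Theory.
Import numFieldNormedType.Exports.

Local Open Scope classical_set_scope.
Local Open Scope ring_scope.

(** * Calculus on the unit disc *)

Section disc_calculus.
Context {R : realType}.
Implicit Types (f g X : R * R -> R) (w : R * R).

Definition rdisc : set (R * R) := [set w | w.1 ^+ 2 + w.2 ^+ 2 < 1].
Definition cldisc : set (R * R) := [set w | w.1 ^+ 2 + w.2 ^+ 2 <= 1].
Definition rcircle : set (R * R) := [set w | w.1 ^+ 2 + w.2 ^+ 2 = 1].

Notation mu := (@lebesgue_measure R).
Notation mu2 := (mu \x mu)%E.

Definition dint f : R := \int[mu2]_(w in rdisc) f w.

(* Continuity is only required along horizontal and vertical slices: this is
   all that Fubini and the fundamental theorem of calculus need. *)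
Record tame f : Prop := Tame {
  tame_measurable : measurable_fun setT f ;
  tame_bounded : exists K, forall w, cldisc w -> `|f w| <= K ;
  tame_contx : forall w, cldisc w -> {for w.1, continuous (fun x => f (x, w.2))} ;
  tame_conty : forall w, cldisc w -> {for w.2, continuous (fun y => f (w.1, y))} }.

Definition pdx f f' := forall w, cldisc w ->
  is_derive w.1 1 (fun x => f (x, w.2)) (f' w).
Definition pdy f f' := forall w, cldisc w ->
  is_derive w.2 1 (fun y => f (w.1, y)) (f' w).

Lemma rdisc_sub : rdisc `<=` cldisc.
Proof. by move=> w /ltW. Qed.

Lemma measurable_rdisc : measurable rdisc.
Proof.
rewrite (_ : rdisc = (fun w => w.1 ^+ 2 + w.2 ^+ 2) @^-1` `]-oo, 1[%classic).
  rewrite -[X in measurable X]setTI.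
  have : measurable_fun setT (fun w : R * R => w.1 ^+ 2 + w.2 ^+ 2).
    by apply: measurable_funD; apply: measurable_funX; [exact: measurable_fst|exact: measurable_snd].
  by apply => //; exact: measurable_itv.
by apply/seteqP; split => w /=; rewrite in_itv.
Qed.

Lemma rdisc_finite : (mu2 rdisc < +oo)%E.
Proof.
apply: (@le_lt_trans _ _ (mu2 (`[-1, 1] `*` `[-1, 1])%classic)).
  apply: le_measure; rewrite ?inE; [exact: measurable_rdisc| |].
    by apply: measurableX; exact: measurable_itv.
  move=> w; rewrite /rdisc/= !in_itv/= => h.
  by split; apply/andP; split; nra.
rewrite product_measure1E//=; try exact: measurable_itv.
by rewrite lebesgue_measure_itv/= lte_fin ifT -?EFinB -?EFinM ?ltry//; lra.
Qed.

Lemma tame_integrable f : tame f -> mu2.-integrable rdisc (EFin \o f).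
Proof.
move=> tf; apply: measurable_bounded_integrable.
- exact: measurable_rdisc.
- exact: rdisc_finite.
- by apply: measurable_funTS; exact: tame_measurable.
- have [K HK] := tame_bounded tf.
  exists K; split; first exact: num_real.
  move=> M KM w wd; rewrite /= (le_trans (HK _ (rdisc_sub wd)))//; exact: ltW.
Qed.

Lemma tame_cst c : tame (fun=> c).
Proof.
split => //; first by exists `|c|.
- by move=> w _; exact: cst_continuous.
- by move=> w _; exact: cst_continuous.
Qed.

Lemma tame_fst : tame (fun w => w.1).
Proof.
split; first exact: measurable_fst.
- by exists 1 => w; rewrite /cldisc /= ler_norml => h; apply/andP; split; nra.
- by move=> w _; exact: cvg_id.
- by move=> w _; exact: cst_continuous.
Qed.

Lemma tame_snd : tame (fun w => w.2).
Proof.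
split; first exact: measurable_snd.
- by exists 1 => w; rewrite /cldisc /= ler_norml => h; apply/andP; split; nra.
- by move=> w _; exact: cst_continuous.
- by move=> w _; exact: cvg_id.
Qed.

Lemma tameD f g : tame f -> tame g -> tame (fun w => f w + g w).
Proof.
move=> tf tg; split.
- by apply: measurable_funD; exact: tame_measurable.
- have [K HK] := tame_bounded tf; have [L HL] := tame_bounded tg.
  by exists (K + L) => w wd; rewrite (le_trans (ler_normD _ _))// lerD// ?HK ?HL.
- by move=> w wd; apply: cvgD; [exact: (tame_contx tf wd)|exact: (tame_contx tg wd)].
- by move=> w wd; apply: cvgD; [exact: (tame_conty tf wd)|exact: (tame_conty tg wd)].
Qed.

Lemma tameM f g : tame f -> tame g -> tame (fun w => f w * g w).
Proof.
move=> tf tg; split.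
- by apply: measurable_funM; exact: tame_measurable.
- have [K HK] := tame_bounded tf; have [L HL] := tame_bounded tg.
  by exists (K * L) => w wd; rewrite normrM ler_pM// ?HK ?HL.
- by move=> w wd; apply: cvgM; [exact: (tame_contx tf wd)|exact: (tame_contx tg wd)].
- by move=> w wd; apply: cvgM; [exact: (tame_conty tf wd)|exact: (tame_conty tg wd)].
Qed.

Lemma tameN f : tame f -> tame (fun w => - f w).
Proof.
move=> tf; rewrite (_ : (fun _ => _) = (fun w => -1 * f w)); last first.
  by apply/funext => w; rewrite mulN1r.
exact: (@tameM (fun=> -1) f (tame_cst _) tf).
Qed.

Lemma tameB f g : tame f -> tame g -> tame (fun w => f w - g w).
Proof. by move=> tf tg; exact: (@tameD f (fun w => - g w) tf (tameN tg)). Qed.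

Lemma tameX f n : tame f -> tame (fun w => f w ^+ n).
Proof.
move=> tf; elim: n => [|n IH].
  by rewrite (_ : (fun _ => _) = (fun=> 1))//; exact: tame_cst.
rewrite (_ : (fun _ => _) = (fun w => f w * f w ^+ n)); first exact: tameM.
by apply/funext => w; rewrite exprS.
Qed.

(** Inversion is continuous only off 0, so the point 0, where its value is 0 by convention, is split
    off. *)
Lemma measurable_funV : measurable_fun setT (@GRing.inv R).
Proof.
rewrite (_ : GRing.inv = (fun x : R => if x == 0 then 0 else x^-1)); last first.
  by apply/funext => x; case: eqP => // ->; rewrite invr0.
apply: measurable_fun_if => //.
- apply: measurable_fun_eqr => //.
- rewrite setTI; apply: open_continuous_measurable_fun.
    rewrite (_ : _ @^-1` _ = ~` [set 0]).
      by apply: closed_openC; apply: accessible_closed_set1; exact: hausdorff_accessible.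
    by apply/seteqP; split => x /=; [move=> /negbT/eqP|move/eqP/negbTE].
  move=> x; rewrite inE/= => /negbT x0; exact: inv_continuous.
Qed.

Lemma tameV f kappa : 0 < kappa -> tame f -> (forall w, cldisc w -> kappa <= f w) ->
  tame (fun w => (f w)^-1).
Proof.
move=> k0 tf kf; split.
- by apply: (measurableT_comp measurable_funV); exact: tame_measurable.
- exists kappa^-1 => w wd; rewrite ger0_norm ?invr_ge0 ?lef_pV2 ?posrE ?kf//.
    by rewrite (lt_le_trans k0)// kf.
  by rewrite (le_trans (ltW k0))// kf.
- move=> w wd; apply: cvgV; last exact: (tame_contx tf wd).
  by case: w wd => x y wd; rewrite gt_eqF// (lt_le_trans k0)// kf.
- move=> w wd; apply: cvgV; last exact: (tame_conty tf wd).
  by case: w wd => x y wd; rewrite gt_eqF// (lt_le_trans k0)// kf.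
Qed.

End disc_calculus.

(** * Green's formula on the disc by slicing along chords *)

Section slices.
Context {R : realType}.
Notation mu := (@lebesgue_measure R).

Lemma integral_derivative_eq0 (F F' : R -> R) (c : R) : 0 < c ->
  (forall x, - c <= x <= c -> {for x, continuous F'}) ->
  (forall x, - c <= x <= c -> is_derive x 1 F (F' x)) ->
  F c = 0 -> F (- c) = 0 ->
  (\int[mu]_(x in `](- c)%R, c%R[) (F' x)%:E = 0)%E.
Proof.
move=> c0 cF' dF Fc FNc.
have cc : - c < c by lra.
have cF x : - c <= x <= c -> {for x, continuous F}.
  move=> /dF dFx; apply: differentiable_continuous; apply/derivable1_diffP.
  exact: ex_derive.
have wc : {within `[- c, c], continuous F'}.
  by apply: continuous_in_subspaceT => x; rewrite inE/= in_itv/=; exact: cF'.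
rewrite -(@integral_itv_bndoo _ _ _ _ true false); last first.
  apply: (@measurable_funS _ _ _ _ `[- c, c]%classic) => //.
    exact: subset_itv_oo_cc.
  by apply/measurable_EFinP; apply: subspace_continuous_measurable_fun.
rewrite (continuous_FTC2 cc wc (F := F)).
- by rewrite Fc FNc subee.
- split.
  + move=> x; rewrite in_itv/= => /andP[x1 x2].
    by apply: ex_derive; apply: dF; rewrite !ltW.
  + by apply: cvg_at_right_filter; apply: cF; lra.
  + by apply: cvg_at_left_filter; apply: cF; lra.
- move=> x; rewrite in_itv/= => /andP[x1 x2].
  by rewrite derive1E; apply: derive_val; apply: dF; rewrite !ltW.
Qed.

(** Also valid for |y| >= 1: [Num.sqrt] is 0 on negative numbers, so both sides are then empty. *)
Lemma chord (y : R) : `]- Num.sqrt (1 - y ^+ 2), Num.sqrt (1 - y ^+ 2)[%classic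
  = [set x : R | x ^+ 2 + y ^+ 2 < 1].
Proof.
apply/seteqP; split => x /=; rewrite in_itv/=; set c := Num.sqrt _.
  move=> /andP[h1 h2].
  have c0 : 0 < c by lra.
  have : c ^+ 2 = 1 - y ^+ 2.
    by rewrite sqr_sqrtr// ltW// -sqrtr_gt0.
  nra.
move=> h.
have h1 : 0 < 1 - y ^+ 2 by nra.
have c0 : 0 < c by rewrite sqrtr_gt0.
have : c ^+ 2 = 1 - y ^+ 2 by rewrite sqr_sqrtr// ltW.
by move=> cE; apply/andP; split; nra.
Qed.

Lemma xslice (f : R * R -> R) (y : R) :
  (\int[mu]_x ((EFin \o f) \_ rdisc) (x, y) =
   \int[mu]_(x in `](- Num.sqrt (1 - y ^+ 2))%R, (Num.sqrt (1 - y ^+ 2))%R[) (f (x, y))%:E)%E.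
Proof.
rewrite [RHS]integral_mkcond chord; apply: eq_integral => x _.
by rewrite !patchE; congr (if _ then _ else _); rewrite /rdisc !inE.
Qed.

Lemma yslice (f : R * R -> R) (x : R) :
  (\int[mu]_y ((EFin \o f) \_ rdisc) (x, y) =
   \int[mu]_(y in `](- Num.sqrt (1 - x ^+ 2))%R, (Num.sqrt (1 - x ^+ 2))%R[) (f (x, y))%:E)%E.
Proof.
rewrite [RHS]integral_mkcond chord; apply: eq_integral => y _.
rewrite !patchE; congr (if _ then _ else _); rewrite /rdisc.
by apply/idP/idP; rewrite !inE/= addrC.
Qed.

Lemma chord_endpoint (y : R) : 0 < Num.sqrt (1 - y ^+ 2) ->
  (Num.sqrt (1 - y ^+ 2)) ^+ 2 + y ^+ 2 = 1.
Proof. by rewrite sqrtr_gt0 => h; rewrite sqr_sqrtr ?ltW// subrK. Qed.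

(** By Fubini, each horizontal chord contributes the difference of [X] at its two endpoints, which
    lie on the circle. *)
Lemma dint_dx_eq0 (X DX : R * R -> R) : tame DX -> pdx X DX ->
  (forall w, rcircle w -> X w = 0) -> dint DX = 0.
Proof.
move=> tDX dX X0; rewrite /dint /Rintegral.
have iDX := tame_integrable tDX.
rewrite integral_mkcond -integral21_prod_meas1/=; last first.
  by rewrite -integrable_mkcond//; exact: measurable_rdisc.
rewrite integral0_eq// => y _. apply: etrans (xslice DX y) _.
have := sqrtr_ge0 (1 - y ^+ 2); set c := Num.sqrt _.
rewrite le_eqVlt => /predU1P[<-|c0]; first by rewrite oppr0 set_itv_ge ?bnd_simp ?integral_set0 ?ltxx.
have cE := chord_endpoint c0; rewrite -/c in cE.
apply: (@integral_derivative_eq0 (fun x => X (x, y))) => //.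
- move=> x /andP[x1 x2]; apply: (@tame_contx _ _ tDX (x, y)); rewrite /cldisc /=; nra.
- move=> x /andP[x1 x2]; apply: (dX (x, y)); rewrite /cldisc /=; nra.
- by apply: X0; rewrite /rcircle/=.
- by apply: X0; rewrite /rcircle/= sqrrN.
Qed.

Lemma dint_dy_eq0 (X DX : R * R -> R) : tame DX -> pdy X DX ->
  (forall w, rcircle w -> X w = 0) -> dint DX = 0.
Proof.
move=> tDX dX X0; rewrite /dint /Rintegral.
have iDX := tame_integrable tDX.
rewrite integral_mkcond -integral12_prod_meas1/=; last first.
  by rewrite -integrable_mkcond//; exact: measurable_rdisc.
rewrite integral0_eq// => y _. apply: etrans (yslice DX y) _.
have := sqrtr_ge0 (1 - y ^+ 2); set c := Num.sqrt _.
rewrite le_eqVlt => /predU1P[<-|c0]; first by rewrite oppr0 set_itv_ge ?bnd_simp ?integral_set0 ?ltxx.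
have cE := chord_endpoint c0; rewrite -/c in cE.
apply: (@integral_derivative_eq0 (fun x => X (y, x))) => //.
- move=> x /andP[x1 x2]; apply: (@tame_conty _ _ tDX (y, x)); rewrite /cldisc /=; nra.
- move=> x /andP[x1 x2]; apply: (dX (y, x)); rewrite /cldisc /=; nra.
- by apply: X0; rewrite /rcircle/= addrC.
- by apply: X0; rewrite /rcircle/= sqrrN addrC.
Qed.

Lemma dintD (f g : R * R -> R) : tame f -> tame g ->
  dint (fun w => f w + g w) = dint f + dint g.
Proof.
move=> tf tg; rewrite /dint RintegralD//; [exact: measurable_rdisc| |]; exact: tame_integrable.
Qed.

Lemma dintB (f g : R * R -> R) : tame f -> tame g ->
  dint (fun w => f w - g w) = dint f - dint g.
Proof.
move=> tf tg; rewrite /dint RintegralB//; [exact: measurable_rdisc| |]; exact: tame_integrable.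
Qed.

Lemma dintZ (k : R) (f : R * R -> R) : tame f ->
  dint (fun w => k * f w) = k * dint f.
Proof.
move=> tf; rewrite /dint RintegralZl//; [exact: measurable_rdisc|exact: tame_integrable].
Qed.

Lemma le_dint (f g : R * R -> R) : tame f -> tame g ->
  (forall w, rdisc w -> f w <= g w) -> dint f <= dint g.
Proof.
move=> tf tg fg; apply: le_Rintegral => //; [exact: measurable_rdisc| |]; exact: tame_integrable.
Qed.

Lemma eq_dint (f g : R * R -> R) :
  (forall w, rdisc w -> f w = g w) -> dint f = dint g.
Proof. by move=> fg; apply: eq_Rintegral => w; rewrite inE => /fg. Qed.

(** Green's second identity: the difference of the two integrands is the divergence of W grad u - u
    grad W, and this field vanishes on the circle because W and its gradient do. *)
Lemma green (W Wx Wy Wxx Wyy u ux uy uxx uyy : R * R -> R) :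
  tame W -> tame Wxx -> tame Wyy -> tame u -> tame uxx -> tame uyy ->
  pdx W Wx -> pdy W Wy -> pdx Wx Wxx -> pdy Wy Wyy ->
  pdx u ux -> pdy u uy -> pdx ux uxx -> pdy uy uyy ->
  (forall w, rcircle w -> [/\ W w = 0, Wx w = 0 & Wy w = 0]) ->
  dint (fun w => W w * (uxx w + uyy w)) = dint (fun w => u w * (Wxx w + Wyy w)).
Proof.
move=> tW tWxx tWyy tu tuxx tuyy dW1 dW2 dW3 dW4 du1 du2 du3 du4 W0.
have tx : tame (fun w => W w * uxx w - u w * Wxx w) by apply: tameB; apply: tameM.
have ty : tame (fun w => W w * uyy w - u w * Wyy w) by apply: tameB; apply: tameM.
apply/eqP; rewrite -subr_eq0 -dintB; try by apply: tameM => //; apply: tameD.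
rewrite (_ : (fun w => _) = (fun w => (W w * uxx w - u w * Wxx w) +
    (W w * uyy w - u w * Wyy w))); last by apply/funext => w; ring.
rewrite dintD//; apply/eqP.
rewrite (@dint_dx_eq0 (fun w => W w * ux w - u w * Wx w))//.
- rewrite (@dint_dy_eq0 (fun w => W w * uy w - u w * Wy w)) ?addr0//.
  + move=> w wd; have ? := dW2 _ wd; have ? := dW4 _ wd; have ? := du2 _ wd.
    have ? := du4 _ wd.
    by apply: is_derive_eq; rewrite /GRing.scale/=; case: (w) => ? ? /=; ring.
  + by move=> w /W0[-> _ ->]; rewrite mul0r mulr0 subrr.
- move=> w wd; have ? := dW1 _ wd; have ? := dW3 _ wd; have ? := du1 _ wd.
  have ? := du3 _ wd.
  by apply: is_derive_eq; rewrite /GRing.scale/=; case: (w) => ? ? /=; ring.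
- by move=> w /W0[-> -> _]; rewrite mul0r mulr0 subrr.
Qed.

End slices.

Section tame_more.
Context {R : realType}.
Implicit Types (f g X : R * R -> R) (w : R * R).

Lemma tame_horner (P : {poly R}) f : tame f -> tame (fun w => P.[f w]).
Proof.
move=> tf; elim/poly_ind: P => [|P c IH].
  by under eq_fun do rewrite horner0; exact: tame_cst.
under eq_fun do rewrite hornerMXaddC.
by apply: tameD; [exact: tameM|exact: tame_cst].
Qed.

Lemma pdx_horner (P : {poly R}) f f' : pdx f f' ->
  pdx (fun w => P.[f w]) (fun w => P^`().[f w] * f' w).
Proof.
move=> df [x y] /df dfw.
exact: (@is_derive1_comp _ (horner P) (fun t => f (t, y)) _ _ _ (is_derive_poly P _)).
Qed.

Lemma pdy_horner (P : {poly R}) f f' : pdy f f' ->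
  pdy (fun w => P.[f w]) (fun w => P^`().[f w] * f' w).
Proof.
move=> df [x y] /df dfw.
exact: (@is_derive1_comp _ (horner P) (fun t => f (x, t)) _ _ _ (is_derive_poly P _)).
Qed.

Lemma pdx_inv f f' : (forall w, cldisc w -> f w != 0) -> pdx f f' ->
  pdx (fun w => (f w)^-1) (fun w => - (f w) ^- 2 * f' w).
Proof.
move=> f0 df w wd; have dfw := df w wd.
have := @is_deriveV _ (fun x => f (x, w.2)) w.1 (f' w) 1 _ dfw.
by case: w wd {dfw} => x y wd; apply; exact: f0.
Qed.

Lemma pdy_inv f f' : (forall w, cldisc w -> f w != 0) -> pdy f f' ->
  pdy (fun w => (f w)^-1) (fun w => - (f w) ^- 2 * f' w).
Proof.
move=> f0 df w wd; have dfw := df w wd.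
have := @is_deriveV _ (fun x => f (w.1, x)) w.2 (f' w) 1 _ dfw.
by case: w wd {dfw} => x y wd; apply; exact: f0.
Qed.

Lemma pdx_eq f f' f'' : pdx f f' -> (forall w, cldisc w -> f' w = f'' w) -> pdx f f''.
Proof. by move=> df e w wd; rewrite -e//; exact: df. Qed.

Lemma pdx_cst (k : R) : pdx (fun=> k) (fun=> 0).
Proof. by move=> w _; exact: is_derive_cst. Qed.

Lemma pdxD f f' g g' : pdx f f' -> pdx g g' -> pdx (fun w => f w + g w) (fun w => f' w + g' w).
Proof. by move=> df dg w wd; apply: is_deriveD; [exact: df|exact: dg]. Qed.

Lemma pdxN f f' : pdx f f' -> pdx (fun w => - f w) (fun w => - f' w).
Proof. by move=> df w wd; apply: is_deriveN; exact: df. Qed.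

Lemma pdxM f f' g g' : pdx f f' -> pdx g g' ->
  pdx (fun w => f w * g w) (fun w => f w * g' w + g w * f' w).
Proof. by move=> df dg [x y] wd; apply: is_deriveM; [exact: (df (x, y))|exact: (dg (x, y))]. Qed.

Lemma pdxX f f' n : pdx f f' ->
  pdx (fun w => f w ^+ n) (fun w => n%:R * f w ^+ n.-1 * f' w).
Proof.
move=> df; elim: n => [|n IH].
  by apply: (pdx_eq (pdx_cst 1)) => w _; rewrite !mul0r.
have := pdxM df IH; under eq_fun do rewrite -exprS.
move=> h; apply: (pdx_eq h) => w _ /=.
by case: n {IH h} => [|n]; rewrite /= ?exprS; ring.
Qed.

Lemma pdy_eq f f' f'' : pdy f f' -> (forall w, cldisc w -> f' w = f'' w) -> pdy f f''.
Proof. by move=> df e w wd; rewrite -e//; exact: df. Qed.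

Lemma pdy_cst (k : R) : pdy (fun=> k) (fun=> 0).
Proof. by move=> w _; exact: is_derive_cst. Qed.

Lemma pdyD f f' g g' : pdy f f' -> pdy g g' -> pdy (fun w => f w + g w) (fun w => f' w + g' w).
Proof. by move=> df dg w wd; apply: is_deriveD; [exact: df|exact: dg]. Qed.

Lemma pdyN f f' : pdy f f' -> pdy (fun w => - f w) (fun w => - f' w).
Proof. by move=> df w wd; apply: is_deriveN; exact: df. Qed.

Lemma pdyM f f' g g' : pdy f f' -> pdy g g' ->
  pdy (fun w => f w * g w) (fun w => f w * g' w + g w * f' w).
Proof. by move=> df dg [x y] wd; apply: is_deriveM; [exact: (df (x, y))|exact: (dg (x, y))]. Qed.

Lemma pdyX f f' n : pdy f f' ->
  pdy (fun w => f w ^+ n) (fun w => n%:R * f w ^+ n.-1 * f' w).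
Proof.
move=> df; elim: n => [|n IH].
  by apply: (pdy_eq (pdy_cst 1)) => w _; rewrite !mul0r.
have := pdyM df IH; under eq_fun do rewrite -exprS.
move=> h; apply: (pdy_eq h) => w _ /=.
by case: n {IH h} => [|n]; rewrite /= ?exprS; ring.
Qed.

Lemma pdx_fst : pdx (fun w => w.1) (fun=> 1 : R).
Proof. by move=> w _; exact: is_derive_id. Qed.
Lemma pdx_snd : pdx (fun w => w.2) (fun=> 0 : R).
Proof. by move=> w _; exact: is_derive_cst. Qed.
Lemma pdy_fst : pdy (fun w => w.1) (fun=> 0 : R).
Proof. by move=> w _; exact: is_derive_cst. Qed.
Lemma pdy_snd : pdy (fun w => w.2) (fun=> 1 : R).
Proof. by move=> w _; exact: is_derive_id. Qed.

Lemma cldisc_fst_le1 w : cldisc w -> -1 <= w.1 <= 1.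
Proof. rewrite /cldisc/= => h; nra. Qed.

End tame_more.

Ltac tame_tac := repeat first
  [ assumption | exact: tame_cst | exact: tame_fst | exact: tame_snd
  | apply: tameX | apply: tameB | apply: tameD | apply: tameM | apply: tameN ].

Ltac pdx_tac := repeat first
  [ eassumption | exact: pdx_fst | exact: pdx_snd | exact: pdx_cst
  | apply: pdxD | apply: pdxN | apply: pdxX | apply: pdxM ].
Ltac pdy_tac := repeat first
  [ eassumption | exact: pdy_fst | exact: pdy_snd | exact: pdy_cst
  | apply: pdyD | apply: pdyN | apply: pdyX | apply: pdyM ].

(* For c = 1 these functions are - arg (1 - z) and |1 - z|^-2;
   taking c > 1 makes them smooth up to the unit circle. *)
Section angle.
Context {R : realType}.
Variable c : R.
Hypothesis c1 : 1 < c.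
Implicit Types w : R * R.

Definition ang w : R := atan (w.2 * (c - w.1)^-1).
Definition Rho w : R := ((c - w.1) ^+ 2 + w.2 ^+ 2)^-1.

Lemma cldisc_cgt w : cldisc w -> c - 1 <= c - w.1.
Proof. by move=> /cldisc_fst_le1/andP[? ?]; lra. Qed.

Lemma dist_ge w : cldisc w -> (c - 1) ^+ 2 <= (c - w.1) ^+ 2 + w.2 ^+ 2.
Proof. by move=> /cldisc_cgt ?; move: c1 => ?; nra. Qed.

Lemma dist_neq0 w : cldisc w -> (c - w.1) ^+ 2 + w.2 ^+ 2 != 0.
Proof. by move=> /dist_ge ?; move: c1 => ?; rewrite gt_eqF//; nra. Qed.

Lemma cfst_neq0 w : cldisc w -> c - w.1 != 0.
Proof. by move=> /cldisc_cgt ?; move: c1 => ?; rewrite gt_eqF//; nra. Qed.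

Lemma tame_Rho : tame Rho.
Proof.
apply: (@tameV _ _ ((c - 1) ^+ 2)); first by rewrite exprn_gt0// subr_gt0.
  by tame_tac.
exact: dist_ge.
Qed.

Lemma tame_ang : tame ang.
Proof.
have tV : tame (fun w : R * R => w.2 * (c - w.1)^-1).
  apply: tameM; first exact: tame_snd.
  apply: (@tameV _ _ (c - 1)); [by rewrite subr_gt0|by tame_tac|exact: cldisc_cgt].
split.
- apply: measurableT_comp; last exact: tame_measurable.
  by apply: continuous_measurable_fun => x; exact: continuous_atan.
- by exists (pi / 2) => w _; rewrite ler_norml !ltW// ?atan_gtNpi2 ?atan_ltpi2.
- move=> w wd; apply: (cvg_comp _ _ (tame_contx tV wd)).
  exact: continuous_atan.
- move=> w wd; apply: (cvg_comp _ _ (tame_conty tV wd)).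
  exact: continuous_atan.
Qed.

Lemma pdx_Rho : pdx Rho (fun w => 2 * (c - w.1) * Rho w ^+ 2).
Proof.
have h : pdx (fun w => (c - w.1) ^+ 2 + w.2 ^+ 2) (fun w => - 2 * (c - w.1)).
  by apply: pdx_eq; [pdx_tac|move=> w _ /=; ring].
move=> w wd; apply: (is_derive_eq (pdx_inv dist_neq0 h wd)).
by rewrite /Rho exprVn; ring.
Qed.

Lemma pdy_Rho : pdy Rho (fun w => - 2 * w.2 * Rho w ^+ 2).
Proof.
have h : pdy (fun w => (c - w.1) ^+ 2 + w.2 ^+ 2) (fun w => 2 * w.2).
  by apply: pdy_eq; [pdy_tac|move=> w _ /=; ring].
move=> w wd; apply: (is_derive_eq (pdy_inv dist_neq0 h wd)).
by rewrite /Rho exprVn; ring.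
Qed.

Lemma pdx_ang : pdx ang (fun w => w.2 * Rho w).
Proof.
have h : pdx (fun w => c - w.1) (fun w => - 1).
  by apply: pdx_eq; [pdx_tac|move=> w _ /=; ring].
have hV : pdx (fun w => w.2 * (c - w.1)^-1) (fun w => w.2 * (c - w.1)^-2).
  have hi := pdx_inv cfst_neq0 h.
  by apply: pdx_eq; [pdx_tac|move=> w _ /=; ring].
move=> [x y] wd; have d0 := cfst_neq0 wd; have d1 := dist_neq0 wd.
have H := is_derive1_comp (is_derive1_atan _) (hV (x, y) wd).
apply: (is_derive_eq H) => /=; rewrite /Rho /= in d0 d1 *.
by field; rewrite d0 d1.
Qed.

Lemma pdy_ang : pdy ang (fun w => (c - w.1) * Rho w).
Proof.
have hV : pdy (fun w => w.2 * (c - w.1)^-1) (fun w => (c - w.1)^-1).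
  move=> [x y] wd /=; apply: (is_derive_eq (is_deriveM _ _)) => //.
  by rewrite /GRing.scale/=; ring.
move=> [x y] wd; have d0 := cfst_neq0 wd; have d1 := dist_neq0 wd.
have H := is_derive1_comp (is_derive1_atan _) (hV (x, y) wd).
apply: (is_derive_eq H) => /=; rewrite /Rho /= in d0 d1 *.
by field; rewrite d0 d1.
Qed.

Section family.
Variables al be ga ka la : R.

(** A family of test functions with computable Laplacian. As [ang] is harmonic with |grad|^2 =
    [Rho], its square has Laplacian 2 [Rho]; the functions w.1 and (c - w.1) [Rho] = Re (1/(c - z))
    are harmonic and serve as correctors; |z|^2 has Laplacian 4. *)
Definition ufam w := al * ang w ^+ 2 + be + ga * w.1 + ka * ((c - w.1) * Rho w)
  + la * (w.1 ^+ 2 + w.2 ^+ 2).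
Definition ufamx w := 2 * al * ang w * (w.2 * Rho w) + ga
  + ka * (2 * (c - w.1) ^+ 2 * Rho w ^+ 2 - Rho w) + 2 * la * w.1.
Definition ufamy w := 2 * al * ang w * ((c - w.1) * Rho w)
  - 2 * ka * (c - w.1) * w.2 * Rho w ^+ 2 + 2 * la * w.2.
Definition ufamxx w := 2 * al * (w.2 ^+ 2 * Rho w ^+ 2
    + 2 * ang w * w.2 * (c - w.1) * Rho w ^+ 2)
  + ka * (8 * (c - w.1) ^+ 3 * Rho w ^+ 3 - 6 * (c - w.1) * Rho w ^+ 2) + 2 * la.
Definition ufamyy w := 2 * al * ((c - w.1) ^+ 2 * Rho w ^+ 2
    - 2 * ang w * w.2 * (c - w.1) * Rho w ^+ 2)
  + ka * (8 * (c - w.1) * w.2 ^+ 2 * Rho w ^+ 3 - 2 * (c - w.1) * Rho w ^+ 2) + 2 * la.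

Lemma pdx_ufam : pdx ufam ufamx.
Proof.
have ? := pdx_ang; have ? := pdx_Rho.
by apply: pdx_eq; [pdx_tac|move=> w _ /=; rewrite /ufamx; ring].
Qed.
Lemma pdy_ufam : pdy ufam ufamy.
Proof.
have ? := pdy_ang; have ? := pdy_Rho.
by apply: pdy_eq; [pdy_tac|move=> w _ /=; rewrite /ufamy; ring].
Qed.
Lemma pdx_ufamx : pdx ufamx ufamxx.
Proof.
have ? := pdx_ang; have ? := pdx_Rho.
by apply: pdx_eq; [pdx_tac|move=> w _ /=; rewrite /ufamxx; ring].
Qed.
Lemma pdy_ufamy : pdy ufamy ufamyy.
Proof.
have ? := pdy_ang; have ? := pdy_Rho.
by apply: pdy_eq; [pdy_tac|move=> w _ /=; rewrite /ufamyy; ring].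
Qed.
Lemma tame_ufam : tame ufam.
Proof. by have := tame_ang; have := tame_Rho => *; rewrite /ufam; tame_tac. Qed.
Lemma tame_ufamxx : tame ufamxx.
Proof. by have := tame_ang; have := tame_Rho => *; rewrite /ufamxx; tame_tac. Qed.
Lemma tame_ufamyy : tame ufamyy.
Proof. by have := tame_ang; have := tame_Rho => *; rewrite /ufamyy; tame_tac. Qed.
Lemma laplacian_ufam w : cldisc w -> ufamxx w + ufamyy w = 2 * al * Rho w + 4 * la.
Proof.
move=> wd; have d := dist_neq0 wd; rewrite /ufamxx /ufamyy /Rho.
by field.
Qed.
End family.
End angle.

(** * The disc automorphism and functions of 1 - |phi_a|^2 *)

Section moebius.
Context {R : realType}.
Variables p q : R.
Let A := p ^+ 2 + q ^+ 2.
Hypothesis A1 : A < 1.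
Implicit Types w : R * R.

(* With a = p + i q and phi_a the disc automorphism exchanging 0 and a:
   Nden = |1 - conj a z|^2, Xi = 1 - |phi_a|^2 and Jac = |phi_a'|^2, so that
   - ln (1 - Xi) is twice the Green function with pole a. *)
Definition Ydisc w : R := 1 - w.1 ^+ 2 - w.2 ^+ 2.
Definition Nden w : R := 1 - 2 * (p * w.1 + q * w.2) + A * (w.1 ^+ 2 + w.2 ^+ 2).
Definition Minv w : R := (Nden w)^-1.
Definition Xi w : R := (1 - A) * (Ydisc w * Minv w).
Definition Jac w : R := (1 - A) ^+ 2 * Minv w ^+ 2.

(** With s = p x + q y and r = x^2 + y^2, [Nden] is (1 - s)^2 + (A r - s^2). The second term is
    nonnegative by Cauchy-Schwarz, and s <= sqrt A <= (1 + A)/2. *)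
Lemma Nden_ge w : cldisc w -> ((1 - A) / 2) ^+ 2 <= Nden w.
Proof.
case: w => x y; rewrite /cldisc /Nden /= => wd.
have A0 : 0 <= A by rewrite /A; nra.
set s := p * x + q * y; set r := x ^+ 2 + y ^+ 2 in wd *.
have r0 : 0 <= r by rewrite /r; nra.
have sA : s ^+ 2 <= A * r.
  have : 0 <= (p * y - q * x) ^+ 2 by exact: sqr_ge0.
  by rewrite /s /A /r; nra.
have As : s ^+ 2 <= A by rewrite (le_trans sA)// -[leRHS]mulr1 ler_wpM2l.
have s1 : s <= (1 + A) / 2.
  rewrite leNgt; apply/negP => s1.
  have : 0 <= (1 - A) ^+ 2 by exact: sqr_ge0.
  by nra.
have : ((1 - A) / 2) ^+ 2 <= (1 - s) ^+ 2.
  by rewrite ler_pXn2r ?nnegrE//; move: A1; lra.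
by rewrite -/s; nra.
Qed.

Lemma Nden_neq0 w : cldisc w -> Nden w != 0.
Proof.
by move=> /Nden_ge h; rewrite gt_eqF// (lt_le_trans _ h)// exprn_gt0//; move: A1; lra.
Qed.

Lemma tame_Minv : tame Minv.
Proof.
apply: (@tameV _ _ (((1 - A) / 2) ^+ 2)); last exact: Nden_ge.
  by rewrite exprn_gt0//; move: A1; lra.
by rewrite /Nden; tame_tac.
Qed.

Definition Nx w := 2 * (A * w.1 - p).
Definition Ny w := 2 * (A * w.2 - q).

Lemma pdx_Minv : pdx Minv (fun w => - (Nx w * Minv w ^+ 2)).
Proof.
have h : pdx Nden Nx.
  by rewrite /Nden; apply: pdx_eq; [pdx_tac|move=> w _ /=; rewrite /Nx; ring].
by apply: (pdx_eq (pdx_inv Nden_neq0 h)) => w _; rewrite /Minv exprVn; ring.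
Qed.

Lemma pdy_Minv : pdy Minv (fun w => - (Ny w * Minv w ^+ 2)).
Proof.
have h : pdy Nden Ny.
  by rewrite /Nden; apply: pdy_eq; [pdy_tac|move=> w _ /=; rewrite /Ny; ring].
by apply: (pdy_eq (pdy_inv Nden_neq0 h)) => w _; rewrite /Minv exprVn; ring.
Qed.

Definition Xix w := (1 - A) * (- 2 * w.1 * Minv w - Ydisc w * Nx w * Minv w ^+ 2).
Definition Xiy w := (1 - A) * (- 2 * w.2 * Minv w - Ydisc w * Ny w * Minv w ^+ 2).
Definition Xixx w := (1 - A) * (- 2 * Minv w + 4 * w.1 * Nx w * Minv w ^+ 2
  - 2 * A * Ydisc w * Minv w ^+ 2 + 2 * Ydisc w * Nx w ^+ 2 * Minv w ^+ 3).
Definition Xiyy w := (1 - A) * (- 2 * Minv w + 4 * w.2 * Ny w * Minv w ^+ 2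
  - 2 * A * Ydisc w * Minv w ^+ 2 + 2 * Ydisc w * Ny w ^+ 2 * Minv w ^+ 3).

Lemma pdx_Xi : pdx Xi Xix.
Proof.
have ? := pdx_Minv.
by rewrite /Xi /Ydisc; apply: pdx_eq; [pdx_tac|move=> w _ /=; rewrite /Xix /Ydisc /Nx; ring].
Qed.
Lemma pdy_Xi : pdy Xi Xiy.
Proof.
have ? := pdy_Minv.
by rewrite /Xi /Ydisc; apply: pdy_eq; [pdy_tac|move=> w _ /=; rewrite /Xiy /Ydisc /Ny; ring].
Qed.
Lemma pdx_Xix : pdx Xix Xixx.
Proof.
have ? := pdx_Minv.
by rewrite /Xix /Ydisc /Nx; apply: pdx_eq; [pdx_tac|move=> w _ /=; rewrite /Xixx /Ydisc /Nx; ring].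
Qed.
Lemma pdy_Xiy : pdy Xiy Xiyy.
Proof.
have ? := pdy_Minv.
by rewrite /Xiy /Ydisc /Ny; apply: pdy_eq; [pdy_tac|move=> w _ /=; rewrite /Xiyy /Ydisc /Ny; ring].
Qed.

Lemma tame_Ydisc : tame Ydisc.
Proof. by rewrite /Ydisc; tame_tac. Qed.
Lemma tame_Nx : tame Nx.
Proof. by rewrite /Nx; tame_tac. Qed.
Lemma tame_Ny : tame Ny.
Proof. by rewrite /Ny; tame_tac. Qed.
Lemma tame_Xi : tame Xi.
Proof. by have := tame_Minv; have := tame_Ydisc => *; rewrite /Xi; tame_tac. Qed.
Lemma tame_Jac : tame Jac.
Proof. by have := tame_Minv => *; rewrite /Jac; tame_tac. Qed.
Lemma tame_Xix : tame Xix.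
Proof.
by have := tame_Minv; have := tame_Ydisc; have := tame_Nx => *; rewrite /Xix; tame_tac.
Qed.
Lemma tame_Xiy : tame Xiy.
Proof.
by have := tame_Minv; have := tame_Ydisc; have := tame_Ny => *; rewrite /Xiy; tame_tac.
Qed.
Lemma tame_Xixx : tame Xixx.
Proof.
by have := tame_Minv; have := tame_Ydisc; have := tame_Nx => *; rewrite /Xixx; tame_tac.
Qed.
Lemma tame_Xiyy : tame Xiyy.
Proof.
by have := tame_Minv; have := tame_Ydisc; have := tame_Ny => *; rewrite /Xiyy; tame_tac.
Qed.

(** Since 1 - [Xi] = |phi_a|^2 with phi_a analytic, the squared gradient is 4 |phi_a|^2 |phi_a'|^2,
    and the Laplacian of |phi_a|^2 is 4 |phi_a'|^2. *)
Lemma grad_Xi w : cldisc w -> Xix w ^+ 2 + Xiy w ^+ 2 = 4 * (1 - Xi w) * Jac w.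
Proof.
move=> /Nden_neq0; rewrite /Xix /Xiy /Xi /Jac /Minv /Nx /Ny /Nden /Ydisc /A => h.
by field.
Qed.

Lemma laplacian_Xi w : cldisc w -> Xixx w + Xiyy w = - 4 * Jac w.
Proof.
move=> /Nden_neq0; rewrite /Xixx /Xiyy /Jac /Minv /Nx /Ny /Nden /Ydisc /A => h.
by field.
Qed.

(** The Laplacian of P(Xi) is P'(Xi) lap Xi + P''(Xi) |grad Xi|^2 = 4 Jac ((1 - x) P'' - P')(Xi),
    and the last factor is the derivative of (1 - x) P'. On the circle [Xi] is 0, so the two
    conditions on P at 0 remove the boundary terms. *)
Lemma green_Xi (P : {poly R}) (u ux uy uxx uyy : R * R -> R) :
  tame u -> tame uxx -> tame uyy ->
  pdx u ux -> pdy u uy -> pdx ux uxx -> pdy uy uyy ->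
  P.[0] = 0 -> P^`().[0] = 0 ->
  dint (fun w => P.[Xi w] * (uxx w + uyy w)) =
  dint (fun w => u w * (4 * Jac w * ((1 - 'X) * P^`())^`().[Xi w])).
Proof.
move=> tu tuxx tuyy du1 du2 du3 du4 P0 P'0.
have tX := tame_Xi; have tX1 := tame_Xix; have tX2 := tame_Xiy.
have tX3 := tame_Xixx; have tX4 := tame_Xiyy.
have tP := tame_horner P tX; have tP' := tame_horner P^`() tX.
have tP'' := tame_horner P^`()^`() tX.
have dP1 := pdx_horner P pdx_Xi; have dP2 := pdy_horner P pdy_Xi.
have d1 := pdx_Xix; have d2 := pdy_Xiy.
have dP3 : pdx (fun w => P^`().[Xi w] * Xix w)
    (fun w => P^`().[Xi w] * Xixx w + P^`()^`().[Xi w] * Xix w ^+ 2).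
  have h1 := pdx_horner P^`() pdx_Xi.
  by apply: pdx_eq; [pdx_tac|move=> w _ /=; ring].
have dP4 : pdy (fun w => P^`().[Xi w] * Xiy w)
    (fun w => P^`().[Xi w] * Xiyy w + P^`()^`().[Xi w] * Xiy w ^+ 2).
  have h1 := pdy_horner P^`() pdy_Xi.
  by apply: pdy_eq; [pdy_tac|move=> w _ /=; ring].
have tW1 : tame (fun w => P^`().[Xi w] * Xixx w + P^`()^`().[Xi w] * Xix w ^+ 2).
  by tame_tac.
have tW2 : tame (fun w => P^`().[Xi w] * Xiyy w + P^`()^`().[Xi w] * Xiy w ^+ 2).
  by tame_tac.
have D : (1 - 'X)^`() = -1 :> {poly R} by rewrite derivB derivX -polyC1 derivC sub0r.
rewrite (green tP tW1 tW2 tu tuxx tuyy dP1 dP2 dP3 dP4 du1 du2 du3 du4).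
  apply: eq_dint => w /rdisc_sub wd; congr (_ * _).
  transitivity (P^`().[Xi w] * (Xixx w + Xiyy w)
    + P^`()^`().[Xi w] * (Xix w ^+ 2 + Xiy w ^+ 2)); first by ring.
  rewrite (grad_Xi wd) (laplacian_Xi wd) derivM D.
  by rewrite !(hornerM, hornerD, hornerN, hornerC, hornerX); ring.
move=> w; rewrite /rcircle/= => wc.
have -> : Xi w = 0 by rewrite /Xi /Ydisc -addrA -opprD wc subrr mul0r mulr0.
by rewrite P0 P'0 !mul0r.
Qed.

(** phi_a maps the disc onto itself, so its Jacobian integrates to the area. In place of a change of
    variables, [Jac] - 1 is exhibited as the divergence of C grad Nden, with an explicit [C]
    vanishing on the circle. *)
Lemma dint_Jac_area : dint Jac = dint (fun=> 1 : R).
Proof.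
have tM := tame_Minv.
have hM := pdx_Minv; have hM' := pdy_Minv.
pose C w := Ydisc w * ((1 - A * (w.1 ^+ 2 + w.2 ^+ 2)) * Minv w ^+ 2 + Minv w) / 2
  - A / 4 * Ydisc w ^+ 2 * Minv w ^+ 2.
apply/eqP; rewrite -subr_eq0 -dintB; [|exact: tame_Jac|exact: tame_cst].
pose DX w := (- w.1 * ((1 - A * (w.1 ^+ 2 + w.2 ^+ 2)) * Minv w ^+ 2 + Minv w)
   + Ydisc w * (- 2 * A * w.1 * Minv w ^+ 2
      - 2 * (1 - A * (w.1 ^+ 2 + w.2 ^+ 2)) * Nx w * Minv w ^+ 3 - Nx w * Minv w ^+ 2) / 2
   + A * w.1 * Ydisc w * Minv w ^+ 2 + A / 2 * Ydisc w ^+ 2 * Nx w * Minv w ^+ 3) * Nx w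
   + C w * 2 * A.
pose DY w :=
  (- w.2 * ((1 - A * (w.1 ^+ 2 + w.2 ^+ 2)) * Minv w ^+ 2 + Minv w)
   + Ydisc w * (- 2 * A * w.2 * Minv w ^+ 2
      - 2 * (1 - A * (w.1 ^+ 2 + w.2 ^+ 2)) * Ny w * Minv w ^+ 3 - Ny w * Minv w ^+ 2) / 2
   + A * w.2 * Ydisc w * Minv w ^+ 2 + A / 2 * Ydisc w ^+ 2 * Ny w * Minv w ^+ 3) * Ny w
   + C w * 2 * A.
have hY := tame_Ydisc; have hNx := tame_Nx; have hNy := tame_Ny.
have tC : tame C by rewrite /C; tame_tac.
have tDX : tame DX by rewrite /DX; tame_tac.
have tDY : tame DY by rewrite /DY; tame_tac.
rewrite (@eq_dint _ _ (fun w => DX w + DY w)); last first.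
  move=> w /rdisc_sub /Nden_neq0.
  rewrite /DX /DY /C /Jac /Minv /Nx /Ny /Nden /Ydisc /A => h.
  by field.
rewrite dintD//.
have C0 w : rcircle w -> C w = 0.
  rewrite /rcircle/= /C /Ydisc -addrA -opprD => ->.
  by rewrite subrr expr0n/= !(mul0r, mulr0) subrr.
have dX : pdx (fun w => C w * Nx w) DX.
  rewrite /C /Ydisc /Nx; apply: pdx_eq; [pdx_tac|move=> w _ /=].
  by rewrite /DX /C /Ydisc /Nx; field.
have dY : pdy (fun w => C w * Ny w) DY.
  rewrite /C /Ydisc /Ny; apply: pdy_eq; [pdy_tac|move=> w _ /=].
  by rewrite /DY /C /Ydisc /Ny; field.
rewrite (dint_dx_eq0 tDX dX) ?(dint_dy_eq0 tDY dY) ?addr0// => w /C0 ->;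
  by rewrite mul0r.
Qed.
End moebius.

Section area.
Context {R : realType}.
Notation mu := (@lebesgue_measure R).

Lemma dint_area : dint (fun=> 1) = pi :> R.
Proof.
rewrite /dint /Rintegral integral_mkcond -integral21_prod_meas1/=; last first.
  rewrite -integrable_mkcond; last exact: measurable_rdisc.
  exact: (tame_integrable (tame_cst 1)).
pose c (y : R) := Num.sqrt (1 - y ^+ 2).
have -> : (\int[mu]_y fubini_G mu ((fun=> 1%:E) \_ rdisc) y =
    \int[mu]_(y in `[(-1)%R, 1%R]) (2 * c y)%:E)%E.
  rewrite [RHS]integral_mkcond; apply: eq_integral => y _.
  rewrite patchE; apply: etrans (xslice (fun=> 1) y) _.
  rewrite integral_cst//= mul1e lebesgue_measure_itv/= lte_fin.
  rewrite -/(c y); have c0 : 0 <= c y := sqrtr_ge0 _.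
  case: ifPn => [cc|]; last first.
    by rewrite -leNgt => cc; case: ifP => // _; congr EFin; lra.
  have : 0 < c y by lra.
  rewrite sqrtr_gt0 => y1; rewrite ifT; first by rewrite opprK -EFinD; congr EFin; ring.
  by rewrite inE/= in_itv/=; apply/andP; split; nra.
(* By the half-angle formula 2 atan (y / (1 + c y)) is arcsin y; this form is visibly continuous up
   to the endpoints, where the argument of atan is 1 or -1. *)
pose G (y : R) := y * c y + 2 * atan (y * (1 + c y)^-1).
have cc (y : R) : {for y, continuous c}.
  apply: continuous_comp; last exact: sqrt_continuous.
  by apply: cvgB; [exact: cvg_cst|exact: exprn_continuous].
have c1 y : 0 < 1 + c y by rewrite ltr_wpDr ?sqrtr_ge0.
have Gc (y : R) : {for y, continuous G}.
  apply: cvgD; first by apply: cvgM; [exact: cvg_id|exact: cc].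
  apply: cvgM; first exact: cvg_cst.
  have h : {for y, continuous (fun t : R => t * (1 + c t)^-1)}.
    apply: cvgM; first exact: cvg_id.
    apply: cvgV; first by rewrite gt_eqF.
    by apply: cvgD; [exact: cvg_cst|exact: cc].
  by apply: (cvg_comp _ _ h); exact: continuous_atan.
have dG (y : R) : y \in `](-1), 1[ -> is_derive y 1 G (2 * c y).
  rewrite in_itv/= => /andP[y1 y2].
  have y0 : 0 < 1 - y ^+ 2 by nra.
  have c0 : 0 < c y by rewrite sqrtr_gt0.
  have cE : c y ^+ 2 = 1 - y ^+ 2 by rewrite sqr_sqrtr// ltW.
  have dq : is_derive y 1 (fun t : R => 1 - t ^+ 2) (- 2 * y).
    by apply: is_derive_eq; rewrite /GRing.scale/=; ring.
  have dc : is_derive y 1 c ((2 * Num.sqrt (1 - y ^+ 2))^-1 * (- 2 * y)) :=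
    @is_derive1_comp _ Num.sqrt (fun t : R => 1 - t ^+ 2) _ _ _ (is_derive1_sqrt y0) dq.
  have d1c : is_derive y 1 (fun t : R => 1 + c t) (0 + (2 * Num.sqrt (1 - y ^+ 2))^-1 * (- 2 * y)).
    by apply: is_deriveD => //; exact: is_derive_cst.
  have c1y : 1 + c y != 0 by rewrite gt_eqF.
  have dV := @is_deriveV _ (fun t : R => 1 + c t) _ _ _ c1y d1c.
  have dm := @is_deriveM _ _ id (fun t : R => (1 + c t)^-1) _ _ _ _ (is_derive_id y 1) dV.
  have da := @is_derive1_comp _ atan (fun t : R => t * (1 + c t)^-1) _ _ _
    (is_derive1_atan _) dm.
  have dG := is_deriveD (@is_deriveM _ _ id c _ _ _ _ (is_derive_id y 1) dc) (is_deriveZ 2 da).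
  apply: (is_derive_eq dG); rewrite /GRing.scale/= -/(c y).
  have -> : 1 + (y * (1 + c y)^-1) ^+ 2 = 2 / (1 + c y).
    rewrite exprMn (_ : y ^+ 2 = 1 - c y ^+ 2); last by rewrite cE; ring.
    by field.
  have yy : y * y = 1 - c y ^+ 2 by rewrite cE; ring.
  have cn : c y != 0 by rewrite gt_eqF.
  transitivity (c y - (y * y) / c y + (y * y) / (c y * (1 + c y)) + 1).
    by field; rewrite cn c1y.
  by rewrite yy; field; rewrite cn c1y.
rewrite (@continuous_FTC2 _ _ G)//=.
- rewrite /G /c sqrrN !expr1n subrr sqrtr0 addr0 invr1 !mulr1 !mulr0 !add0r.
  by rewrite atanN atan1; field.
- apply: continuous_in_subspaceT => y _; apply: cvgM; [exact: cvg_cst|exact: cc].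
- split.
  + by move=> y yI; have ? := dG _ yI; exact: ex_derive.
  + by apply: cvg_at_right_filter; exact: Gc.
  + by apply: cvg_at_left_filter; exact: Gc.
- by move=> y yI; rewrite derive1E; have ? := dG _ yI; exact: derive_val.
Qed.
End area.

(** * Polynomial kernels approximating the Green function *)

Section kernel_poly.
Context {R : realType}.
Variables m n : nat.

(* Approximates x |-> - ln (1 - x) from below.  The second term makes the
   derivative vanish at 0, so that kpoly (Xi w) vanishes to second order on the
   circle and Green's formula has no boundary term. *)
Definition kpoly : {poly R} :=
  \sum_(k < n.+1) k.+1%:R^-1 *: 'X^(k.+1) - m.+1%:R^-1 *: (1 - (1 - 'X) ^+ m.+1).

Lemma kpolyE x : kpoly.[x] = \sum_(k < n.+1) x ^+ k.+1 / k.+1%:R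
  - (1 - (1 - x) ^+ m.+1) / m.+1%:R.
Proof.
rewrite /kpoly !(hornerD, hornerN, hornerZ, horner_sum, horner_exp, hornerC, hornerX).
congr (_ - _); last by rewrite mulrC.
by apply: eq_bigr => i _; rewrite hornerZ hornerXn mulrC.
Qed.

Lemma kpoly0 : kpoly.[0] = 0.
Proof.
rewrite kpolyE subr0 expr1n subrr mul0r subr0 big1// => i _.
by rewrite expr0n mul0r.
Qed.

Lemma deriv_kpoly : kpoly^`() = \sum_(k < n.+1) 'X^k - (1 - 'X) ^+ m.
Proof.
rewrite /kpoly derivB derivZ derivB -polyC1 derivC deriv_exp.
rewrite derivB derivC derivX !sub0r mulN1r; congr (_ - _).
  rewrite raddf_sum /=; apply: eq_bigr => k _.
  rewrite derivZ derivXn -scalerMnr scalerMnl -mulr_natr mulVf ?pnatr_eq0 ?scale1r//.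
by rewrite mulNrn opprK -scalerMnr scalerMnl -mulr_natr mulVf ?scale1r// pnatr_eq0.
Qed.

Lemma deriv_kpoly0 : kpoly^`().[0] = 0.
Proof.
rewrite deriv_kpoly hornerD horner_sum big_ord_recl/= big1 ?addr0; last first.
  by move=> i _; rewrite hornerXn expr0n.
by rewrite !(hornerN, hornerD, horner_exp, hornerC, hornerX) subr0 expr1n expr0 subrr.
Qed.

(** By the geometric sum, (1 - x) [kpoly]' is 1 - x^(n+1) - (1 - x)^(m+1). At x = [Xi] the first
    resulting density concentrates on the circle (x = 0), the second at the pole a (x = 1). *)
Lemma kpoly_flux x : ((1 - 'X) * kpoly^`())^`().[x] =
  m.+1%:R * (1 - x) ^+ m - n.+1%:R * x ^+ n.
Proof.
have -> : (1 - 'X) * kpoly^`() = 1 - 'X^(n.+1) - (1 - 'X) ^+ m.+1.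
  rewrite deriv_kpoly mulrBr -exprS; congr (_ - _).
  by rewrite -opprB -[in RHS]opprB mulNr subrX1.
rewrite !derivB -polyC1 derivC derivXn deriv_exp derivB derivC derivX !sub0r.
rewrite mulN1r mulNrn opprK !(hornerN, hornerD, hornerMn, horner_exp, hornerC, hornerX).
by rewrite addrC !mulr_natl.
Qed.

End kernel_poly.

(** * Mass and concentration of the two densities *)

Section mass.
Context {R : realType}.
Variables p q : R.
Hypothesis A1 : p ^+ 2 + q ^+ 2 < 1.
Implicit Types w : R * R.
Notation xi := (Xi p q).
Notation T := (Jac p q).

Let tXi := tame_Xi A1.
Let tT := tame_Jac A1.

Lemma green_ufam (c al be ga ka la : R) (m n : nat) : 1 < c ->
  dint (fun w => (@kpoly R m n).[xi w] * (2 * al * Rho c w + 4 * la)) =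
  dint (fun w => ufam c al be ga ka la w *
    (4 * T w * (m.+1%:R * (1 - xi w) ^+ m - n.+1%:R * xi w ^+ n))).
Proof.
move=> c1.
under [RHS]eq_dint do rewrite -kpoly_flux.
rewrite -(green_Xi A1 (tame_ufam c1 _ _ _ _ _) (tame_ufamxx c1 al ka la) (tame_ufamyy c1 al ka la)
  (pdx_ufam c1 _ _ _ _ _) (pdy_ufam c1 _ _ _ _ _) (pdx_ufamx c1 _ _ _ _) (pdy_ufamy c1 _ _ _)
  (kpoly0 m n) (deriv_kpoly0 m n)).
by apply: eq_dint => w /rdisc_sub wd; rewrite (laplacian_ufam c1).
Qed.

(** Green's formula for the constant function 1: its Laplacian is 0, so the two densities carry the
    same mass. *)
Lemma dint_mass_flux (m n : nat) :
  dint (fun w => T w * (m.+1%:R * (1 - xi w) ^+ m)) =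
  dint (fun w => T w * (n.+1%:R * xi w ^+ n)).
Proof.
have c2 : 1 < 2 :> R by rewrite ltr1n.
have t1 : tame (fun w => T w * (m.+1%:R * (1 - xi w) ^+ m)) by tame_tac.
have t2 : tame (fun w => T w * (n.+1%:R * xi w ^+ n)) by tame_tac.
have := green_ufam 0 1 0 0 0 m n c2.
rewrite (@eq_dint _ _ (fun=> 0 * 1)); last by move=> w _; ring.
rewrite dintZ ?mul0r; last exact: tame_cst.
rewrite (@eq_dint _ (fun w => ufam _ _ _ _ _ _ w * _)
  (fun w => 4 * (T w * (m.+1%:R * (1 - xi w) ^+ m) - T w * (n.+1%:R * xi w ^+ n)))); last first.
  by move=> w _; rewrite /ufam; ring.
rewrite dintZ; last exact: tameB.
rewrite dintB// => /esym/eqP; rewrite mulf_eq0 subr_eq0 => /orP[|/eqP//].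
by rewrite pnatr_eq0.
Qed.

(** Both masses are independent of m and n, and for exponent 0 the integrand is the Jacobian. *)
Lemma dint_mass0 (n : nat) : dint (fun w => T w * (n.+1%:R * xi w ^+ n)) = pi.
Proof.
rewrite -(dint_mass_flux 0) (dint_mass_flux 0 0) -[RHS](dint_area (R := R)) -(dint_Jac_area A1).
by apply: eq_dint => w _; rewrite expr0 !mulr1.
Qed.

Lemma dint_mass1 (m : nat) : dint (fun w => T w * (m.+1%:R * (1 - xi w) ^+ m)) = pi.
Proof. by rewrite (dint_mass_flux m 0) dint_mass0. Qed.

Lemma natrV_step (n : nat) : pi - n.+1%:R / n.+2%:R * pi = pi / n.+2%:R :> R.
Proof.
have n2 : n.+2%:R != 0 :> R by rewrite pnatr_eq0.
rewrite [X in _ - X / _ * _](_ : _ = n.+2%:R - 1); last by rewrite -[n.+2]addn1 natrD addrK.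
by field.
Qed.

(** Rate of concentration at the pole: (n+1) x^n (1 - x) is (n+1) x^n minus (n+1)/(n+2) times the
    next density of the family, and both densities have mass pi. *)
Lemma dint_defect0 (n : nat) :
  dint (fun w => T w * (n.+1%:R * xi w ^+ n) * (1 - xi w)) = pi / n.+2%:R.
Proof.
have n2 : n.+2%:R != 0 :> R by rewrite pnatr_eq0.
have t1 : tame (fun w => T w * (n.+1%:R * xi w ^+ n)) by tame_tac.
have t2 : tame (fun w => T w * (n.+2%:R * xi w ^+ n.+1)) by tame_tac.
rewrite (@eq_dint _ _ (fun w => T w * (n.+1%:R * xi w ^+ n) -
   n.+1%:R / n.+2%:R * (T w * (n.+2%:R * xi w ^+ n.+1)))); last first.
  by move=> w _; rewrite [xi w ^+ n.+1]exprS; field.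
by rewrite dintB ?dintZ ?dint_mass0 ?natrV_step//; apply: tameM => //; exact: tame_cst.
Qed.

Lemma dint_defect1 (n : nat) :
  dint (fun w => T w * (n.+1%:R * (1 - xi w) ^+ n) * xi w) = pi / n.+2%:R.
Proof.
have n2 : n.+2%:R != 0 :> R by rewrite pnatr_eq0.
have t1 : tame (fun w => T w * (n.+1%:R * (1 - xi w) ^+ n)) by tame_tac.
have t2 : tame (fun w => T w * (n.+2%:R * (1 - xi w) ^+ n.+1)) by tame_tac.
rewrite (@eq_dint _ _ (fun w => T w * (n.+1%:R * (1 - xi w) ^+ n) -
   n.+1%:R / n.+2%:R * (T w * (n.+2%:R * (1 - xi w) ^+ n.+1)))); last first.
  by move=> w _; rewrite [(1 - xi w) ^+ n.+1]exprS; field.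
by rewrite dintB ?dintZ ?dint_mass1 ?natrV_step//; apply: tameM => //; exact: tame_cst.
Qed.

Lemma Jac_ge0 w : 0 <= T w.
Proof. by rewrite /Jac mulr_ge0// sqr_ge0. Qed.

Lemma Xi_ge0 w : cldisc w -> 0 <= xi w.
Proof.
move=> wd; apply: mulr_ge0; first by rewrite subr_ge0 ltW.
apply: mulr_ge0.
  by move: wd; rewrite /cldisc /Ydisc/=; lra.
rewrite invr_ge0 (le_trans _ (Nden_ge A1 wd))// exprn_ge0// divr_ge0// subr_ge0 ltW//.
Qed.

(** The explicit form of |phi_a|^2: it shows that [Xi] <= 1, with equality only at the pole. *)
Lemma oneB_XiE w : cldisc w ->
  1 - xi w = ((w.1 - p) ^+ 2 + (w.2 - q) ^+ 2) * Minv p q w.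
Proof.
by move=> /(Nden_neq0 A1); rewrite /Xi /Minv /Ydisc /Nden => h; field.
Qed.

Lemma Minv_gt0 w : cldisc w -> 0 < Minv p q w.
Proof.
move=> wd; rewrite invr_gt0 (lt_le_trans _ (Nden_ge A1 wd))// exprn_gt0// divr_gt0//.
by rewrite subr_gt0.
Qed.

Lemma Xi_le1 w : cldisc w -> xi w <= 1.
Proof.
move=> wd; rewrite -subr_ge0 (oneB_XiE wd) mulr_ge0// ?addr_ge0 ?sqr_ge0//.
exact/ltW/Minv_gt0.
Qed.

(** Green's formula for u = -2 ang^2, whose Laplacian is -4 Rho. The density at the pole enters with
    a negative sign and is dropped; in the density at the circle 2 ang^2 is at most pi^2/2, because
    |atan| < pi/2, and the mass is pi. *)
Lemma potential_le (c : R) (n : nat) : 1 < c ->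
  dint (fun w => (@kpoly R n n).[xi w] * Rho c w) <= pi ^+ 3 / 2.
Proof.
move=> c1.
have tA := tame_ang c1; have tR := tame_Rho c1.
have tP := tame_horner (@kpoly R n n) tXi.
have tPR : tame (fun w => (@kpoly R n n).[xi w] * Rho c w) by tame_tac.
have t1 : tame (fun w => T w * (n.+1%:R * (1 - xi w) ^+ n)) by tame_tac.
have -> : dint (fun w => (@kpoly R n n).[xi w] * Rho c w) =
    dint (fun w => 2 * ang c w ^+ 2 *
      (T w * (n.+1%:R * (1 - xi w) ^+ n - n.+1%:R * xi w ^+ n))).
  have := green_ufam (-2) 0 0 0 0 n n c1.
  rewrite (@eq_dint _ _ (fun w => -4 * ((@kpoly R n n).[xi w] * Rho c w))); last first.
    by move=> w _; ring.
  rewrite (@eq_dint _ (fun w => ufam _ _ _ _ _ _ w * _) (fun w => -4 * (2 * ang c w ^+ 2 *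
      (T w * (n.+1%:R * (1 - xi w) ^+ n - n.+1%:R * xi w ^+ n))))); last first.
    by move=> w _; rewrite /ufam; ring.
  rewrite !dintZ//; last by tame_tac.
  by apply: mulfI; rewrite oppr_eq0 pnatr_eq0.
have -> : pi ^+ 3 / 2 = dint (fun w => pi ^+ 2 / 2 * (T w * (n.+1%:R * (1 - xi w) ^+ n))).
  by rewrite dintZ// dint_mass1; ring.
apply: le_dint; [by tame_tac|by tame_tac|move=> w /rdisc_sub wd].
have T0 := Jac_ge0 w; have x0 := Xi_ge0 wd; have x1 := Xi_le1 wd.
have a0 := sqr_ge0 (ang c w).
have a1 : 2 * ang c w ^+ 2 <= pi ^+ 2 / 2.
  have h1 := atan_gtNpi2 (w.2 * (c - w.1)^-1); have h2 := atan_ltpi2 (w.2 * (c - w.1)^-1).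
  by rewrite -/(ang c w) in h1 h2; nra.
have k1 : 0 <= n.+1%:R * (1 - xi w) ^+ n by rewrite mulr_ge0// exprn_ge0// subr_ge0.
have k2 : 0 <= n.+1%:R * xi w ^+ n by rewrite mulr_ge0// exprn_ge0.
apply: (@le_trans _ _ (2 * ang c w ^+ 2 * (T w * (n.+1%:R * (1 - xi w) ^+ n)))).
  apply: ler_wpM2l; first by rewrite mulr_ge0.
  by apply: ler_wpM2l => //; rewrite gerBl.
by apply: ler_wpM2r => //; exact: mulr_ge0.
Qed.

(** The hypotheses say that u is at most 0 on the circle and at least L at the pole, with errors
    linear in [xi] and 1 - [xi]. By the two defect lemmas each error costs K pi / (n+2). *)
Lemma potential_ge (c al be ga ka la K L : R) (n : nat) : 1 < c ->
  (forall w, rdisc w -> ufam c al be ga ka la w <= K * xi w) ->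
  (forall w, rdisc w -> L - K * (1 - xi w) <= ufam c al be ga ka la w) ->
  4 * pi * (L - 2 * K / n.+2%:R) <=
  dint (fun w => (@kpoly R n n).[xi w] * - (2 * al * Rho c w + 4 * la)).
Proof.
move=> c1 hu hl.
have tA := tame_ang c1; have tR := tame_Rho c1; have tu := tame_ufam c1 al be ga ka la.
have tP := tame_horner (@kpoly R n n) tXi.
set u := ufam c al be ga ka la in hu hl tu *.
have -> : dint (fun w => (@kpoly R n n).[xi w] * - (2 * al * Rho c w + 4 * la)) =
    dint (fun w => 4 * (u w * (T w * (n.+1%:R * xi w ^+ n)) -
      u w * (T w * (n.+1%:R * (1 - xi w) ^+ n)))).
  have := green_ufam al be ga ka la n n c1; rewrite -/u => /(congr1 (fun t => -1 * t)).
  rewrite -!dintZ; [|by tame_tac|by tame_tac].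
  rewrite (@eq_dint _ _ (fun w => (@kpoly R n n).[xi w] * - (2 * al * Rho c w + 4 * la))).
    by move=> ->; apply: eq_dint => w _; ring.
  by move=> w _; ring.
have -> : 4 * pi * (L - 2 * K / n.+2%:R) =
   dint (fun w => 4 * ((L * (T w * (n.+1%:R * xi w ^+ n)) -
                K * (T w * (n.+1%:R * xi w ^+ n) * (1 - xi w)))
            - K * (T w * (n.+1%:R * (1 - xi w) ^+ n) * xi w))).
  rewrite dintZ; last by tame_tac.
  rewrite dintB; [|by tame_tac|by tame_tac].
  rewrite dintB; [|by tame_tac|by tame_tac].
  rewrite dintZ; last by tame_tac.
  rewrite dintZ; last by tame_tac.
  rewrite dintZ; last by tame_tac.
  by rewrite dint_mass0 dint_defect0 dint_defect1; ring.
apply: le_dint; [by tame_tac|by tame_tac|move=> w wd].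
have T0 := Jac_ge0 w; have x0 := Xi_ge0 (rdisc_sub wd); have x1 := Xi_le1 (rdisc_sub wd).
have k1 : 0 <= T w * (n.+1%:R * (1 - xi w) ^+ n).
  by rewrite mulr_ge0// mulr_ge0// exprn_ge0// subr_ge0.
have k2 : 0 <= T w * (n.+1%:R * xi w ^+ n) by rewrite mulr_ge0// mulr_ge0// exprn_ge0.
apply: ler_wpM2l => //; apply: lerB.
- by apply: le_trans (ler_wpM2r k2 (hl w wd)); rewrite le_eqVlt; apply/orP; left; apply/eqP; ring.
- by apply: le_trans (ler_wpM2r k1 (hu w wd)) _; rewrite le_eqVlt; apply/orP; left; apply/eqP; ring.
Qed.
End mass.

Section kpoly_limit.
Context {R : realType}.

(** The remainder vanishes at 0 and has derivative t^(n+1) / (1 - t), so the mean value theorem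
    gives both bounds. *)
Lemma log_remainder (n : nat) (x : R) : 0 <= x < 1 ->
  0 <= - ln (1 - x) - \sum_(k < n.+1) x ^+ k.+1 / k.+1%:R <= x ^+ n.+1 / (1 - x).
Proof.
move=> /andP[x0 x1].
pose P : {poly R} := \sum_(k < n.+1) k.+1%:R^-1 *: 'X^(k.+1).
have PE t : P.[t] = \sum_(k < n.+1) t ^+ k.+1 / k.+1%:R.
  rewrite horner_sum; apply: eq_bigr => k _.
  by rewrite hornerZ hornerXn mulrC.
have dP t : t < 1 -> P^`().[t] = (1 - t ^+ n.+1) / (1 - t).
  move=> t1; have t1' : 1 - t != 0 by rewrite gt_eqF// subr_gt0.
  apply: (mulIf t1'); rewrite mulfVK//.
  rewrite raddf_sum horner_sum /= -[RHS]opprB subrX1 -mulNr opprB [LHS]mulrC; congr (_ * _).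
  apply: eq_bigr => k _.
  by rewrite derivZ derivXn -scalerMnr scalerMnl -mulr_natr mulVf ?pnatr_eq0// scale1r hornerXn.
pose g t := - ln (1 - t) - P.[t].
have dg (t : R) : t < 1 -> is_derive t 1 g (t ^+ n.+1 / (1 - t)).
  move=> t1.
  have d1 : is_derive t 1 (fun s : R => 1 - s) (0 - 1).
    exact: is_deriveB.
  have t0 : 0 < 1 - t by rewrite subr_gt0.
  have d2 := @is_derive1_comp _ (@ln R) (fun s : R => 1 - s) _ _ _ (is_derive1_ln t0) d1.
  apply: (is_derive_eq (is_deriveB (is_deriveN d2) (is_derive_poly P t))).
  by rewrite dP//; field; rewrite gt_eqF.
have cg : {within `[0, x], continuous g}.
  apply: continuous_in_subspaceT => t; rewrite inE/= in_itv/= => /andP[_ tx].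
  apply: differentiable_continuous; apply/derivable1_diffP.
  by have := dg t (le_lt_trans tx x1) => ?; exact: ex_derive.
have dgx (t : R) : t \in `]0, x[ -> is_derive t 1 g (t ^+ n.+1 / (1 - t)).
  by rewrite in_itv/= => /andP[_ tx]; apply: dg; exact: lt_trans x1.
have [t] := MVT_segment x0 dgx cg.
rewrite -PE; rewrite in_itv/= => /andP[t0 tx].
have g0 : g 0 = 0.
  rewrite /g subr0 ln1 PE big1 ?oppr0 ?addr0// => k _.
  by rewrite expr0n mul0r.
rewrite g0 !subr0 -/(g x) => ->.
have t1 : 0 < 1 - t by rewrite subr_gt0 (le_lt_trans tx).
have xx1 : 0 < 1 - x by rewrite subr_gt0.
apply/andP; split; first by rewrite mulr_ge0// divr_ge0 ?exprn_ge0// ltW.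
rewrite mulrAC ler_pdivrMr// mulrAC ler_pdivlMr//.
rewrite -[leRHS]mulr1 -!mulrA; apply: ler_pM.
- exact: exprn_ge0.
- by rewrite mulr_ge0// ltW.
- by rewrite lerXn2r.
- by nra.
Qed.

(** The subtracted term (1 - (1 - x)^(n+1)) / (n+1) is at most x, and x is already the first term of
    the sum. *)
Lemma kpoly_ge0 (n : nat) (x : R) : 0 <= x <= 1 -> 0 <= (@kpoly R n n).[x].
Proof.
move=> /andP[x0 x1]; rewrite kpolyE subr_ge0.
apply: (@le_trans _ _ x).
  rewrite ler_pdivrMr ?ltr0Sn//.
  rewrite -[X in X - _](expr1n _ n.+1) subrXX.
  rewrite (_ : 1 - (1 - x) = x); last by ring.
  rewrite ler_wpM2l// (_ : n.+1%:R = \sum_(i < n.+1) 1); last first.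
    by rewrite sumr_const card_ord.
  apply: ler_sum => i _; rewrite expr1n mul1r exprn_ile1 ?subr_ge0//; lra.
rewrite big_ord_recl/= expr1 divr1 lerDl sumr_ge0// => k _.
by rewrite divr_ge0// exprn_ge0.
Qed.

Lemma kpoly_le (n : nat) (x : R) : 0 <= x < 1 -> (@kpoly R n n).[x] <= - ln (1 - x).
Proof.
move=> x01; have /andP[h _] := log_remainder n x01; case/andP: x01 => x0 x1.
rewrite subr_ge0 in h; apply: le_trans h.
rewrite kpolyE gerBl divr_ge0// subr_ge0 exprn_ile1 ?subr_ge0//; lra.
Qed.

Lemma kpoly_cvg (x : R) : 0 <= x < 1 ->
  (@kpoly R n n).[x] @[n --> \oo] --> - ln (1 - x).
Proof.
move=> x01; have /andP[x0 x1] := x01.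
have xx1 : 0 < 1 - x by rewrite subr_gt0.
apply: (@squeeze_cvgr _ _ _ _ (fun n => - ln (1 - x) - (x ^+ n.+1 / (1 - x) + n.+1%:R^-1))
  (fun=> - ln (1 - x))).
- apply: nearW => n; rewrite kpoly_le// andbT kpolyE.
  have /andP[_ h] := log_remainder n x01.
  have : (1 - (1 - x) ^+ n.+1) / n.+1%:R <= n.+1%:R^-1.
    rewrite -[leRHS]mul1r ler_wpM2r// gerBl exprn_ge0//; lra.
  have aux (l S a b d : R) : l - S <= a -> b <= d -> l - (a + d) <= S - b by lra.
  exact: aux.
- rewrite -[X in _ --> X]subr0; apply: cvgB; first exact: cvg_cst.
  rewrite -[X in _ --> X]addr0; apply: cvgD; last exact: cvg_harmonic.
  rewrite -(mul0r (1 - x)^-1); apply: cvgM; last exact: cvg_cst.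
  rewrite (cvg_shiftS (fun n => x ^+ n)); apply: cvg_expr.
  by rewrite ger0_norm.
- exact: cvg_cst.
Qed.

End kpoly_limit.

(** * Upper bound for the Green potential *)

Section upper.
Context {R : realType}.
Variables p q : R.
Hypothesis A1 : p ^+ 2 + q ^+ 2 < 1.
Notation mu := (@lebesgue_measure R).
Notation mu2 := (mu \x mu)%E.
Notation xi := (Xi p q).

Lemma measurable_Xi : measurable_fun setT xi.
Proof. exact: tame_measurable (tame_Xi A1). Qed.

Lemma measurable_green : measurable_fun setT (fun w => - ln (1 - xi w)).
Proof.
apply: measurable_funN; apply: measurableT_comp; first exact: measurable_ln.
by apply: measurable_funB => //; exact: measurable_Xi.
Qed.

Lemma measurable_Rho (c : R) : measurable_fun setT (Rho c).
Proof.
apply: (measurableT_comp measurable_funV); apply: measurable_funD; apply: measurable_funX.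
  by apply: measurable_funB => //; exact: measurable_fst.
exact: measurable_snd.
Qed.

Lemma green_ge0 w : rdisc w -> 0 <= - ln (1 - xi w).
Proof. by move=> wd; rewrite oppr_ge0 ln_le0// gerBl (Xi_ge0 A1)//; exact: rdisc_sub. Qed.

Lemma rdisc_fst w : rdisc w -> w.1 < (1 : R).
Proof. by rewrite /rdisc/= => h; nra. Qed.

(** Fatou's lemma applied to [potential_le], with n tending to infinity and c to 1
    simultaneously. *)
Lemma green_potential_le :
  (\int[mu2]_(w in rdisc) (Rho 1 w * - ln (1 - xi w))%:E <= (pi ^+ 3 / 2)%:E)%E.
Proof.
pose cn n : R := 1 + n.+1%:R^-1.
have cn1 n : 1 < cn n by rewrite ltrDl invr_gt0.
(* At the pole the limit integrand is 0, because [ln] 0 = 0, while the polynomials diverge there;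
   the value is reset to 0 so that convergence holds at every point. *)
pose f n w := (if xi w == 1 then 0 else (@kpoly R n n).[xi w] * Rho (cn n) w) : R.
have mk n : measurable_fun setT (fun w => (@kpoly R n n).[xi w] * Rho (cn n) w).
  apply: measurable_funM; last exact: measurable_Rho.
  exact: tame_measurable (tame_horner _ (tame_Xi A1)).
have mf n : measurable_fun setT (f n).
  by apply: measurable_fun_ifT => //; apply: measurable_fun_eqr => //; exact: measurable_Xi.
have k0 n w : rdisc w -> 0 <= (@kpoly R n n).[xi w] * Rho (cn n) w.
  move=> wd; rewrite mulr_ge0 ?kpoly_ge0 ?(Xi_ge0 A1) ?(Xi_le1 A1)//; try exact: rdisc_sub.
  by rewrite invr_ge0 addr_ge0 ?sqr_ge0.
have f0 n w : rdisc w -> 0 <= f n w.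
  by move=> wd; rewrite /f; case: ifP => // _; exact: k0.
have lf w : rdisc w -> f n w @[n --> \oo] --> Rho 1 w * - ln (1 - xi w).
  move=> wd; have [x1|x1] := eqVneq (xi w) 1.
    rewrite (_ : (fun n => f n w) = (fun=> 0)); last by apply/funext => n; rewrite /f x1 eqxx.
    by rewrite x1 subrr ln0// oppr0 mulr0; exact: cvg_cst.
  rewrite (_ : (fun n => f n w) = (fun n => Rho (cn n) w * (@kpoly R n n).[xi w])); last first.
    by apply/funext => n; rewrite /f (negbTE x1) mulrC.
  apply: cvgM; last first.
    apply: kpoly_cvg; rewrite (Xi_ge0 A1) ?lt_neqAle ?x1 ?(Xi_le1 A1)//; exact: rdisc_sub.
  apply: cvgV; first by rewrite gt_eqF// ltr_pwDl ?sqr_ge0// exprn_gt0// subr_gt0 rdisc_fst.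
  apply: cvgD; last exact: cvg_cst.
  under eq_fun do rewrite expr2; rewrite expr2.
  have h : cn n - w.1 @[n --> \oo] --> 1 - w.1.
    apply: cvgB; last exact: cvg_cst.
    rewrite -[X in _ --> X]addr0; apply: cvgD; [exact: cvg_cst|exact: cvg_harmonic].
  exact: cvgM.
have := @fatou _ _ R mu2 rdisc measurable_rdisc (fun n w => (f n w)%:E) _ _.
rewrite (_ : (\int[_]_(x in _) _)%E = (\int[mu2]_(w in rdisc) (Rho 1 w * - ln (1 - xi w))%:E)%E); last first.
  apply: eq_integral => w; rewrite inE => wd.
  have h : (f n w)%:E @[n --> \oo] --> (Rho 1 w * - ln (1 - xi w))%:E.
    by apply: cvg_EFin; [exact: nearW|exact: lf].
  by rewrite is_cvg_limn_einfE; [exact/cvg_lim|apply/cvg_ex; eexists; exact: h].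
move=> h; apply: le_trans (h _ _) _.
- by move=> n; apply/measurable_EFinP; apply: measurable_funTS; exact: mf.
- by move=> n w wd; rewrite lee_fin f0.
rewrite limn_einf_lim; apply: lime_le; first exact: is_cvg_einfs.
apply: nearW => n; apply: (@le_trans _ _ (\int[mu2]_(x in rdisc) (f n x)%:E)%E).
  by apply: ereal_inf_lbound; exists n => //=.
apply: (@le_trans _ _ (\int[mu2]_(w in rdisc) ((@kpoly R n n).[xi w] * Rho (cn n) w)%:E)%E).
  apply: ge0_le_integral => //.
  - exact: measurable_rdisc.
  - by move=> w wd; rewrite lee_fin f0.
  - by apply/measurable_EFinP; apply: measurable_funTS; exact: mf.
  - by apply/measurable_EFinP; apply: measurable_funTS; exact: mk.
  - by move=> w wd; rewrite lee_fin /f; case: ifP => // _; exact: k0.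
have tk : tame (fun w => (@kpoly R n n).[xi w] * Rho (cn n) w).
  by apply: tameM; [exact: tame_horner _ (tame_Xi A1)|exact: tame_Rho].
have := potential_le A1 n (cn1 n).
rewrite /dint /Rintegral -lee_fin fineK//.
by apply: integrable_fin_num; [exact: measurable_rdisc|exact: (tame_integrable tk)].
Qed.
End upper.

(** * Lower bound for the Green potential *)

Section atan_bounds.
Context {R : realType}.

Lemma atan_sq_le (t : R) : atan t ^+ 2 <= t ^+ 2.
Proof.
have pos (s : R) : 0 <= s -> 0 <= atan s <= s.
  move=> s0; have h (x : R) : x \in `]0, s[ -> is_derive x 1 atan (1 + x ^+ 2)^-1.
    by move=> _; exact: is_derive1_atan.
  have cat : {within `[0, s], continuous (@atan R)}.
    by apply: continuous_in_subspaceT => x _; exact: continuous_atan.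
  have [x _] := MVT_segment s0 h cat; rewrite atan0 !subr0 => ->.
  have x2 : 0 <= x ^+ 2 := sqr_ge0 x.
  rewrite mulr_ge0 ?invr_ge0 ?addr_ge0//= -[leRHS]mul1r ler_wpM2r// invf_le1//; lra.
have [t0|t0] := leP 0 t.
  by have /andP[? ?] := pos t t0; rewrite ler_pXn2r ?nnegrE.
have t0' : 0 <= - t by lra.
have /andP[? ?] := pos _ t0'.
by rewrite -[leLHS]sqrrN -atanN -[leRHS]sqrrN ler_pXn2r ?nnegrE.
Qed.

Lemma cos_pi4_sq : cos (pi / 4) ^+ 2 = 2^-1 :> R.
Proof.
have := cos_mulr2n (pi / 4 : R).
rewrite (_ : (pi / 4) *+ 2 = pi / 2); last by rewrite -mulr_natr; field.
rewrite cos_pihalf -mulr_natr => h; lra.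
Qed.

(** The constant adds the bounds of two cases. For |th| <= pi/4, cos^2 >= 1/2 and the gap is at most
    pi/2. Beyond pi/4, the mean value theorem writes cos |th| as sin x (pi/2 - |th|) with sin^2 x >=
    1/2. *)
Lemma gap_sq_le (th : R) : - (pi / 2) < th < pi / 2 ->
  (pi / 2 - `|th|) ^+ 2 <= (2 + pi ^+ 2 / 2) * cos th ^+ 2.
Proof.
move=> /andP[t1 t2]; rewrite -(cos_norm th).
have pi0 := @pi_gt0 R.
have : `|th| < pi / 2 by rewrite ltr_norml t1.
have : 0 <= `|th| by exact: normr_ge0.
set s := `|th| => s0 s1.
have c0 : 0 <= cos s by apply: cos_ge0_pihalf; lra.
have p4 : 0 <= cos (pi / 4) :> R by apply: cos_ge0_pihalf; lra.
have [s4|s4] := leP s (pi / 4).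
  have : cos (pi / 4) <= cos s.
    rewrite leNgt ltr_cos ?in_itv/=; lra.
  rewrite -(@ler_pXn2r _ 2%N) ?nnegrE// cos_pi4_sq => h.
  apply: (@le_trans _ _ (pi ^+ 2 / 2 * cos s ^+ 2)); last first.
    by rewrite ler_wpM2r ?sqr_ge0//; lra.
  by nra.
have dcos (x : R) : x \in `]s, (pi / 2)[ -> is_derive x 1 cos (- sin x).
  by move=> _; exact: is_derive_cos.
have ccos : {within `[s, pi / 2], continuous (@cos R)}.
  by apply: continuous_in_subspaceT => x _; exact: continuous_cos.
have [x] := MVT_segment (ltW s1) dcos ccos.
rewrite in_itv/= cos_pihalf sub0r mulNr => /andP[sx xp] /oppr_inj csE.
have cx0 : 0 <= cos x by apply: cos_ge0_pihalf; lra.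
have cx : cos x <= cos (pi / 4) by rewrite leNgt ltr_cos ?in_itv/=; clear -pi0 s0 s4 sx xp; lra.
have : cos x ^+ 2 <= 2^-1 by rewrite -cos_pi4_sq ler_pXn2r ?nnegrE.
have := cos2Dsin2 x; rewrite csE exprMn => e1 e2.
have s2 : 2^-1 <= sin x ^+ 2 by lra.
have g0 : 0 <= (pi / 2 - s) ^+ 2 := sqr_ge0 _.
have q0 : 0 <= sin x ^+ 2 := sqr_ge0 _.
have p2 : 0 <= pi ^+ 2 / 2 :> R by rewrite divr_ge0// sqr_ge0.
have : (pi / 2 - s) ^+ 2 <= 2 * (sin x ^+ 2 * (pi / 2 - s) ^+ 2) by nra.
move=> /le_trans; apply; apply: ler_wpM2r; first exact: mulr_ge0.
by rewrite lerDl.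
Qed.

(** With gam = pi/2 - |atan t| the left side is 2 pi gam - 2 gam^2, and 2 pi gam <= e + pi^2 gam^2 /
    e. The factor (1 + t^2)^-1 is cos^2 (atan t), which for the angle of 1 - z on the unit circle is
    (1 - x)/2: a harmonic majorant of the gap that is only e at the point 1. *)
Lemma boundary_gap (e t : R) : 0 < e ->
  pi ^+ 2 / 2 - 2 * atan t ^+ 2 <=
  e + pi ^+ 2 / e * (2 + pi ^+ 2 / 2) * (1 + t ^+ 2)^-1.
Proof.
move=> e0; have pi0 := @pi_gt0 R.
have t1 := atan_gtNpi2 t; have t2 := atan_ltpi2 t.
have := @gap_sq_le (atan t); rewrite t1 t2 => /(_ isT).
have -> : cos (atan t) ^+ 2 = (1 + t ^+ 2)^-1.
  by rewrite cos_atan exprVn sqr_sqrtr// addr_ge0// sqr_ge0.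
have -> : atan t ^+ 2 = `|atan t| ^+ 2 by rewrite real_normK// num_real.
have : `|atan t| < pi / 2 by rewrite ltr_norml t1.
have : 0 <= `|atan t| by exact: normr_ge0.
set s := `|atan t| => s0 s1 h.
rewrite -mulrA; apply: (@le_trans _ _ (e + pi ^+ 2 / e * (pi / 2 - s) ^+ 2)); last first.
  by rewrite lerD2l ler_wpM2l// divr_ge0 ?sqr_ge0 ?ltW.
have : 0 <= (e - pi * (pi / 2 - s)) ^+ 2 / e by rewrite divr_ge0 ?sqr_ge0 ?ltW.
rewrite (_ : _ / e = e + pi ^+ 2 / e * (pi / 2 - s) ^+ 2 - 2 * pi * (pi / 2 - s)); last first.
  by field; rewrite gt_eqF.
have : 0 <= 2 * (pi / 2 - s) ^+ 2 by rewrite mulr_ge0// sqr_ge0.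
by nra.
Qed.
End atan_bounds.

Section lower.
Context {R : realType}.

(** The linear bookkeeping of [potential_profile], stated with variables so that [lra] sees the
    nonlinear terms as atoms. *)
Lemma upper_sum (e V V' a a3 a4 k1 k2 m : R) : V <= e + (a + a3) -> a3 <= m -> m <= k1 ->
  0 <= k2 -> 0 <= a4 -> V' <= V -> V' - e - a - a4 <= k1 + k2.
Proof. by lra. Qed.

Lemma lower_sum (e V V' a1 a2 b2 b3 b4 bt ct k k6 k7 cy tau A : R) :
  a1 <= bt + b3 -> a2 <= 2 * bt + b2 -> cy <= 2 * ct + b4 ->
  b3 + b2 + b4 <= e + k7 -> V - A <= V' -> A <= k6 -> 0 <= k -> 3 * bt + 2 * ct + 2 * tau = e ->
  0 <= tau ->
  V - 3 * e - (k + (k6 + k7)) <= V' - e - (a1 + a2) - cy.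
Proof. by lra. Qed.

(* The corrections to (1 - e) (pi^2/2 - 2 theta^2), where theta = arg (c - z),
   make the profile nonpositive on the unit circle while changing it little at
   the point p, for c - 1 much smaller than 1 - p. *)
Lemma potential_profile (e C : R) : 0 < e < 1 -> 0 <= C ->
  exists c p K ga be ka : R, [/\ 1 < c, 0 < p < 1,
   (forall w, rdisc w -> ufam c (-2 * (1 - e)) be ga ka C w <= K * Xi p 0 w) &
   (forall w, rdisc w -> (1 - e) * pi ^+ 2 / 2 - 3 * e - K * (1 - Xi p 0 w) <=
      ufam c (-2 * (1 - e)) be ga ka C w)].
Proof.
move=> /andP[e0 e1] C0; have pi0 := @pi_gt0 R.
(* B is the coefficient in [boundary_gap]; the existential keeps it opaque to the arithmetic
   tactics. *)
have [B BE] : exists B : R, B = pi ^+ 2 / e * (2 + pi ^+ 2 / 2) by eexists.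
have B0 : 0 <= B.
  by rewrite BE mulr_ge0 ?divr_ge0 ?addr_ge0 ?divr_ge0 ?sqr_ge0 ?(ltW e0).
(* tau is the distance from p to 1. The correctors cost 3 B tau + 2 C tau at p, as [t1], [t2] and
   [t3] show below; the extra 2 tau ensures 2 tau < 1. *)
have [tau tau0 tauE] : exists2 tau, 0 < tau & (3 * B + 2 * C + 2) * tau = e.
  have den0 : 0 < 3 * B + 2 * C + 2 by lra.
  exists (e / (3 * B + 2 * C + 2)); first exact: divr_gt0.
  by rewrite mulrC mulfVK// gt_eqF.
have tau1 : 2 * tau < 1 by nra.
(* d = c - 1 is of order tau^2, so that (c^2 - 1) / (c - p), the size at p of the corrector built on
   Re (1/(c - z)), is still of order tau. *)
have [d dE] : exists d, d = tau ^+ 2 by eexists.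
have [p pE] : exists p, p = 1 - tau by eexists.
have [c cE] : exists c, c = 1 + d by eexists.
have d0 : 0 < d by rewrite dE exprn_gt0.
have c1 : 1 < c by rewrite cE ltrDl.
have p01 : 0 < p < 1 by rewrite pE; apply/andP; split; lra.
have A1 : p ^+ 2 + 0 ^+ 2 < 1 by rewrite expr0n addr0 expr_lt1//; case/andP: p01 => // /ltW.
(* K2 collects the coefficients of |w.1 - p| in [t1], [t2] and [t3]. In K, the first summand pays
   for the error inside the circle ([t4]), 8 / d^2 for the angle ([angb]), and K2^2 / e for the
   linear deviation from p ([KZ]). *)
have [K2 K2E] : exists K2, K2 = B + B * (c ^+ 2 - 1) / (2 * d ^+ 2) + 2 * C by eexists.
pose K := 4 * B / (d * (1 - p ^+ 2)) + (8 / d ^+ 2 + K2 ^+ 2 / e).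
(* These values produce the form [uE], where the bracket multiplied by B equals cos^2 of the angle
   on the circle and [Ydisc] vanishes there. *)
pose be := (1 - e) * pi ^+ 2 / 2 - e - B / 2 - C.
pose ga := B / (2 * c); pose ka := - (B * (c ^+ 2 - 1) / (2 * c)).
exists c, p, K, ga, be, ka.
have pA : 0 < 1 - p ^+ 2 by move: A1; rewrite expr0n addr0 subr_gt0.
have Ka0 : 0 <= 4 * B / (d * (1 - p ^+ 2)).
  by apply: divr_ge0; [exact: mulr_ge0|exact/ltW/mulr_gt0].
have Kb0 : 0 <= 8 / d ^+ 2 + K2 ^+ 2 / e.
  by rewrite addr_ge0// divr_ge0 ?sqr_ge0// ltW.
have uE w : ufam c (-2 * (1 - e)) be ga ka C w =
   (1 - e) * (pi ^+ 2 / 2 - 2 * ang c w ^+ 2) - e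
   - B * ((c - w.1) / (2 * c) + (c ^+ 2 - 1) / (2 * c) * ((c - w.1) * Rho c w))
   - C * Ydisc w.
  by rewrite /ufam /be /ga /ka /Ydisc; field; rewrite gt_eqF// (lt_trans _ c1).
have hR w : rdisc w -> [/\ d <= c - w.1, 0 < Rho c w & (c - w.1) ^+ 2 * Rho c w <= 1].
  move=> wd; have x1 := rdisc_fst wd.
  have hd : d <= c - w.1 by rewrite cE; lra.
  have h2 : 0 < (c - w.1) ^+ 2 by rewrite exprn_gt0// (lt_le_trans d0).
  have y2 := sqr_ge0 w.2.
  split; [by []|by rewrite invr_gt0; lra|].
  by rewrite ler_pdivrMr ?mul1r; clear -h2 y2; lra.
have NE w : rdisc w -> [/\ 0 < Nden p 0 w & Nden p 0 w <= 4].
  move=> wd; split.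
    by rewrite -invr_gt0; apply: Minv_gt0 => //; exact: rdisc_sub.
  case/andP: p01 => p0 p1; case: w wd => x y; rewrite /rdisc /Nden /= => wd.
  rewrite !expr0n !mul0r !addr0; have x1 : -1 < x by nra.
  have : p ^+ 2 * (x ^+ 2 + y ^+ 2) <= 1.
    rewrite -[leRHS]mulr1 ler_pM ?sqr_ge0 ?addr_ge0 ?sqr_ge0//; last exact: ltW.
    by rewrite exprn_ile1// ltW.
  by nra.
split => //.
- move=> w wd; have [hd R0 hR1] := hR w wd; have [N0 N4] := NE w wd.
  have wc := rdisc_sub wd.
  have x0 := Xi_ge0 A1 wc.
  have v0 : 0 <= pi ^+ 2 / 2 - 2 * ang c w ^+ 2.
    have t1 := atan_gtNpi2 (w.2 * (c - w.1)^-1).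
    have t2 := atan_ltpi2 (w.2 * (c - w.1)^-1).
    by rewrite -/(ang c w) in t1 t2; nra.
  have h0 : c - w.1 != 0 by rewrite gt_eqF// (lt_le_trans d0).
  have h00 : 0 < c - w.1 by rewrite (lt_le_trans d0).
  have := @boundary_gap R e (w.2 * (c - w.1)^-1) e0; rewrite -/(ang c w) -BE.
  have -> : (1 + (w.2 * (c - w.1)^-1) ^+ 2)^-1 = (c - w.1) ^+ 2 * Rho c w.
    by rewrite /Rho; have := dist_neq0 c1 wc => n0; field; rewrite n0 h0.
  (* With Y = 1 - |z|^2 one has |c - z|^2 = 2 c (c - x) - (c^2 - 1) - Y. Solving for c - x expresses
     cos^2 of the angle by harmonic functions plus a multiple of Y. *)
  have -> : (c - w.1) ^+ 2 * Rho c w = (c - w.1) / (2 * c)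
     + (c ^+ 2 - 1) / (2 * c) * ((c - w.1) * Rho c w)
     + Ydisc w * ((c - w.1) * Rho c w) / (2 * c).
    rewrite /Rho /Ydisc; have := dist_neq0 c1 wc => n0; field.
    by rewrite n0 gt_eqF// (lt_trans _ c1).
  move=> gap; rewrite uE.
  have Y0 : 0 <= Ydisc w by clear -wc; move: wc; rewrite /cldisc /Ydisc/=; lra.
  have YX : Ydisc w * (1 - p ^+ 2) <= 4 * Xi p 0 w.
    rewrite (_ : 4 * Xi p 0 w = Ydisc w * (1 - p ^+ 2) * (4 / Nden p 0 w)); last first.
      by rewrite /Xi /Minv; ring.
    rewrite -[leLHS]mulr1; apply: ler_wpM2l; first by rewrite mulr_ge0// ltW.
    by rewrite ler_pdivlMr// mul1r.
  have hRd : (c - w.1) * Rho c w <= d^-1.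
    rewrite -(ler_pM2l d0) mulfV ?gt_eqF//.
    apply: le_trans hR1; rewrite expr2 -mulrA ler_wpM2r//.
    by rewrite mulr_ge0// ltW.
  have hR0 : 0 <= (c - w.1) * Rho c w by rewrite mulr_ge0// ltW.
  have t3 : Ydisc w * ((c - w.1) * Rho c w) / (2 * c) <= Ydisc w * d^-1.
    rewrite ler_pdivrMr; last by clear -c1; lra.
    rewrite -mulrA ler_wpM2l//; apply: (le_trans hRd).
    by rewrite ler_peMr ?invr_ge0 ?(ltW d0)//; clear -c1; lra.
  have t4 : B * (Ydisc w * d^-1) <= 4 * B / (d * (1 - p ^+ 2)) * Xi p 0 w.
    have -> : 4 * B / (d * (1 - p ^+ 2)) * Xi p 0 w =
      B / d * (4 * Xi p 0 w / (1 - p ^+ 2)).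
      by field; rewrite !gt_eqF.
    rewrite (_ : B * _ = B / d * Ydisc w); last by ring.
    apply: ler_wpM2l; first by rewrite divr_ge0// ltW.
    by rewrite ler_pdivlMr.
  have t5 : B * (Ydisc w * ((c - w.1) * Rho c w) / (2 * c)) <= B * (Ydisc w * d^-1).
    exact: ler_wpM2l.
  have CY : 0 <= C * Ydisc w by rewrite mulr_ge0.
  have ev : (1 - e) * (pi ^+ 2 / 2 - 2 * ang c w ^+ 2) <= pi ^+ 2 / 2 - 2 * ang c w ^+ 2.
    by rewrite ler_piMl// gerBl ltW.
  have kx : 0 <= (8 / d ^+ 2 + K2 ^+ 2 / e) * Xi p 0 w by rewrite mulr_ge0.
  by rewrite /K [in leRHS]mulrDl; apply: (upper_sum _ t5 t4 kx CY ev); rewrite -mulrDr.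
- move=> w wd; have [hd R0 hR1] := hR w wd; have [N0 N4] := NE w wd.
  have wc := rdisc_sub wd.
  have x1 := Xi_le1 A1 wc.
  have h00 : 0 < c - w.1 by rewrite (lt_le_trans d0).
  pose s := 1 - Xi p 0 w.
  have s0 : 0 <= s by rewrite subr_ge0.
  (* s = 1 - [Xi] is |w - p|^2 / Nden with Nden <= 4, so s controls the squared distance to p. *)
  have sE : (w.1 - p) ^+ 2 + w.2 ^+ 2 <= 4 * s.
    rewrite /s (oneB_XiE A1 wc) subr0 /Minv mulrCA.
    rewrite -[leLHS]mulr1; apply: ler_wpM2l; first by rewrite addr_ge0 ?sqr_ge0.
    by rewrite ler_pdivlMr// mul1r.
  pose Z := `|w.1 - p|.
  have Z0 : 0 <= Z by exact: normr_ge0.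
  have Z2 : Z ^+ 2 <= 4 * s.
    by rewrite /Z real_normK ?num_real//; have := sqr_ge0 w.2; clear -sE; lra.
  have xZ : w.1 - p <= Z by exact: ler_norm.
  have xZ' : - Z <= w.1 - p by have := ler_norm (- (w.1 - p)); rewrite normrN -/Z lerNl.
  have angb : 2 * ang c w ^+ 2 <= 8 / d ^+ 2 * s.
    have := atan_sq_le (w.2 * (c - w.1)^-1); rewrite -/(ang c w) => h.
    have h1 : (w.2 * (c - w.1)^-1) ^+ 2 <= w.2 ^+ 2 / d ^+ 2.
      rewrite exprMn ler_wpM2l ?sqr_ge0// exprVn lef_pV2 ?posrE ?exprn_gt0//.
      by rewrite ler_pXn2r ?nnegrE// ltW.
    have : w.2 ^+ 2 / d ^+ 2 <= 4 * s / d ^+ 2.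
      rewrite ler_wpM2r ?invr_ge0 ?sqr_ge0//; have := sqr_ge0 (w.1 - p); clear -sE; lra.
    rewrite (_ : 8 / d ^+ 2 * s = 2 * (4 * s / d ^+ 2)); last ring.
    by move=> h2; rewrite ler_wpM2l// (le_trans h)// (le_trans h1).
  have cpE : c - p = d + tau by rewrite cE pE; ring.
  have cp0 : 0 < c - p by rewrite cpE addr_gt0.
  have cpd : d <= c - p by rewrite cpE lerDl ltW.
  have t1 : B * ((c - w.1) / (2 * c)) <= B * tau + B * Z.
    rewrite -mulrDr ler_wpM2l// ler_pdivrMr; last by clear -c1; lra.
    rewrite (_ : c - w.1 = c - p - (w.1 - p)); last by ring.
    have dt : d <= tau by rewrite dE expr2 ler_piMl ?ltW//; clear -tau1 tau0; lra.
    rewrite cpE; clear -dt c1 tau0 Z0 xZ'.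
    have : 0 <= (tau + Z) * (2 * c - 2) by rewrite mulr_ge0; lra.
    by nra.
  have t2 : B * ((c ^+ 2 - 1) / (2 * c) * ((c - w.1) * Rho c w)) <=
      B * (2 * tau) + B * (c ^+ 2 - 1) / (2 * d ^+ 2) * Z.
    have cc0 : 0 <= c ^+ 2 - 1 by rewrite subr_ge0 expr_ge1 ?ltW// (lt_trans ltr01).
    have hi : (c - w.1) * Rho c w <= (c - w.1)^-1.
      by rewrite -(ler_pM2l h00) mulfV ?gt_eqF// mulrA -expr2.
    have hz : (c - w.1)^-1 <= (c - p)^-1 + Z / d ^+ 2.
      rewrite -subr_ge0 (_ : _ - _ = Z / d ^+ 2 - (w.1 - p) / ((c - w.1) * (c - p))); last first.
        by field; rewrite !gt_eqF.
      rewrite subr_ge0; apply: (@le_trans _ _ (Z / ((c - w.1) * (c - p)))).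
        by rewrite ler_wpM2r// invr_ge0 mulr_ge0// ltW.
      apply: ler_wpM2l => //; rewrite lef_pV2 ?posrE.
      - by rewrite expr2 ler_pM// ltW.
      - exact: mulr_gt0.
      - exact: exprn_gt0.
    have hc : (c ^+ 2 - 1) / 2 * (c - p)^-1 <= 2 * tau.
      have cp2 : 0 < 2 * (c - p) by rewrite mulr_gt0.
      rewrite -mulrA -invfM ler_pdivrMr//.
      by rewrite cE pE dE; clear -tau0 tau1; nra.
    rewrite (_ : B * (2 * tau) + _ = B * (2 * tau + (c ^+ 2 - 1) / (2 * d ^+ 2) * Z)); last by ring.
    apply: ler_wpM2l => //.
    apply: (@le_trans _ _ ((c ^+ 2 - 1) / 2 * ((c - p)^-1 + Z / d ^+ 2))).
      apply: ler_pM => //.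
      - by rewrite divr_ge0// mulr_ge0// ltW// (lt_trans _ c1).
      - by rewrite mulr_ge0// ltW.
      - by rewrite ler_wpM2l// lef_pV2 ?posrE; clear -c1; lra.
      - exact: le_trans hi hz.
    rewrite mulrDr lerD//.
    rewrite le_eqVlt; apply/orP; left; apply/eqP; field; rewrite gt_eqF//.
  have t3 : C * Ydisc w <= C * (2 * tau) + 2 * C * Z.
    rewrite (_ : C * (2 * tau) + 2 * C * Z = C * (2 * tau + 2 * Z)); last by ring.
    rewrite ler_wpM2l// /Ydisc; have := sqr_ge0 w.2.
    have x1' := rdisc_fst wd; have x1'' : -1 < w.1 by clear -wd; move: wd; rewrite /rdisc/= => ?; nra.
    by rewrite pE in xZ xZ' *; clear -tau0 tau1 xZ xZ' x1' x1'' Z0; nra.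
  (* Young's inequality turns the linear deviation |w.1 - p| into a small constant plus a multiple
     of s. *)
  have KZ : K2 * Z <= e + K2 ^+ 2 / e * s.
    have : 0 <= (2 * e - K2 * Z) ^+ 2 / (4 * e) by rewrite divr_ge0 ?sqr_ge0// mulr_ge0// ltW.
    rewrite (_ : _ / _ = e - K2 * Z + K2 ^+ 2 / e * (Z ^+ 2 / 4)); last first.
      by field; rewrite gt_eqF.
    have : K2 ^+ 2 / e * (Z ^+ 2 / 4) <= K2 ^+ 2 / e * s.
      by rewrite ler_wpM2l ?divr_ge0 ?sqr_ge0 ?(ltW e0)// ler_pdivrMr// mulrC.
    by clear; lra.
  have ev : (1 - e) * (pi ^+ 2 / 2 - 2 * ang c w ^+ 2) >=
      (1 - e) * pi ^+ 2 / 2 - 2 * ang c w ^+ 2.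
    rewrite mulrBr -mulrA lerD2l lerN2 ler_piMl ?(mulr_ge0 _ (sqr_ge0 _))//.
    by rewrite gerBl ltW.
  have k0 : 0 <= 4 * B / (d * (1 - p ^+ 2)) * s by rewrite mulr_ge0.
  rewrite uE -/s /K [(_ + (_ + _)) * s]mulrDl [(8 / _ + _) * s]mulrDl [B * (_ + _)]mulrDr.
  apply: (@lower_sum _ _ _ _ _ (B * (c ^+ 2 - 1) / (2 * d ^+ 2) * Z) _ (2 * C * Z)
    (B * tau) (C * tau) _ _ _ _ tau _ t1 _ _ _ ev angb k0).
  - by rewrite (_ : 2 * (B * tau) = B * (2 * tau)); [exact: t2|ring].
  - by rewrite (_ : 2 * (C * tau) = C * (2 * tau)); [exact: t3|ring].
  - by rewrite -!mulrDl -K2E; exact: KZ.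
  - by rewrite -tauE; ring.
  - exact: ltW.
Qed.
End lower.

Section lower2.
Context {R : realType}.
Notation mu := (@lebesgue_measure R).
Notation mu2 := (mu \x mu)%E.

Lemma dintE (f : R * R -> R) : tame f ->
  (\int[mu2]_(w in rdisc) (f w)%:E)%E = (dint f)%:E.
Proof.
move=> tf; rewrite /dint /Rintegral fineK//.
by apply: integrable_fin_num; [exact: measurable_rdisc|exact: (tame_integrable tf)].
Qed.

Lemma negligible_point (p q : R) : mu2.-negligible [set (p, q)].
Proof.
exists ([set p] `*` [set q]); split.
- by apply: measurableX; exact: measurable_set1.
- rewrite product_measure1E; [|exact: measurable_set1|exact: measurable_set1].
  by rewrite [X in (X * _)%E]lebesgue_measure_set1 mul0e.
- by move=> _ ->.
Qed.

(** The profile with al = -2 (1 - e) and la = C satisfies - lap u = 4 ((1 - e) Rho - C), matching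
    the assumed lower bound for D; p depends only on e and C. D is intended to be |g'|^2 for f =
    1. *)
Lemma green_potential_ge (e C : R) : 0 < e < 1 -> 0 <= C ->
  exists2 p, 0 < p < 1 & forall D : R * R -> R, measurable_fun setT D ->
    (forall w, rdisc w -> 0 <= D w) ->
    (forall w, rdisc w -> (1 - e) * Rho 1 w - C <= D w) ->
    ((pi * ((1 - e) * pi ^+ 2 / 2 - 3 * e))%:E <=
       \int[mu2]_(w in rdisc) (D w * - ln (1 - Xi p 0 w))%:E)%E.
Proof.
move=> e01 C0; have /andP[e0 e1] := e01.
have [c [p [K [ga [be [ka [c1 p01 hu hl]]]]]]] := potential_profile e01 C0.
exists p => // D mD D0 hD.
have A1 : p ^+ 2 + 0 ^+ 2 < 1 by rewrite expr0n addr0; case/andP: p01 => *; nra.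
have pi0 := @pi_gt0 R.
set L := (1 - e) * pi ^+ 2 / 2 - 3 * e in hl *.
have mG := measurable_green A1.
have key n : ((pi * (L - 2 * K / n.+2%:R))%:E <=
    \int[mu2]_(w in rdisc) (D w * - ln (1 - Xi p 0 w))%:E)%E.
  pose k w := (@kpoly R n n).[Xi p 0 w].
  have tk : tame k by exact: tame_horner (tame_Xi A1).
  have tR := tame_Rho c1.
  have mk := tame_measurable tk.
  have k0 w : rdisc w -> 0 <= k w.
    by move=> wd; apply: kpoly_ge0; rewrite (Xi_ge0 A1) ?(Xi_le1 A1)//; exact: rdisc_sub.
  apply: (@le_trans _ _ (\int[mu2]_(w in rdisc) (D w * k w)%:E)%E); last first.
    (* [kpoly] lies below the logarithm except possibly at the pole, where [ln] 0 = 0; a single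
       point is negligible. *)
    apply: ae_ge0_le_integral.
    - exact: measurable_rdisc.
    - by move=> w wd; rewrite lee_fin mulr_ge0 ?D0 ?k0.
    - by apply/measurable_EFinP; apply: measurable_funTS; exact: measurable_funM.
    - by move=> w wd; rewrite lee_fin mulr_ge0 ?D0 ?(green_ge0 A1).
    - by apply/measurable_EFinP; apply: measurable_funTS; exact: measurable_funM.
    - apply: negligibleS (negligible_point p 0) => w /= /not_implyP[wd]; rewrite lee_fin => h.
      have wc := rdisc_sub wd.
      have [x1|x1] := eqVneq (Xi p 0 w) 1; last first.
        exfalso; apply: h; apply: ler_wpM2l; first exact: D0.
        by apply: kpoly_le; rewrite (Xi_ge0 A1)// lt_neqAle x1 (Xi_le1 A1).
      have := oneB_XiE A1 wc; rewrite x1 subrr => /esym/eqP.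
      rewrite mulf_eq0 (gt_eqF (Minv_gt0 A1 wc)) orbF subr0.
      rewrite paddr_eq0 ?sqr_ge0// !sqrf_eq0 subr_eq0 => /andP[/eqP w1 /eqP w2].
      by rewrite [w]surjective_pairing w1 w2.
  (* Since c > 1, Rho c <= Rho 1. The term with C is moved to the right so that all extended
     integrals have nonnegative integrands. *)
  have h1 : (((1 - e) * dint (fun w => k w * Rho c w))%:E <=
     \int[mu2]_(w in rdisc) (D w * k w)%:E + (C * dint k)%:E)%E.
    have tkR : tame (fun w => (1 - e) * (k w * Rho c w)) by tame_tac.
    have tCk : tame (fun w => C * k w) by tame_tac.
    have tkR0 : tame (fun w => k w * Rho c w) by tame_tac.
    rewrite -(dintZ _ tkR0) -(dintZ _ tk) -(dintE tkR) -(dintE tCk).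
    have mDk : measurable_fun rdisc (fun w => (D w * k w)%:E).
      by apply/measurable_EFinP; apply: measurable_funTS; exact: measurable_funM.
    have mCk : measurable_fun rdisc (fun w => (C * k w)%:E).
      by apply/measurable_EFinP; apply: measurable_funTS; exact: tame_measurable.
    have Dk0 w : rdisc w -> (0 <= (D w * k w)%:E)%E.
      by move=> wd; rewrite lee_fin mulr_ge0 ?D0 ?k0.
    have Ck0 w : rdisc w -> (0 <= (C * k w)%:E)%E.
      by move=> wd; rewrite lee_fin mulr_ge0 ?k0.
    rewrite -ge0_integralD; [|exact: measurable_rdisc|exact: Dk0|exact: mDk|exact: Ck0|exact: mCk].
    apply: ge0_le_integral.
    - exact: measurable_rdisc.
    - move=> w wd; rewrite lee_fin mulr_ge0 ?mulr_ge0 ?k0//; first lra.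
      by rewrite invr_ge0 addr_ge0 ?sqr_ge0.
    - by apply/measurable_EFinP; apply: measurable_funTS; exact: tame_measurable.
    - by apply: emeasurable_funD.
    - move=> w wd; rewrite -EFinD lee_fin -mulrDl mulrCA mulrC.
      apply: ler_wpM2r; first exact: k0.
      have : Rho c w <= Rho 1 w.
        have w1 := rdisc_fst wd; have y2 := sqr_ge0 w.2.
        rewrite /Rho lef_pV2 ?posrE.
        + by rewrite lerD2r; nra.
        + by rewrite ltr_pwDl// exprn_gt0//; lra.
        + by rewrite ltr_pwDl// exprn_gt0//; lra.
      by have := hD w wd; nra.
  have h2 := potential_ge A1 n c1 hu hl.
  have h3 : dint (fun w => (kpoly n n).[Xi p 0 w] * - (2 * (-2 * (1 - e)) * Rho c w + 4 * C)) =
     4 * ((1 - e) * dint (fun w => k w * Rho c w) - C * dint k).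
    have t1 : tame (fun w => k w * Rho c w) by tame_tac.
    have t2 : tame (fun w => (1 - e) * (k w * Rho c w)) by tame_tac.
    have t3 : tame (fun w => C * k w) by tame_tac.
    rewrite -(dintZ _ t1) -(dintZ _ tk) -(dintB t2 t3) -dintZ; last exact: tameB.
    by apply: eq_dint => w _; rewrite /k; ring.
  rewrite h3 -mulrA in h2.
  rewrite ler_pM2l// in h2.
  apply: (@le_trans _ _ ((1 - e) * dint (fun w => k w * Rho c w) - C * dint k)%:E).
    by rewrite lee_fin.
  by rewrite EFinB leeBlDr.
set I := (\int[mu2]_(w in rdisc) (D w * - ln (1 - Xi p 0 w))%:E)%E in key *.
have := leey I; rewrite le_eqVlt => /predU1P[->|Ify]; first by rewrite leey.
have If : I \is a fin_num.
  rewrite ge0_fin_numE// integral_ge0// => w wd.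
  by rewrite lee_fin mulr_ge0 ?D0 ?(green_ge0 A1).
rewrite -(fineK If) lee_fin.
have key' n : pi * (L - 2 * K / n.+2%:R) <= fine I by rewrite -lee_fin fineK.
apply/ler_addgt0Pr => eta eta0.
have [n hn] : exists n : nat, pi * (2 * K / n.+2%:R) <= eta.
  exists (Num.truncn (pi * 2 * `|K| / eta)).
  set n := Num.truncn _.
  have n0 : 0 < n.+2%:R :> R by rewrite ltr0n.
  have h : pi * 2 * `|K| / eta <= n.+2%:R.
    apply: ltW; apply: (@lt_le_trans _ _ n.+1%:R); last by rewrite ler_nat.
    by rewrite /n truncnS_gt.
  rewrite ler_pdivrMr// in h.
  rewrite 2!mulrA ler_pdivrMr// [eta * _]mulrC; apply: le_trans h.
  apply: (@le_trans _ _ (pi * 2 * `|K|)); last by [].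
  by apply: ler_wpM2l; [rewrite mulr_ge0 ?(ltW pi0)|exact: ler_norm].
by apply: le_trans (lerD (key' n) hn); rewrite -mulrDr subrK.
Qed.
End lower2.

(** * Complex differentiation and power series *)

Section cabs_theory.
Context {R : realType}.
Implicit Types (z w : R[i]).

Lemma cabs_ge0 z : 0 <= cabs z.
Proof. by case: z => a b /=; exact: sqrtr_ge0. Qed.

Lemma cabs_sq z : cabs z ^+ 2 = complex.Re z ^+ 2 + complex.Im z ^+ 2.
Proof. by case: z => a b /=; rewrite sqr_sqrtr// addr_ge0 ?sqr_ge0. Qed.

Lemma cabsM z w : cabs (z * w) = cabs z * cabs w.
Proof. exact: ComplexField.Normc.normcM. Qed.

Lemma cabsD z w : cabs (z + w) <= cabs z + cabs w.
Proof. exact: complex.le_normcD. Qed.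

Lemma cabsN z : cabs (- z) = cabs z.
Proof. exact: complex.normcN. Qed.

Lemma cabsV z : cabs z^-1 = (cabs z)^-1.
Proof. exact: ComplexField.Normc.normcV. Qed.

Lemma cabs0 : cabs (0 : R[i]) = 0.
Proof. exact: ComplexField.Normc.normc0. Qed.

Lemma cabs1 : cabs (1 : R[i]) = 1.
Proof. exact: ComplexField.Normc.normc1. Qed.

Lemma cabs_eq0 z : (cabs z == 0) = (z == 0).
Proof.
apply/idP/idP => [/eqP/ComplexField.Normc.eq0_normc ->//|/eqP ->].
by rewrite cabs0.
Qed.

Lemma cabs_gt0 z : (0 < cabs z) = (z != 0).
Proof. by rewrite lt_neqAle cabs_ge0 andbT eq_sym cabs_eq0. Qed.

Lemma cabsX z n : cabs (z ^+ n) = cabs z ^+ n.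
Proof. by elim: n => [|n IH]; rewrite ?expr0 ?cabs1// !exprS cabsM IH. Qed.

Lemma cabsB z w : cabs (z - w) <= cabs z + cabs w.
Proof. by rewrite -(cabsN w); exact: cabsD. Qed.

Lemma cabs_distC z w : cabs (z - w) = cabs (w - z).
Proof. by rewrite -cabsN opprB. Qed.

Lemma cabs_sum I (r : seq I) (P : pred I) (F : I -> R[i]) :
  cabs (\sum_(i <- r | P i) F i) <= \sum_(i <- r | P i) cabs (F i).
Proof.
elim/big_ind2: _ => [|x1 x2 y1 y2 h1 h2|//]; first by rewrite cabs0.
by rewrite (le_trans (cabsD _ _))// lerD.
Qed.

Lemma cabs_real (x : R) : cabs x%:C%C = `|x|.
Proof. by rewrite /= expr0n addr0 sqrtr_sqr. Qed.

Lemma cabs_nat n : cabs (n%:R : R[i]) = n%:R.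
Proof. by rewrite -(rmorph_nat (real_complex R)) cabs_real ger0_norm. Qed.

Lemma Re_le_cabs z : `|complex.Re z| <= cabs z.
Proof.
case: z => a b /=; rewrite -sqrtr_sqr ler_wsqrtr// lerDl; exact: sqr_ge0.
Qed.

Lemma Im_le_cabs z : `|complex.Im z| <= cabs z.
Proof.
case: z => a b /=; rewrite -sqrtr_sqr ler_wsqrtr// lerDr; exact: sqr_ge0.
Qed.

Lemma cabs_le_ReIm z : cabs z <= `|complex.Re z| + `|complex.Im z|.
Proof.
rewrite -(@ler_pXn2r _ 2%N) ?nnegrE ?cabs_ge0 ?addr_ge0//.
rewrite cabs_sq sqrrD !real_normK ?num_real//.
by rewrite [leRHS]addrAC lerDl mulrn_wge0// mulr_ge0.
Qed.

Lemma ReD z w : complex.Re (z + w) = complex.Re z + complex.Re w.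
Proof. by case: z; case: w. Qed.
Lemma ImD z w : complex.Im (z + w) = complex.Im z + complex.Im w.
Proof. by case: z; case: w. Qed.
Lemma ReN z : complex.Re (- z) = - complex.Re z.
Proof. by case: z. Qed.
Lemma ImN z : complex.Im (- z) = - complex.Im z.
Proof. by case: z. Qed.
Lemma ReM z w : complex.Re (z * w) =
  complex.Re z * complex.Re w - complex.Im z * complex.Im w.
Proof. by case: z; case: w. Qed.
Lemma ImM z w : complex.Im (z * w) =
  complex.Re z * complex.Im w + complex.Im z * complex.Re w.
Proof. by case: z; case: w => a b c d /=; ring. Qed.

Lemma complex_ext z w : complex.Re z = complex.Re w -> complex.Im z = complex.Im w -> z = w.
Proof. by case: z; case: w => a b c d /= -> ->. Qed.

Lemma cabs_dist z w : cabs z - cabs w <= cabs (z - w).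
Proof. by rewrite lerBlDr; have := cabsD (z - w) w; rewrite subrK. Qed.

Definition ctends (u : nat -> R[i]) (l : R[i]) :=
  forall e : R, 0 < e -> exists N, forall n, (N <= n)%N -> cabs (u n - l) <= e.

(** Complex differentiability with real epsilons and the real modulus, as the norm of [Cplx R] is
    complex-valued. [derivable_cdiff] and [cdiff_is_derive] translate in both directions. *)
Definition cdiff (f : R[i] -> R[i]) z d := forall e : R, 0 < e ->
  exists2 dl : R, 0 < dl & forall h, cabs h < dl ->
    cabs (f (z + h) - f z - h * d) <= e * cabs h.

Definition ccont (f : R[i] -> R[i]) z := forall e : R, 0 < e ->
  exists2 dl : R, 0 < dl & forall h, cabs h < dl -> cabs (f (z + h) - f z) <= e.

Lemma ltc0P (e : R[i]) : 0 < e -> 0 < complex.Re e /\ e = (complex.Re e)%:C%C.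
Proof. by case: e => a b; rewrite ltcE/= => /andP[/eqP -> ->]. Qed.

Lemma normE (z : Cplx R) : `|z| = (cabs z)%:C%C.
Proof. by []. Qed.

Lemma ctends_cvg (u : nat -> Cplx R) (l : Cplx R) :
  ctends u l -> u n @[n --> \oo] --> l.
Proof.
move=> ul; apply/cvgrPdist_le => e /ltc0P[e0 ->].
have [N HN] := ul _ e0; exists N => // n /= /HN.
by rewrite cabs_distC => h; rewrite [leLHS]normE lecR.
Qed.

Lemma ctends_limn (u : nat -> Cplx R) (l : Cplx R) : ctends u l -> limn u = l.
Proof. by move=> /ctends_cvg/cvg_lim; apply; exact: norm_hausdorff. Qed.

Lemma ctends_unique (u : nat -> R[i]) l l' : ctends u l -> ctends u l' -> l = l'.
Proof. by move=> /ctends_limn <- /ctends_limn <-. Qed.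

Lemma cdiff_is_derive (f : Cplx R -> Cplx R) (z d : Cplx R) :
  cdiff f z d -> is_derive z 1 f d.
Proof.
move=> fd.
have h : (h : Cplx R)^-1 *: (f (h *: (1 : Cplx R) + z) - f z) @[h --> (0 : Cplx R)^'] --> d.
  apply/cvgrPdist_le => e /ltc0P[e0 ->].
  have [dl dl0 H] := fd _ e0.
  exists (dl%:C)%C; first by rewrite /= ltcR.
  move=> h; rewrite /ball_/= sub0r normrN => hd h0.
  have {}hd : cabs h < dl by move: hd; rewrite [X in X < _]normE ltcR.
  have hp : 0 < cabs h by rewrite cabs_gt0.
  rewrite [leLHS]normE lecR -(ler_pM2r hp) -cabsM; apply: le_trans (H h hd).
  rewrite -cabsN mulrC mulrBr opprB [h *: 1]mulr1 [h^-1 *: _]/(_ * _) mulVKf//.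
  by rewrite [h + z]addrC.
apply: DeriveDef; first by apply/cvg_ex; exists d.
exact/cvg_lim.
Qed.

Lemma derivable_cdiff (f : Cplx R -> Cplx R) (z : Cplx R) :
  derivable f z 1 -> cdiff f z (derive1 f z).
Proof.
move=> fd e e0; rewrite derive1E.
have /cvgrPdist_le h : (h : Cplx R)^-1 *: (f (h *: (1 : Cplx R) + z) - f z) @[h --> (0 : Cplx R)^'] --> 'D_1 f z by exact: fd.
have ec0 : 0 < e%:C%C :> R[i] by rewrite ltcR.
have [/= dl dl0 H] := h _ ec0.
have [dl0' dlE] := ltc0P dl0.
exists (complex.Re dl) => // k kd.
have [->|k0] := eqVneq k 0; first by rewrite addr0 subrr mul0r subr0 cabs0 mulr0.
have := H k; rewrite /ball_/= sub0r normrN.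
rewrite [X in X < _ -> _]normE {1}dlE ltcR => /(_ kd k0).
rewrite [leLHS]normE lecR => hk.
have kp : 0 < cabs k by rewrite cabs_gt0.
rewrite -(ler_pM2r kp) in hk; apply: le_trans hk.
rewrite -cabsM -[leRHS]cabsN [_ * k]mulrC mulrBr opprB [k *: 1]mulr1 [k^-1 *: _]/(_ * _) mulVKf//.
by rewrite [k + z]addrC.
Qed.

Lemma cdiff_derive1 (f : Cplx R -> Cplx R) (z d : Cplx R) : cdiff f z d -> derive1 f z = d.
Proof. by move=> /cdiff_is_derive fd; rewrite derive1E; exact: derive_val. Qed.

Lemma cdiff_derivable (f : Cplx R -> Cplx R) (z d : Cplx R) : cdiff f z d -> derivable f z 1.
Proof. by move=> /cdiff_is_derive fd; exact: ex_derive. Qed.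

End cabs_theory.

Section ctends_theory.
Context {R : realType}.
Implicit Types (u v : nat -> R[i]).

Lemma ctends_cst (l : R[i]) : ctends (fun=> l) l.
Proof. by move=> e e0; exists 0 => n _; rewrite subrr cabs0 ltW. Qed.

Lemma ctendsD u v l m : ctends u l -> ctends v m -> ctends (fun n => u n + v n) (l + m).
Proof.
move=> hu hv e e0; have e2 : 0 < e / 2 by rewrite divr_gt0.
have [N1 H1] := hu _ e2; have [N2 H2] := hv _ e2.
exists (maxn N1 N2) => n; rewrite geq_max => /andP[/H1 h1 /H2 h2].
rewrite opprD addrACA (le_trans (cabsD _ _))// [leRHS](splitr e); exact: lerD.
Qed.

Lemma ctendsZ (c : R[i]) u l : ctends u l -> ctends (fun n => c * u n) (c * l).
Proof.
move=> hu e e0; have [->|c0] := eqVneq c 0.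
  by exists 0 => n _; rewrite !mul0r subrr cabs0 ltW.
have cp : 0 < cabs c by rewrite cabs_gt0.
have [N H] := hu _ (divr_gt0 e0 cp); exists N => n /H.
by rewrite -mulrBr cabsM ler_pdivlMr// mulrC.
Qed.

Lemma ctendsB u v l m : ctends u l -> ctends v m -> ctends (fun n => u n - v n) (l - m).
Proof.
move=> hu hv; apply: ctendsD => //; rewrite -mulN1r.
by under eq_fun do rewrite -mulN1r; exact: ctendsZ.
Qed.

Lemma ctends_shift u l : ctends u l -> ctends (fun n => u n.+1) l.
Proof. by move=> hu e /hu[N H]; exists N => n Nn; apply: H; exact: leqW. Qed.

Lemma ctends_eq u v l : (forall n, u n = v n) -> ctends u l -> ctends v l.
Proof. by move=> /funext ->. Qed.

Lemma ctends_cabs_le u l (B : R) N :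
  ctends u l -> (forall n, (N <= n)%N -> cabs (u n) <= B) -> cabs l <= B.
Proof.
move=> hu hB; apply/ler_addgt0Pr => e e0; have [M H] := hu _ e0.
have := H (maxn N M) (leq_maxr _ _); have := hB (maxn N M) (leq_maxl _ _).
move=> h1 h2; have := cabs_dist l (u (maxn N M)); rewrite cabs_distC => h3.
by apply: (le_trans _ (lerD h1 h2)); rewrite -lerBlDl.
Qed.

Lemma ctends_ReIm u (a b : R) :
  complex.Re (u n) @[n --> \oo] --> a -> complex.Im (u n) @[n --> \oo] --> b ->
  ctends u (Complex a b).
Proof.
move=> /cvgrPdist_le ha /cvgrPdist_le hb e e0.
have e2 : 0 < e / 2 by rewrite divr_gt0.
have [N1 _ H1] := ha _ e2; have [N2 _ H2] := hb _ e2.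
exists (maxn N1 N2) => n; rewrite geq_max => /andP[/H1 /= h1 /H2 /= h2].
rewrite (le_trans (cabs_le_ReIm _))// [leRHS](splitr e) !ReD !ImD !ReN !ImN/=.
by rewrite distrC [X in _ + X]distrC; exact: lerD.
Qed.

Definition csums u s := ctends (fun n => \sum_(k < n) u k) s.

Lemma real_sum_cvg (v : nat -> R) (B : R) : (forall n, \sum_(k < n) `|v k| <= B) ->
  exists s, \sum_(k < n) v k @[n --> \oo] --> (s : R).
Proof.
move=> hB.
have h : cvgn [series `|v k|]_k.
  apply: nondecreasing_is_cvgn; first by apply: nondecreasing_series => n _ _; exact: normr_ge0.
  by exists B => _ [n _ <-]; rewrite /series/= big_mkord.
have /cvg_ex[s hs] := normed_cvg h.
by exists s; move: hs; rewrite (_ : series v = fun n => \sum_(k < n) v k)//; apply/funext => n; rewrite /series/= big_mkord.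
Qed.

Lemma csums_exists u (B : R) : (forall n, \sum_(k < n) cabs (u k) <= B) ->
  exists s, csums u s.
Proof.
move=> hB.
have [a ha] : exists s, \sum_(k < n) complex.Re (u k) @[n --> \oo] --> (s : R).
  apply: (@real_sum_cvg (fun k => complex.Re (u k)) B) => n.
  by apply: le_trans (hB n); apply: ler_sum => i _; exact: Re_le_cabs.
have [b hb] : exists s, \sum_(k < n) complex.Im (u k) @[n --> \oo] --> (s : R).
  apply: (@real_sum_cvg (fun k => complex.Im (u k)) B) => n.
  by apply: le_trans (hB n); apply: ler_sum => i _; exact: Im_le_cabs.
exists (Complex a b); apply: ctends_ReIm.
- rewrite (_ : (fun n => _) = (fun n => \sum_(k < n) complex.Re (u k)))//.
  by apply/funext => n; apply: (big_morph _ (@ReD _)).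
- rewrite (_ : (fun n => _) = (fun n => \sum_(k < n) complex.Im (u k)))//.
  by apply/funext => n; apply: (big_morph _ (@ImD _)).
Qed.

Lemma csums_tail u s (N : nat) (t : R) : csums u s ->
  (forall n, \sum_(k < n) cabs (u (N + k)%N) <= t) ->
  cabs (s - \sum_(k < N) u k) <= t.
Proof.
move=> hs ht.
have h := ctendsB hs (ctends_cst (\sum_(k < N) u k)).
apply: (ctends_cabs_le (N := N) h) => n Nn.
rewrite -(subnKC Nn) big_split_ord/= [X in X - _]addrC addrK.
exact: le_trans (cabs_sum _ _ _) (ht _).
Qed.

End ctends_theory.

Section geometric_sums.
Context {R : realType}.
Variable q : R.
Hypothesis q01 : 0 <= q < 1.

Let q0 : 0 <= q. Proof. by case/andP: q01. Qed.
Let q1 : 0 < 1 - q. Proof. by rewrite subr_gt0; case/andP: q01. Qed.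

Lemma geo_sum0 n : \sum_(k < n) q ^+ k <= (1 - q)^-1.
Proof.
rewrite -[leRHS]mul1r ler_pdivlMr// mulrC -opprB mulNr -subrX1 opprB.
by rewrite gerBl exprn_ge0.
Qed.

Lemma geo_sum1 n : \sum_(k < n) k.+1%:R * q ^+ k <= (1 - q)^-2.
Proof.
have h : (1 - q) * \sum_(k < n) k.+1%:R * q ^+ k + n%:R * q ^+ n = \sum_(k < n) q ^+ k.
  elim: n => [|n IH]; first by rewrite !big_ord0 mulr0 mul0r addr0.
  by rewrite !big_ord_recr/= -IH exprS -natr1; ring.
rewrite -exprVn expr2 -(ler_pM2l q1) mulrA mulfV ?gt_eqF// mul1r.
apply: le_trans (geo_sum0 n); rewrite -h lerDl mulr_ge0// exprn_ge0//.
Qed.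

Lemma geo_sum2 n : \sum_(k < n) k.+1%:R * k.+2%:R * q ^+ k <= 2 * (1 - q)^-3.
Proof.
have h : (1 - q) * \sum_(k < n) k.+1%:R * k.+2%:R * q ^+ k + n%:R * n.+1%:R * q ^+ n
    = 2 * \sum_(k < n) k.+1%:R * q ^+ k.
  elim: n => [|n IH]; first by rewrite !big_ord0 !mulr0 !mul0r addr0.
  by rewrite !big_ord_recr/= [RHS]mulrDr -IH exprS -!natr1; ring.
rewrite -exprVn exprS -(ler_pM2l q1) mulrCA [(1 - q) * (_ * _)]mulrA mulfV ?gt_eqF// mul1r.
rewrite exprVn; apply: (@le_trans _ _ (2 * \sum_(k < n) k.+1%:R * q ^+ k)).
  by rewrite -h lerDl !mulr_ge0// exprn_ge0//.
by rewrite ler_pM2l// geo_sum1.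
Qed.

End geometric_sums.

(** * Power series: convergence, termwise differentiation, Taylor coefficients *)

Section power_series.
Context {R : realType}.
Implicit Types (c : nat -> R[i]) (z h : R[i]).

(** Radius of convergence at least rho, in Abel's form: boundedness on every smaller radius, a
    condition that passes to [dcoef]. *)
Definition cgrow c (rho : R) := forall r, 0 < r < rho ->
  exists C, forall k, cabs (c k) * r ^+ k <= C.

Definition psum c z s := csums (fun k => c k * z ^+ k) s.

Definition dcoef c k : R[i] := k.+1%:R * c k.+1.

(** Abel's lemma: boundedness at the midpoint t of r and rho gives geometric decay with ratio r /
    t. *)
Lemma cgrow_bound c rho (r : R) : cgrow c rho -> 0 <= r < rho ->
  exists C q : R, [/\ 0 <= C, 0 <= q < 1 & forall k, cabs (c k) * r ^+ k <= C * q ^+ k].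
Proof.
move=> hc /andP[r0 rrho].
pose t := (r + rho) / 2; have t0 : 0 < t < rho by rewrite /t; lra.
have [C HC] := hc _ t0; have t00 : 0 < t by case/andP: t0.
exists C, (r / t); split.
- by apply: le_trans (HC 0%N); rewrite mulr_ge0 ?cabs_ge0 ?expr0.
- rewrite divr_ge0 ?(ltW t00)//= ltr_pdivrMr// mul1r /t; lra.
- move=> k; rewrite exprMn exprVn.
  have tk : 0 < t ^+ k by rewrite exprn_gt0.
  rewrite (_ : cabs (c k) * r ^+ k = cabs (c k) * t ^+ k * (r ^+ k / t ^+ k)); last first.
    by field; rewrite gt_eqF.
  by rewrite ler_wpM2r// divr_ge0 ?exprn_ge0// ltW.
Qed.

Lemma psum_exists c rho z : cgrow c rho -> cabs z < rho -> exists s, psum c z s.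
Proof.
move=> hc zr.
have [|C [q [C0 q01 H]]] := cgrow_bound hc (r := cabs z); first by rewrite cabs_ge0.
apply: (csums_exists (B := C * (1 - q)^-1)) => n.
apply: (@le_trans _ _ (\sum_(k < n) C * q ^+ k)).
  by apply: ler_sum => k _; rewrite cabsM cabsX.
by rewrite -mulr_sumr ler_wpM2l// geo_sum0.
Qed.

Lemma cgrow_dcoef c rho : cgrow c rho -> cgrow (dcoef c) rho.
Proof.
move=> hc r /andP[r0 rr].
have [|C [q [C0 q01 H]]] := cgrow_bound hc (r := r); first by rewrite ltW.
exists (C / r * (1 - q)^-2) => k.
have := geo_sum1 q01 k.+1; rewrite big_ord_recr/= => h.
have {}h : k.+1%:R * q ^+ k <= (1 - q)^-2.
  apply: le_trans h; rewrite lerDr sumr_ge0// => i _.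
  by rewrite mulr_ge0// exprn_ge0//; case/andP: q01.
have h2 : cabs (c k.+1) * r ^+ k <= C / r * q ^+ k.
  rewrite mulrAC ler_pdivlMr// -mulrA -exprSr; apply: le_trans (H k.+1) _.
  by rewrite exprS mulrCA ler_piMl ?mulr_ge0// ?exprn_ge0//; case/andP: q01 => // ? /ltW.
rewrite /dcoef cabsM cabs_nat -mulrA; apply: (@le_trans _ _ (k.+1%:R * (C / r * q ^+ k))).
  by rewrite ler_wpM2l.
by rewrite mulrCA ler_wpM2l// divr_ge0// ltW.
Qed.

(** The remainders satisfy T_(k+1) = (z + h) T_k + k h^2 z^(k-1). The factor r^2 on the left avoids
    the exponent k - 2, which would be negative for small k. *)
Lemma taylor_remainder (r : R) z h k : 0 <= r -> cabs z <= r -> cabs (z + h) <= r ->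
  r ^+ 2 * cabs ((z + h) ^+ k - z ^+ k - h * (k%:R * z ^+ k.-1)) <=
  k%:R ^+ 2 * r ^+ k * cabs h ^+ 2.
Proof.
move=> r0 zr zhr; have h2 := sqr_ge0 (cabs h).
elim: k => [|k IH].
  by rewrite !expr0 subrr sub0r !mul0r mulr0 oppr0 cabs0 mulr0 expr0n !mul0r.
set T := _ - _ in IH.
have -> : (z + h) ^+ k.+1 - z ^+ k.+1 - h * (k.+1%:R * z ^+ k.+1.-1) =
   (z + h) * T + k%:R * h ^+ 2 * z ^+ k.-1.
  rewrite /T [k.+1.-1]/= -natr1; case: k {IH T} => [|k]; first by rewrite !expr0 !expr1 mul0r; ring.
  by rewrite /= !exprS; ring.
apply: (@le_trans _ _ (r ^+ 2 * (r * cabs T + k%:R * cabs h ^+ 2 * cabs z ^+ k.-1))).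
  rewrite ler_wpM2l ?sqr_ge0//; apply: le_trans (cabsD _ _) _.
  rewrite !cabsM cabs_nat !cabsX lerD2r ler_wpM2r ?cabs_ge0//.
have e1 : r ^+ 2 * (r * cabs T) <= r * (k%:R ^+ 2 * r ^+ k * cabs h ^+ 2).
  by rewrite mulrCA ler_wpM2l.
have e2 : r ^+ 2 * (k%:R * cabs h ^+ 2 * cabs z ^+ k.-1) <= k%:R * cabs h ^+ 2 * r ^+ k.+1.
  case: k {IH T e1} => [|k]; first by rewrite !mul0r mulr0.
  rewrite mulrCA; apply: ler_wpM2l; first by rewrite mulr_ge0.
  rewrite -(addn2 k) addnC exprD; apply: ler_wpM2l; first exact: sqr_ge0.
  by rewrite lerXn2r ?nnegrE ?cabs_ge0.
rewrite mulrDr; apply: (le_trans (lerD e1 e2)).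
have rk : 0 <= r * r ^+ k * cabs h ^+ 2 by rewrite mulr_ge0// mulr_ge0// exprn_ge0.
have k0 : 0 <= k%:R :> R by [].
rewrite [r ^+ k.+1]exprS -natr1; set a := r * r ^+ k * cabs h ^+ 2 in rk *.
rewrite [leLHS](_ : _ = (k%:R ^+ 2 + k%:R) * a); last by rewrite /a; ring.
rewrite [leRHS](_ : _ = (k%:R + 1) ^+ 2 * a); last by rewrite /a; ring.
by rewrite ler_wpM2r//; lra.
Qed.

(** The second-order remainders of the monomials sum to O(|h|^2) on a disc of radius r strictly
    between |z| and rho; k^2 <= (k+1)(k+2) brings the sum under [geo_sum2]. *)
Lemma psum_cdiff c rho f z d : cgrow c rho ->
  (forall w, cabs w < rho -> psum c w (f w)) -> cabs z < rho -> psum (dcoef c) z d ->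
  cdiff f z d.
Proof.
move=> hc hf zr hd.
pose r := (cabs z + rho) / 2.
have zge0 := cabs_ge0 z.
have zr1 : cabs z < r by rewrite /r; lra.
have rr : r < rho by rewrite /r; lra.
have r0 : 0 < r by exact: le_lt_trans zr1.
have [|C [q [C0 q01 H]]] := cgrow_bound hc (r := r); first by rewrite ltW.
pose B := C * (2 * (1 - q)^-3).
have q1 : 0 < 1 - q by rewrite subr_gt0; case/andP: q01.
have B0 : 0 <= B by rewrite !mulr_ge0// invr_ge0 exprn_ge0// ltW.
have key h : cabs (z + h) <= r -> r ^+ 2 * cabs (f (z + h) - f z - h * d) <= B * cabs h ^+ 2.
  move=> zh.
  have zhr : cabs (z + h) < rho by exact: le_lt_trans rr.
  (* Shifted by one, since n + 1 terms of f correspond to n terms of its derivative. *)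
  have t1 := ctends_shift (ctendsB (hf _ zhr) (hf _ zr)).
  have t := ctendsB t1 (ctendsZ h hd).
  have r20 : r%:C%C ^+ 2 != 0 :> R[i].
    by rewrite -cabs_gt0 cabsX cabs_real exprn_gt0// gtr0_norm.
  have := ctendsZ (r%:C%C ^+ 2) t => tt.
  have -> : r ^+ 2 * cabs (f (z + h) - f z - h * d) = cabs (r%:C%C ^+ 2 * (f (z + h) - f z - h * d)).
    by rewrite cabsM cabsX cabs_real gtr0_norm.
  apply: (ctends_cabs_le (N := 0) tt) => n _.
  rewrite cabsM cabsX cabs_real gtr0_norm//.
  have -> : \sum_(k < n.+1) c k * (z + h) ^+ k - \sum_(k < n.+1) c k * z ^+ k -
       h * (\sum_(k < n) dcoef c k * z ^+ k) =
     \sum_(k < n.+1) c k * ((z + h) ^+ k - z ^+ k - h * (k%:R * z ^+ k.-1)).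
    rewrite [in RHS](eq_bigr (fun k : 'I_n.+1 => (c k * (z + h) ^+ k - c k * z ^+ k) -
       h * (c k * (k%:R * z ^+ k.-1)))); last by move=> k _; ring.
    rewrite !sumrB; congr (_ - _); rewrite -mulr_sumr; congr (_ * _).
    rewrite big_ord_recl/= mul0r mulr0 add0r; apply: eq_bigr => k _.
    by rewrite /dcoef /bump/= add1n; ring.
  apply: (@le_trans _ _ (\sum_(k < n.+1) cabs (c k) * (k%:R ^+ 2 * r ^+ k * cabs h ^+ 2))).
    apply: (@le_trans _ _ (r ^+ 2 * \sum_(k < n.+1) cabs (c k * ((z + h) ^+ k - z ^+ k - h * (k%:R * z ^+ k.-1))))).
      by rewrite ler_wpM2l ?sqr_ge0// cabs_sum.
    rewrite mulr_sumr; apply: ler_sum => k _; rewrite cabsM mulrCA ler_wpM2l ?cabs_ge0//.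
    by apply: taylor_remainder => //; exact: ltW.
  apply: (@le_trans _ _ (\sum_(k < n.+1) (C * (k.+1%:R * k.+2%:R * q ^+ k)) * cabs h ^+ 2)).
    apply: ler_sum => k _.
    rewrite [leLHS](_ : _ = k%:R ^+ 2 * (cabs (c k) * r ^+ k) * cabs h ^+ 2); last by ring.
    apply: ler_wpM2r; first exact: sqr_ge0.
    rewrite [leRHS]mulrCA; apply: ler_pM.
    - exact: sqr_ge0.
    - by rewrite mulr_ge0 ?cabs_ge0// exprn_ge0// ltW.
    - by rewrite -natrX -natrM ler_nat -mulnn leq_mul// leqW.
    - exact: H.
  rewrite -mulr_suml; apply: ler_wpM2r; first exact: sqr_ge0.
  by rewrite -mulr_sumr; apply: ler_wpM2l => //; exact: geo_sum2.
move=> e e0.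
have r2 : 0 < r ^+ 2 by rewrite exprn_gt0.
exists (Num.min (r - cabs z) (e * r ^+ 2 / (B + 1))).
  by rewrite lt_min subr_gt0 zr1 divr_gt0// ?mulr_gt0//; lra.
move=> h; rewrite lt_min => /andP[h1 h2].
have := key h; have /le_trans -> : cabs (z + h) <= cabs z + cabs h by exact: cabsD.
  move=> /(_ isT) hk.
  rewrite -(ler_pM2l r2); apply: le_trans hk _.
  rewrite expr2 mulrA [leRHS]mulrA ler_wpM2r ?cabs_ge0//.
  have B1 : 0 < B + 1 by lra.
  rewrite ltr_pdivlMr// in h2; have := cabs_ge0 h.
  by rewrite [r ^+ 2 * e]mulrC => ?; nra.
by lra.
Qed.

Lemma psum_dcoef_iter c n k : iter n dcoef c k = ((k + n) ^_ n)%:R * c (k + n)%N.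
Proof.
elim: n k => [|n IH] k; first by rewrite addn0 ffactn0 mul1r.
by rewrite iterS /dcoef IH mulrA -natrM addSnnS [in RHS]ffactnSr addnS subSn ?leq_addl// addnK mulnC.
Qed.

Lemma psum0 c s : psum c 0 s -> s = c 0%N.
Proof.
move=> hs; apply: (ctends_unique hs) => e e0; exists 1%N => -[//|n] _.
rewrite big_ord_recl/= expr0 mulr1 big1 ?addr0 ?subrr ?cabs0 ?ltW// => k _.
by rewrite expr0n mulr0.
Qed.

Lemma psum_derive1n c rho (f : Cplx R -> Cplx R) : cgrow c rho ->
  (forall w, cabs w < rho -> psum c w (f w)) ->
  forall n z, cabs z < rho -> psum (iter n dcoef c) z (derive1n n f z).
Proof.
move=> hc hf; elim=> [|n IH] z zr; first by rewrite derive1n0; exact: hf.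
have hn : cgrow (iter n dcoef c) rho.
  by elim: n {IH} => //= n IH; exact: cgrow_dcoef.
have [d hd] := psum_exists (cgrow_dcoef hn) zr.
rewrite derive1nS.
by rewrite (cdiff_derive1 (psum_cdiff hn IH zr hd)).
Qed.

Lemma taylor_coefE c rho (f : Cplx R -> Cplx R) n : 0 < rho -> cgrow c rho ->
  (forall w, cabs w < rho -> psum c w (f w)) -> taylor_coef f n = c n.
Proof.
move=> r0 hc hf; have := psum_derive1n hc hf n (z := 0); rewrite cabs0 => /(_ r0)/psum0.
rewrite psum_dcoef_iter /taylor_coef add0n ffactnn => ->.
by rewrite mulrC mulKf// pnatr_eq0 -lt0n fact_gt0.
Qed.

End power_series.

(** * Cauchy's theorem on circles *)

Section interval_integral.
Context {R : realType}.
Notation mu := (@lebesgue_measure R).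
Implicit Types (f g : R -> R).

Definition rint (a b : R) f : R := \int[mu]_(t in `[a, b]) f t.

Definition rcont (a b : R) f := forall x, a <= x <= b -> {for x, continuous f}.

Lemma rcontS a b a' b' f : a <= a' -> b' <= b -> rcont a b f -> rcont a' b' f.
Proof.
by move=> aa bb h x /andP[x1 x2]; apply: h; rewrite (le_trans aa x1) (le_trans x2 bb).
Qed.

Lemma rcontD a b f g : rcont a b f -> rcont a b g -> rcont a b (fun x => f x + g x).
Proof. by move=> hf hg x xab; apply: cvgD; [exact: hf|exact: hg]. Qed.

Lemma rcontM a b f g : rcont a b f -> rcont a b g -> rcont a b (fun x => f x * g x).
Proof. by move=> hf hg x xab; apply: cvgM; [exact: hf|exact: hg]. Qed.

Lemma rcontN a b f : rcont a b f -> rcont a b (fun x => - f x).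
Proof. by move=> hf x xab; apply: cvgN; exact: hf. Qed.

Lemma rcont_cst a b k : rcont a b (fun=> k).
Proof. by move=> x _; exact: cst_continuous. Qed.

Lemma rint_integrable a b f : rcont a b f -> mu.-integrable `[a, b] (EFin \o f).
Proof.
move=> hf; apply: continuous_compact_integrable; first exact: segment_compact.
by apply: continuous_in_subspaceT => x; rewrite inE/= in_itv/=; exact: hf.
Qed.

Lemma rintD a b f g : rcont a b f -> rcont a b g ->
  rint a b (fun x => f x + g x) = rint a b f + rint a b g.
Proof.
by move=> hf hg; rewrite /rint RintegralD//; exact: rint_integrable.
Qed.

Lemma rintB a b f g : rcont a b f -> rcont a b g ->
  rint a b (fun x => f x - g x) = rint a b f - rint a b g.
Proof.
by move=> hf hg; rewrite /rint RintegralB//; exact: rint_integrable.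
Qed.

Lemma rintZ a b k f : rcont a b f -> rint a b (fun x => k * f x) = k * rint a b f.
Proof. by move=> hf; rewrite /rint RintegralZl//; exact: rint_integrable. Qed.

Lemma eq_rint a b f g : (forall x, a <= x <= b -> f x = g x) -> rint a b f = rint a b g.
Proof. by move=> h; apply: eq_Rintegral => x; rewrite inE/= in_itv/=; exact: h. Qed.

Lemma rint_cst a b k : a <= b -> rint a b (fun=> k) = k * (b - a).
Proof.
move=> ab; rewrite /rint /Rintegral integral_cst//= lebesgue_measure_itv/= lte_fin.
move: ab; rewrite le_eqVlt => /predU1P[->|->]; last by rewrite -EFinB.
by rewrite ltxx subrr mulr0 mule0.
Qed.

Lemma rint_le a b f g : rcont a b f -> rcont a b g ->
  (forall x, a <= x <= b -> f x <= g x) -> rint a b f <= rint a b g.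
Proof.
move=> hf hg h; apply: le_Rintegral => //; exact: rint_integrable.
Qed.

Lemma rint_bound a b f M : a <= b -> rcont a b f ->
  (forall x, a <= x <= b -> `|f x| <= M) -> `|rint a b f| <= M * (b - a).
Proof.
move=> ab hf hM; rewrite ler_norml; apply/andP; split.
  rewrite -mulNr -rint_cst//; apply: rint_le => //; first exact: rcont_cst.
  by move=> x /hM; rewrite ler_norml => /andP[].
rewrite -rint_cst//; apply: rint_le => //; first exact: rcont_cst.
by move=> x /hM; rewrite ler_norml => /andP[].
Qed.

Lemma rint_split a m b f : a <= m -> m <= b -> rcont a b f ->
  rint a b f = rint a m f + rint m b f.
Proof.
move=> am mb hf; have iab := rint_integrable hf.
have := Rintegral_itvB iab (x := m); rewrite !bnd_simp => /(_ am mb).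
rewrite -/(rint a b f) -/(rint a m f) => h.
rewrite {1}/rint -(subrK (rint a m f) (\int[_]_(_ in _) _)) h addrC; congr (_ + _).
rewrite /rint -Rintegral_itv_obnd_cbnd//.
apply: integrableS iab => //.
by apply: subset_itv; rewrite bnd_simp.
Qed.

Lemma rint_FTC a b f F : a <= b -> rcont a b f ->
  (forall x, a <= x <= b -> is_derive x 1 F (f x)) -> rint a b f = F b - F a.
Proof.
rewrite le_eqVlt => /predU1P[<- _ _|ab hf dF].
  by rewrite /rint set_itv1 Rintegral_set1 subrr.
have cF x : a <= x <= b -> {for x, continuous F}.
  move=> /dF dFx; apply: differentiable_continuous; apply/derivable1_diffP.
  exact: ex_derive.
rewrite /rint /Rintegral (@continuous_FTC2 _ f F)//.
- by apply: continuous_in_subspaceT => x; rewrite inE/= in_itv/=; exact: hf.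
- split.
  + move=> x; rewrite in_itv/= => /andP[x1 x2].
    by apply: ex_derive; apply: dF; rewrite !ltW.
  + by apply: cvg_at_right_filter; apply: cF; rewrite lexx ltW.
  + by apply: cvg_at_left_filter; apply: cF; rewrite lexx ltW.
- move=> x; rewrite in_itv/= => /andP[x1 x2].
  by rewrite derive1E; apply: derive_val; apply: dF; rewrite !ltW.
Qed.

End interval_integral.

(** * Goursat's bisection for additive functions of rectangles *)

Section bisection.
Context {R : realType}.
Variable J : R -> R -> R -> R -> R.
Variables X1 X2 Y1 Y2 : R.
Hypotheses (X12 : X1 <= X2) (Y12 : Y1 <= Y2).
Hypothesis addx : forall x1 xm x2 y1 y2, X1 <= x1 -> x1 <= xm -> xm <= x2 -> x2 <= X2 ->
  Y1 <= y1 -> y1 <= y2 -> y2 <= Y2 -> J x1 x2 y1 y2 = J x1 xm y1 y2 + J xm x2 y1 y2.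
Hypothesis addy : forall x1 x2 y1 ym y2, X1 <= x1 -> x1 <= x2 -> x2 <= X2 ->
  Y1 <= y1 -> y1 <= ym -> ym <= y2 -> y2 <= Y2 -> J x1 x2 y1 y2 = J x1 x2 y1 ym + J x1 x2 ym y2.
Hypothesis localJ : forall x y, X1 <= x <= X2 -> Y1 <= y <= Y2 -> forall e : R, 0 < e ->
  exists2 d, 0 < d & forall x1 x2 y1 y2, X1 <= x1 -> x1 <= x <= x2 -> x2 <= X2 ->
  Y1 <= y1 -> y1 <= y <= y2 -> y2 <= Y2 -> x2 - x1 < d -> y2 - y1 < d ->
  `|J x1 x2 y1 y2| <= e * (x2 - x1 + (y2 - y1)) ^+ 2.

Let L := X2 - X1.
Let T := Y2 - Y1.
Let w n (l : R) : R := l / 2 ^+ n.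

Let Q n (s : R * R) := J s.1 (s.1 + w n L) s.2 (s.2 + w n T).

Let wS n l : w n l = w n.+1 l + w n.+1 l.
Proof. by rewrite /w exprS; field; rewrite expf_neq0. Qed.

Let w_ge0 n l : 0 <= l -> 0 <= w n l.
Proof. by move=> l0; rewrite divr_ge0 ?exprn_ge0. Qed.

Let inside n (s : R * R) := [/\ X1 <= s.1, s.1 + w n L <= X2, Y1 <= s.2 & s.2 + w n T <= Y2].

Let quarter n s : inside n s -> exists s', [/\ inside n.+1 s',
  (s.1 <= s'.1) && (s'.1 + w n.+1 L <= s.1 + w n L),
  (s.2 <= s'.2) && (s'.2 + w n.+1 T <= s.2 + w n T) &
  `|Q n s| <= 4 * `|Q n.+1 s'|].
Proof.
case: s => x y [/= h1 h2 h3 h4].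
have l0 : 0 <= w n.+1 L by rewrite w_ge0// subr_ge0.
have t0 : 0 <= w n.+1 T by rewrite w_ge0// subr_ge0.
have eL := wS n L; have eT := wS n T.
set l := w n.+1 L in l0 eL; set t := w n.+1 T in t0 eT.
have e : Q n (x, y) = Q n.+1 (x, y) + Q n.+1 (x, y + t) + (Q n.+1 (x + l, y) + Q n.+1 (x + l, y + t)).
  rewrite /Q/= -/l -/t eL eT !addrA.
  have xl : X1 <= x + l by lra.
  have xl2 : x + l <= x + l + l by lra.
  have xl3 : x + l + l <= X2 by rewrite -addrA -eL.
  have xl4 : x + l <= X2 by lra.
  have yt2 : y + t <= y + t + t by lra.
  have yt3 : y + t + t <= Y2 by rewrite -addrA -eT.
  have xx : x <= x + l by lra.
  have yy : y <= y + t by lra.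
  have yy2 : y <= y + t + t by lra.
  rewrite (addx h1 xx xl2 xl3 h3 yy2 yt3) (addy h1 xx xl4 h3 yy yt2 yt3).
  by rewrite (addy xl xl2 xl3 h3 yy yt2 yt3) addrA.
have [q1|q1] := leP `|Q n (x, y)| (4 * `|Q n.+1 (x, y)|).
  by exists (x, y); rewrite /inside/= -/l -/t; split => //; [split|apply/andP; split..]; lra.
have [q2|q2] := leP `|Q n (x, y)| (4 * `|Q n.+1 (x, y + t)|).
  by exists (x, y + t); rewrite /inside/= -/l -/t; split => //; [split|apply/andP; split..]; lra.
have [q3|q3] := leP `|Q n (x, y)| (4 * `|Q n.+1 (x + l, y)|).
  by exists (x + l, y); rewrite /inside/= -/l -/t; split => //; [split|apply/andP; split..]; lra.
exists (x + l, y + t); rewrite /inside/= -/l -/t; split => //; [split; lra|apply/andP; split; lra|apply/andP; split; lra|].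
have := ler_normD (Q n.+1 (x, y) + Q n.+1 (x, y + t)) (Q n.+1 (x + l, y) + Q n.+1 (x + l, y + t)).
have := ler_normD (Q n.+1 (x, y)) (Q n.+1 (x, y + t)).
have := ler_normD (Q n.+1 (x + l, y)) (Q n.+1 (x + l, y + t)).
by rewrite -e; lra.
Qed.

Let step n (s : R * R) : R * R :=
  get [set s' | [/\ inside n.+1 s',
  (s.1 <= s'.1) && (s'.1 + w n.+1 L <= s.1 + w n L),
  (s.2 <= s'.2) && (s'.2 + w n.+1 T <= s.2 + w n T) &
  `|Q n s| <= 4 * `|Q n.+1 s'|]].

Let stepP n s : inside n s -> [/\ inside n.+1 (step n s),
  (s.1 <= (step n s).1) && ((step n s).1 + w n.+1 L <= s.1 + w n L),
  (s.2 <= (step n s).2) && ((step n s).2 + w n.+1 T <= s.2 + w n T) &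
  `|Q n s| <= 4 * `|Q n.+1 (step n s)|].
Proof. by move=> /quarter[s' hs']; rewrite /step; case: xgetP => [t -> //|/(_ s')]; move=> /(_ hs'). Qed.

Let Fixpoint sq n : R * R := if n is m.+1 then step m (sq m) else (X1, Y1).

Let sq_inside n : inside n (sq n).
Proof.
elim: n => [|n IH]; last by have [] := stepP IH.
by rewrite /inside /w /= expr0 !divr1 /L /T; split => //; lra.
Qed.

Let sq_mono n m : (n <= m)%N -> [/\ (sq n).1 <= (sq m).1,
  (sq m).1 + w m L <= (sq n).1 + w n L, (sq n).2 <= (sq m).2 &
  (sq m).2 + w m T <= (sq n).2 + w n T].
Proof.
elim: m => [|m IH]; first by rewrite leqn0 => /eqP ->.
rewrite leq_eqVlt => /predU1P[->//|/IH[h1 h2 h3 h4]].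
by have [_ /andP[g1 g2] /andP[g3 g4] _] := stepP (sq_inside m); split => /=; lra.
Qed.

Let sq_big n : `|J X1 X2 Y1 Y2| <= 4 ^+ n * `|Q n (sq n)|.
Proof.
elim: n => [|n IH].
  rewrite expr0 mul1r /Q /w /= expr0 !divr1 /L /T.
  by rewrite !(addrC _ (_ - _)) !subrK.
apply: (le_trans IH); have [_ _ _ h] := stepP (sq_inside n).
by rewrite exprSr -mulrA ler_wpM2l// exprn_ge0.
Qed.

Let limit_point (u : nat -> R) l : 0 <= l -> (forall n m, (n <= m)%N -> u n <= u m /\ u m + w m l <= u n + w n l) ->
  exists x, forall n, u n <= x <= u n + w n l.
Proof.
move=> l0 h; exists (sup (range u)) => n.
have ub m : ubound (range u) (u m + w m l).
  move=> _ [k _ <-]; have [mk|/ltnW km] := leqP m k.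
    by have [_ h2] := h m k mk; apply: le_trans h2; rewrite lerDl w_ge0.
  by have [h1 _] := h k m km; rewrite (le_trans h1)// lerDl w_ge0.
have r0 : range u !=set0 by exists (u 0%N), 0%N.
apply/andP; split; last by apply: ge_sup => //; exact: ub.
by apply: ub_le_sup; [exists (u 0%N + w 0 l); exact: ub|exists n].
Qed.

(** Some quarter of each rectangle carries at least a quarter of |J|. The chosen quarters shrink to
    a point, where [localJ] makes |J| too small compared with the squared half-perimeter, which also
    scales by 4^-n. *)
Lemma bisection : J X1 X2 Y1 Y2 = 0.
Proof.
have L0 : 0 <= L by rewrite subr_ge0.
have T0 : 0 <= T by rewrite subr_ge0.
apply/eqP; rewrite -normr_le0 leNgt; apply/negP => c0.
have [x hx] : exists x, forall n, (sq n).1 <= x <= (sq n).1 + w n L.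
  by apply: limit_point => // n m /sq_mono[].
have [y hy] : exists y, forall n, (sq n).2 <= y <= (sq n).2 + w n T.
  by apply: limit_point => // n m /sq_mono[].
have xX : X1 <= x <= X2.
  by have [h1 h2 _ _] := sq_inside 0; have /andP[? ?] := hx 0%N; apply/andP; split; lra.
have yY : Y1 <= y <= Y2.
  by have [_ _ h1 h2] := sq_inside 0; have /andP[? ?] := hy 0%N; apply/andP; split; lra.
set c := `|J X1 X2 Y1 Y2| in c0.
pose S := L + T + 1.
have S0 : 0 < S by rewrite /S; lra.
(* With this tolerance 4^n |Q n| is at most c / 2, because 4^n times the squared half-perimeter is
   (L + T)^2 <= S^2. The summand 1 in S keeps S positive for degenerate rectangles. *)
have [d d0 Hd] := localJ xX yY (e := c / (2 * S ^+ 2)) ltac:(by rewrite divr_gt0// mulr_gt0// exprn_gt0).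
have [n hn] : exists n : nat, S / d < 2 ^+ n.
  exists (Num.truncn (S / d)).+1.
  apply: (lt_trans (truncnS_gt _)).
  by rewrite -natrX ltr_nat ltn_expl.
have p0 : 0 < 2 ^+ n :> R by rewrite exprn_gt0.
have wd l : 0 <= l -> l < S -> w n l < d.
  move=> l0 lS; rewrite /w ltr_pdivrMr//; rewrite ltr_pdivrMr// in hn.
  by rewrite mulrC; exact: lt_trans hn.
have [h1 h2 h3 h4] := sq_inside n.
have := Hd _ _ _ _ h1 (hx n) h2 h3 (hy n) h4.
rewrite ![_ + w n _ - _]addrAC !subrr !add0r.
have LS : L < S by rewrite /S; lra.
have TS : T < S by rewrite /S; lra.
move=> /(_ (wd L L0 LS) (wd T T0 TS)) hJ.
have := sq_big n; rewrite -/c => hb.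
have : 4 ^+ n * `|Q n (sq n)| <= c / 2.
  apply: (@le_trans _ _ (4 ^+ n * (c / (2 * S ^+ 2) * (w n L + w n T) ^+ 2))).
    by rewrite ler_wpM2l// exprn_ge0.
  have -> : 4 ^+ n * (c / (2 * S ^+ 2) * (w n L + w n T) ^+ 2) = c / 2 * ((L + T) ^+ 2 / S ^+ 2).
    rewrite /w (_ : 4 = 2 * 2 :> R); last by ring.
    by rewrite exprMn; field; rewrite !gt_eqF.
  rewrite -[leRHS]mulr1 ler_wpM2l//; first by rewrite divr_ge0// ltW.
  have LTS : L + T <= S by rewrite /S lerDl.
  rewrite ler_pdivrMr ?exprn_gt0// mul1r.
  by apply: lerXn2r => //; rewrite nnegrE; [exact: addr_ge0|exact: ltW].
by lra.
Qed.

End bisection.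

(** * Goursat's theorem in polar coordinates *)

Section polar.
Context {R : realType}.
Implicit Types (F : R[i] -> R[i]) (r t : R).

Definition pt r t : R[i] := Complex (r * cos t) (r * sin t).

Lemma cabs_pt r t : cabs (pt r t) = `|r|.
Proof.
rewrite /pt /= !exprMn -mulrDr cos2Dsin2 mulr1; exact: sqrtr_sqr.
Qed.

Lemma lipschitz_of_derive (f f' : R -> R) : (forall x : R, is_derive x 1 f (f' x)) ->
  (forall x, `|f' x| <= 1) -> forall s t, `|f s - f t| <= `|s - t|.
Proof.
move=> df hf'.
have key s t : s <= t -> `|f s - f t| <= `|s - t|.
  move=> st; have cf : {within `[s, t], continuous f}.
    apply: continuous_in_subspaceT => x _.
    by apply: differentiable_continuous; apply/derivable1_diffP; have := df x => ?; exact: ex_derive.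
  have [c _ e] := MVT_segment st (fun x _ => df x) cf.
  by rewrite distrC e normrM [leRHS]distrC ler_piMl.
move=> s t; have [/key//|/ltW/key h] := leP s t.
by rewrite distrC [leRHS]distrC.
Qed.

Lemma cos_lip s t : `|cos s - cos t| <= `|s - t| :> R.
Proof.
apply: (lipschitz_of_derive (f' := fun x => - sin x)) => x.
by rewrite normrN sin_max.
Qed.

Lemma sin_lip s t : `|sin s - sin t| <= `|s - t| :> R.
Proof. by apply: (lipschitz_of_derive (f' := cos)) => x; exact: cos_max. Qed.

Lemma pt_lip r t r' t' : cabs (pt r t - pt r' t') <= 2 * `|r - r'| + 2 * `|r'| * `|t - t'|.
Proof.
apply: le_trans (cabs_le_ReIm _) _; rewrite ReD ImD ReN ImN /=.
have h (a b : R) : `|a| <= 1 -> `|a - b| <= `|t - t'| -> `|r * a - r' * b| <= `|r - r'| + `|r'| * `|t - t'|.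
  move=> a1 ab; rewrite (_ : _ - _ = (r - r') * a + r' * (a - b)); last by ring.
  apply: le_trans (ler_normD _ _) _; rewrite !normrM lerD//; last exact: ler_wpM2l.
  by rewrite ler_piMr.
have := lerD (h _ _ (cos_max t) (cos_lip t t')) (h _ _ (sin_max t) (sin_lip t t')).
by move=> /le_trans; apply; rewrite le_eqVlt; apply/orP; left; apply/eqP; ring.
Qed.

Lemma cdiff_ccont F w d : cdiff F w d -> ccont F w.
Proof.
move=> hF e e0; have [dl dl0 H] := hF 1 ltr01.
have d1 : 0 < 1 + cabs d by rewrite ltr_pwDl ?cabs_ge0.
exists (Num.min dl (e / (1 + cabs d))); first by rewrite lt_min dl0 divr_gt0.
move=> h; rewrite lt_min ltr_pdivlMr// => /andP[/H h1 h2].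
rewrite -(subrK (h * d) (F (w + h) - F w)); apply: le_trans (cabsD _ _) _.
rewrite cabsM; apply: le_trans (ltW h2); rewrite mulrDr mulr1 lerD2r.
by rewrite mul1r in h1.
Qed.

Lemma ccont_curve F (gam : R -> R[i]) t (L : R) :
  (forall s, cabs (gam s - gam t) <= L * `|s - t|) -> ccont F (gam t) ->
  {for t, continuous (fun s => complex.Re (F (gam s)))} /\
  {for t, continuous (fun s => complex.Im (F (gam s)))}.
Proof.
move=> lip hF.
have key e : 0 < e -> \forall s \near t, cabs (F (gam s) - F (gam t)) <= e.
  move=> e0; have [dl dl0 H] := hF e e0.
  have L1 : 0 < `|L| + 1 by rewrite ltr_wpDl.
  exists (dl / (`|L| + 1)); first by rewrite /= divr_gt0.
  move=> s; rewrite /ball_/= distrC ltr_pdivlMr// => hs.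
  rewrite -[gam s](subrKC (gam t)); apply: H.
  apply: le_lt_trans (lip s) _; apply: le_lt_trans hs.
  rewrite mulrC ler_wpM2l// (le_trans (ler_norm _))// lerDl//.
split; apply/cvgrPdist_le => e /key; apply: filterS => s; apply: le_trans.
- by rewrite distrC -ReN -ReD; exact: Re_le_cabs.
- by rewrite distrC -ImN -ImD; exact: Im_le_cabs.
Qed.

Lemma ccont_arc F r t : ccont F (pt r t) ->
  {for t, continuous (fun s => complex.Re (F (pt r s)))} /\
  {for t, continuous (fun s => complex.Im (F (pt r s)))}.
Proof.
apply: (@ccont_curve F (pt r) t (2 * `|r|)) => s.
by apply: le_trans (pt_lip _ _ _ _) _; rewrite subrr normr0 mulr0 add0r.
Qed.

Lemma ccont_ray F r t : ccont F (pt r t) ->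
  {for r, continuous (fun s => complex.Re (F (pt s t)))} /\
  {for r, continuous (fun s => complex.Im (F (pt s t)))}.
Proof.
apply: (@ccont_curve F (pt ^~ t) r 2) => s.
by apply: le_trans (pt_lip _ _ _ _) _; rewrite subrr normr0 mulr0 addr0.
Qed.

(** Minus the real part of the integral of F(w) dw / w around the polar rectangle: dw / w is i dt on
    arcs and dr / r on rays. The other part of the integral is recovered later by replacing F with i
    F. *)
Definition polarJ F (x1 x2 y1 y2 : R) : R :=
  rint y1 y2 (fun t => complex.Im (F (pt x2 t)) - complex.Im (F (pt x1 t))) +
  rint x1 x2 (fun r => (complex.Re (F (pt r y2)) - complex.Re (F (pt r y1))) * r^-1).

Section goursat.
Variables X1 X2 Y1 Y2 : R.
Hypotheses (X10 : 0 < X1) (X12 : X1 <= X2) (X21 : X2 <= 1) (Y12 : Y1 <= Y2).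

Definition acont F := forall w, X1 <= cabs w <= X2 -> ccont F w.

Let ptin r t : X1 <= r <= X2 -> X1 <= cabs (pt r t) <= X2.
Proof. by move=> /[dup] rX /andP[r1 _]; rewrite cabs_pt ger0_norm// (le_trans (ltW X10)). Qed.

Lemma arc_cont F x : acont F -> X1 <= x <= X2 -> forall a b,
  rcont a b (fun t => complex.Im (F (pt x t))).
Proof. by move=> hF xX a b t _; apply: (ccont_arc _).2; apply: hF; exact: ptin. Qed.

Lemma ray_cont F y : acont F ->
  rcont X1 X2 (fun r => complex.Re (F (pt r y))).
Proof. by move=> hF r rX; apply: (ccont_ray _).1; apply: hF; exact: ptin. Qed.

Lemma ray_cont_div F y y' : acont F ->
  rcont X1 X2 (fun r => (complex.Re (F (pt r y)) - complex.Re (F (pt r y'))) * r^-1).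
Proof.
move=> hF; apply: rcontM.
  by apply: rcontD; [exact: ray_cont|apply: rcontN; exact: ray_cont].
move=> r /andP[r1 _]; apply: inv_continuous; rewrite gt_eqF//; exact: lt_le_trans r1.
Qed.

Lemma polarJ_addx F x1 xm x2 y1 y2 : acont F -> X1 <= x1 -> x1 <= xm -> xm <= x2 ->
  x2 <= X2 -> y1 <= y2 ->
  polarJ F x1 x2 y1 y2 = polarJ F x1 xm y1 y2 + polarJ F xm x2 y1 y2.
Proof.
move=> hF h1 h2 h3 h4 h5; rewrite /polarJ.
have c x : X1 <= x <= X2 -> rcont y1 y2 (fun t => complex.Im (F (pt x t))).
  by move=> xX; exact: arc_cont.
have c1 := c x1; have c2 := c x2; have cm := c xm.
rewrite !rintB; try by (apply: c; apply/andP; split; lra).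
rewrite (@rint_split _ x1 xm x2)//; first by ring.
by apply: (rcontS _ _ (ray_cont_div hF)).
Qed.

Lemma polarJ_addy F x1 x2 y1 ym y2 : acont F -> X1 <= x1 -> x1 <= x2 -> x2 <= X2 ->
  y1 <= ym -> ym <= y2 ->
  polarJ F x1 x2 y1 y2 = polarJ F x1 x2 y1 ym + polarJ F x1 x2 ym y2.
Proof.
move=> hF h1 h2 h3 h4 h5; rewrite /polarJ.
have x1X : X1 <= x1 <= X2 by apply/andP; split; lra.
have x2X : X1 <= x2 <= X2 by apply/andP; split; lra.
rewrite (@rint_split _ y1 ym y2)//; last first.
  by apply: rcontD; [exact: arc_cont|apply: rcontN; exact: arc_cont].
rewrite addrACA; congr (_ + _); rewrite -rintD.
- by apply: eq_rint => r _; ring.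
- by apply: (rcontS _ _ (ray_cont_div hF)).
- by apply: (rcontS _ _ (ray_cont_div hF)).
Qed.

Lemma polarJB F G x1 x2 y1 y2 : acont F -> acont G -> X1 <= x1 -> x1 <= x2 -> x2 <= X2 ->
  polarJ (fun w => F w - G w) x1 x2 y1 y2 = polarJ F x1 x2 y1 y2 - polarJ G x1 x2 y1 y2.
Proof.
move=> hF hG h1 h2 h3; rewrite /polarJ.
have x1X : X1 <= x1 <= X2 by apply/andP; split; lra.
have x2X : X1 <= x2 <= X2 by apply/andP; split; lra.
rewrite opprD addrACA; congr (_ + _); rewrite -rintB.
- by apply: eq_rint => t _; rewrite !ImD !ImN; ring.
- by apply: rcontD; [exact: arc_cont|apply: rcontN; exact: arc_cont].
- by apply: rcontD; [exact: arc_cont|apply: rcontN; exact: arc_cont].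
- by apply: eq_rint => t _; rewrite !ReD !ReN; ring.
- by apply: (rcontS _ _ (ray_cont_div hF)).
- by apply: (rcontS _ _ (ray_cont_div hG)).
Qed.

Lemma ccontD F G w : ccont F w -> ccont G w -> ccont (fun w => F w + G w) w.
Proof.
move=> hF hG e e0; have e2 : 0 < e / 2 by rewrite divr_gt0.
have [d1 d10 H1] := hF _ e2; have [d2 d20 H2] := hG _ e2.
exists (Num.min d1 d2); first by rewrite lt_min d10.
move=> h; rewrite lt_min => /andP[/H1 h1 /H2 h2].
rewrite opprD addrACA (le_trans (cabsD _ _))// [leRHS](splitr e); exact: lerD.
Qed.

Lemma ccont_affine (a b w0 w : R[i]) : ccont (fun w => a + (w - w0) * b) w.
Proof.
apply: (@cdiff_ccont _ _ b) => e e0; exists 1 => // h _.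
rewrite (_ : _ - _ = 0); last by ring.
by rewrite cabs0 mulr_ge0 ?cabs_ge0// ltW.
Qed.

(** Explicit primitives suffice here; affine functions are the local comparison functions in
    [goursat]. *)
Lemma polarJ_affine a b w0 x1 x2 y1 y2 : 0 < x1 -> x1 <= x2 -> y1 <= y2 ->
  polarJ (fun w => a + (w - w0) * b) x1 x2 y1 y2 = 0.
Proof.
move=> x10 x12 y12; rewrite /polarJ.
case: a b w0 => [a1 a2] [al be] [u v].
rewrite (@eq_rint _ y1 y2 _ (fun t => (x2 - x1) * (be * cos t + al * sin t))); last first.
  by move=> t _; rewrite /pt /=; ring.
rewrite (@eq_rint _ x1 x2 _ (fun=> al * (cos y2 - cos y1) - be * (sin y2 - sin y1))); last first.
  by move=> r /andP[r1 _]; rewrite /pt /=; field; rewrite gt_eqF// (lt_le_trans x10).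
have cf : rcont y1 y2 (fun t => (x2 - x1) * (be * cos t + al * sin t)).
  apply: rcontM; first exact: rcont_cst.
  apply: rcontD; apply: rcontM; try exact: rcont_cst.
    by move=> t _; exact: continuous_cos.
  by move=> t _; exact: continuous_sin.
have df (t : R) : y1 <= t <= y2 -> is_derive t 1 (fun t => (x2 - x1) * (be * sin t - al * cos t))
    ((x2 - x1) * (be * cos t + al * sin t)).
  by move=> _; apply: is_derive_eq; rewrite /GRing.scale/=; ring.
by rewrite rint_cst// (rint_FTC y12 cf df); ring.
Qed.

Lemma polarJ_bound E x1 x2 y1 y2 (M : R) : acont E -> X1 <= x1 -> x1 <= x2 -> x2 <= X2 ->
  y1 <= y2 -> (forall r t, x1 <= r <= x2 -> y1 <= t <= y2 -> cabs (E (pt r t)) <= M) ->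
  `|polarJ E x1 x2 y1 y2| <= 2 * M / X1 * (x2 - x1 + (y2 - y1)).
Proof.
move=> hE h1 h2 h3 h4 hM.
have M0 : 0 <= M by apply: le_trans (cabs_ge0 _) (hM x1 y1 _ _); rewrite lexx.
have x1X : X1 <= x1 <= X2 by apply/andP; split; lra.
have x2X : X1 <= x2 <= X2 by apply/andP; split; lra.
have X11 : X1 <= 1 by exact: le_trans X21.
have MX : M * 2 <= 2 * M / X1.
  by rewrite ler_pdivlMr// [M * 2]mulrC ler_piMr// mulr_ge0.
apply: le_trans (ler_normD _ _) _; rewrite [_ + (y2 - y1)]addrC mulrDr lerD//.
  apply: le_trans (ler_wpM2r _ MX); last by rewrite subr_ge0.
  apply: rint_bound => //.
    by apply: rcontD; [exact: arc_cont|apply: rcontN; exact: arc_cont].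
  move=> t ty; apply: le_trans (ler_normB _ _) _.
  rewrite mulr_natr mulr2n; apply: lerD; apply: le_trans (Im_le_cabs _) (hM _ _ _ ty); by rewrite lexx ?h2.
apply: rint_bound => //; first by apply: (rcontS _ _ (ray_cont_div hE)).
move=> r /[dup] rx /andP[r1 r2]; rewrite normrM normfV.
have r0 : 0 < r by apply: lt_le_trans (le_trans h1 r1).
rewrite (ger0_norm (ltW r0)); apply: ler_pM => //; first by rewrite invr_ge0 ltW.
  apply: le_trans (ler_normB _ _) _.
  rewrite mulr_natl mulr2n; apply: lerD; apply: le_trans (Re_le_cabs _) (hM _ _ rx _); by rewrite lexx ?h4.
by rewrite lef_pV2 ?posrE//; exact: le_trans r1.
Qed.

Lemma goursat F : (forall w, X1 <= cabs w <= X2 -> exists d, cdiff F w d) ->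
  polarJ F X1 X2 Y1 Y2 = 0.
Proof.
move=> dF.
have cF : acont F by move=> w /dF[d]; exact: cdiff_ccont.
apply: bisection => //.
- by move=> x1 xm x2 y1 y2 *; exact: polarJ_addx.
- by move=> x1 x2 y1 ym y2 *; exact: polarJ_addy.
move=> x y xX yY e e0.
have [d hd] := dF _ (ptin y xX).
(* The bound in [polarJ_bound] with M = (e X1 / 4) (2 s) is exactly e s^2; the factor 2 s comes from
   [pt_lip] and radii at most 1. *)
have e4 : 0 < e * X1 / 4 by rewrite divr_gt0// mulr_gt0.
have [dl dl0 H] := hd _ e4.
exists (dl / 4); first by rewrite divr_gt0.
move=> x1 x2 y1 y2 h1 hx h2 h3 hy h4 hdx hdy.
have /andP[x1x xx2] := hx; have /andP[y1y yy2] := hy.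
pose G w := F (pt x y) + (w - pt x y) * d.
have cG : acont G by move=> w _; exact: ccont_affine.
have x12 : x1 <= x2 by lra.
have y12 : y1 <= y2 by lra.
rewrite -[polarJ F _ _ _ _]subr0 -(@polarJ_affine (F (pt x y)) d (pt x y) x1 x2 y1 y2)//; last first.
  exact: lt_le_trans h1.
rewrite -/G -(@polarJB F G)//.
set s := x2 - x1 + (y2 - y1).
have s0 : 0 <= s by rewrite /s; lra.
apply: (@le_trans _ _ (2 * (e * X1 / 4 * (2 * s)) / X1 * s)); last first.
  by rewrite le_eqVlt; apply/orP; left; apply/eqP; field; rewrite gt_eqF.
apply: polarJ_bound => //.
  move=> w wX; apply: ccontD; first exact: cF.
  move=> e' e'0; have [dl' dl'0 H'] := cG w wX _ e'0.
  by exists dl' => // h /H'; rewrite -opprD cabsN.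
move=> r t /andP[r1 r2] /andP[t1 t2].
have hs : cabs (pt r t - pt x y) <= 2 * s.
  apply: le_trans (pt_lip _ _ _ _) _.
  have /andP[Xx xX'] := xX.
  have : `|r - x| <= x2 - x1 by rewrite ler_norml; apply/andP; split; lra.
  have : `|t - y| <= y2 - y1 by rewrite ler_norml; apply/andP; split; lra.
  have x0 : 0 <= x by exact: le_trans (ltW X10) Xx.
  have x1' : x <= 1 by exact: le_trans X21.
  rewrite (ger0_norm x0).
  by have := normr_ge0 (t - y); rewrite /s; nra.
have hdl : cabs (pt r t - pt x y) < dl by apply: le_lt_trans hs _; rewrite /s; lra.
have := H _ hdl; rewrite subrKC /G opprD addrA => /le_trans; apply.
by apply: ler_wpM2l => //; exact: ltW.
Qed.

End goursat.

(** Over a full turn the two rays coincide, so only the two circles contribute to the integral. *)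
Lemma circle_mean_const F (a b : R) : 0 < a -> a <= b -> b <= 1 ->
  (forall w, a <= cabs w <= b -> exists d, cdiff F w d) ->
  rint 0 (2 * pi) (fun t => complex.Im (F (pt a t))) =
  rint 0 (2 * pi) (fun t => complex.Im (F (pt b t))).
Proof.
move=> a0 ab b1 dF; have pi0 := @pi_ge0 R.
have y12 : 0 <= 2 * pi :> R by rewrite mulr_ge0.
have := goursat a0 ab b1 y12 dF; rewrite /polarJ.
have cF : acont a b F by move=> w /dF[d]; exact: cdiff_ccont.
rewrite rintB; [|by apply: (arc_cont a0 cF); rewrite lexx ab..].
rewrite (@eq_rint _ a b _ (fun=> 0)) ?rint_cst ?mul0r ?addr0//.
  by move=> /eqP; rewrite subr_eq0 => /eqP.
by move=> r _; rewrite /pt mulr_natl cos2pi sin2pi cos0 sin0 subrr mul0r.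
Qed.

End polar.

(** * The mean value property with one exceptional point *)

Section circle_mean.
Context {R : realType}.
Implicit Types (F G : R[i] -> R[i]) (r : R).

Definition imean F r := rint 0 (2 * pi) (fun t => complex.Im (F (pt r t))).

Lemma pt0 t : pt 0 t = 0 :> R[i].
Proof. by rewrite /pt !mul0r. Qed.

Lemma twopi_gt0 : 0 < 2 * pi :> R.
Proof. by rewrite mulr_gt0// pi_gt0. Qed.

(** Negative radii are allowed, so that r = 0 is an interior point of the interval on which
    dominated continuity is applied. *)
Lemma imean_continuous F K : (forall w, cabs w < 1 -> ccont F w) ->
  (forall w, cabs w < 1 -> cabs (F w) <= K) ->
  forall r, -1 < r < 1 -> {for r, continuous (imean F)}.
Proof.
move=> cF bF r r1.
have inD s t : s \in `](-1), 1[%classic -> cabs (pt s t) < 1.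
  by rewrite cabs_pt inE/= in_itv/= ltr_norml.
apply: (@continuity_under_integral R _ _ (@lebesgue_measure R)
  (fun s t => complex.Im (F (pt s t))) `[0, 2 * pi]%classic _ (-1) 1 _ _ (fun=> K)) => //.
- move=> s sI; apply: rint_integrable => t _; apply: (ccont_arc _).2.
  by apply: cF; apply: inD; rewrite inE.
- apply: aeW => t _ s sI; apply: (ccont_ray _).2.
  by apply: cF; exact: inD.
- by apply: rint_integrable; exact: rcont_cst.
- move=> s sI; apply: aeW => t _; apply: le_trans (Im_le_cabs _) _.
  by apply: bF; apply: inD; rewrite inE.
- by rewrite inE/= in_itv.
Qed.

Lemma const_limit_right (g : R -> R) a b : a < b -> {for a, continuous g} ->
  (forall s, a < s <= b -> g s = g b) -> g a = g b.
Proof.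
move=> ab /cvgrPdist_le cg h; apply/eqP; rewrite -subr_eq0 -normr_le0.
apply/ler_addgt0Pr => e e0; rewrite add0r.
have [dl /= dl0 H] := cg _ e0.
pose s := Num.min b (a + dl / 2).
have as' : a < s by rewrite lt_min ab ltrDl divr_gt0.
have sb : s <= b by rewrite ge_min lexx.
rewrite -(h s) ?as' ?sb//; apply: H; rewrite /ball_/= distrC gtr0_norm ?subr_gt0//.
have : s <= a + dl / 2 by rewrite ge_min lexx orbT.
by lra.
Qed.

Lemma const_limit_left (g : R -> R) a b : a < b -> {for b, continuous g} ->
  (forall s, a <= s < b -> g s = g a) -> g b = g a.
Proof.
move=> ab /cvgrPdist_le cg h; apply/eqP; rewrite -subr_eq0 -normr_le0.
apply/ler_addgt0Pr => e e0; rewrite add0r.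
have [dl /= dl0 H] := cg _ e0.
pose s := Num.max a (b - dl / 2).
have as' : s < b by rewrite gt_max ab ltrBlDr ltrDl divr_gt0.
have sb : a <= s by rewrite le_max lexx.
rewrite -(h s) ?as' ?sb//; apply: H; rewrite /ball_/= gtr0_norm ?subr_gt0//.
have : b - dl / 2 <= s by rewrite le_max lexx orbT.
by lra.
Qed.

(** At z0 only continuity is assumed. The means are constant for radii below |z0| and for radii
    above it; continuity in r joins these ranges at |z0| and extends the value down to r = 0. *)
Lemma imean_value F K (z0 : R[i]) : cabs z0 < 1 ->
  (forall w, cabs w < 1 -> ccont F w) ->
  (forall w, cabs w < 1 -> cabs (F w) <= K) ->
  (forall w, cabs w < 1 -> w != z0 -> exists d, cdiff F w d) ->
  forall r, 0 <= r < 1 -> imean F r = complex.Im (F 0) * (2 * pi).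
Proof.
move=> z1 cF bF dF r /andP[r0 r1].
have m0 : imean F 0 = complex.Im (F 0) * (2 * pi).
  rewrite /imean (@eq_rint _ _ _ _ (fun=> complex.Im (F 0))); last by move=> t _; rewrite pt0.
  by rewrite rint_cst ?subr0// ltW// twopi_gt0.
rewrite -m0; have cm := imean_continuous cF bF.
set s0 := cabs z0 in z1; have s00 : 0 <= s0 := cabs_ge0 z0.
have mc a b : 0 < a -> a <= b -> b < 1 -> (b < s0) || (s0 < a) -> imean F a = imean F b.
  move=> a0 ab b1 hs; apply: circle_mean_const => //; first exact: ltW.
  move=> w /andP[wa wb]; apply: dF; first exact: le_lt_trans b1.
  by apply: contraTneq hs => wz; rewrite negb_or -!leNgt /s0 -wz wa wb.
have low s : 0 <= s < s0 -> imean F s = imean F 0.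
  rewrite le_eqVlt => /andP[/predU1P[<-//|sp] ss].
  symmetry; apply: const_limit_right => //; first by apply: cm; rewrite ltrN10 ltr01.
  move=> t /andP[t0 ts]; apply: mc => //; last by rewrite ss.
  exact: lt_trans z1.
have mid : imean F s0 = imean F 0.
  move: s00; rewrite le_eqVlt => /predU1P[<-//|sp].
  apply: const_limit_left => //; apply: cm; rewrite z1 andbT; exact: lt_trans sp.
have [rs|rs] := ltP r s0; first by apply: low; rewrite r0.
move: rs; rewrite le_eqVlt => /predU1P[<-//|rs].
rewrite -mid; symmetry; apply: const_limit_right => //.
  by apply: cm; rewrite z1 andbT (lt_le_trans _ s00).
move=> t /andP[st tr]; apply: mc => //; last by rewrite st orbT.
exact: le_lt_trans st.
Qed.

Section cmean.
Variable r : R.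
Hypothesis r01 : 0 < r < 1.

Definition circc F := rcont 0 (2 * pi) (fun t => complex.Re (F (pt r t))) /\
  rcont 0 (2 * pi) (fun t => complex.Im (F (pt r t))).

Definition cmean F : R[i] := Complex
  (rint 0 (2 * pi) (fun t => complex.Re (F (pt r t))) / (2 * pi))
  (rint 0 (2 * pi) (fun t => complex.Im (F (pt r t))) / (2 * pi)).

Lemma circc_cont F : (forall w, cabs w = r -> ccont F w) -> circc F.
Proof.
have rp : `|r| = r by rewrite gtr0_norm//; case/andP: r01.
by move=> h; split=> t _; [apply: (ccont_arc _).1|apply: (ccont_arc _).2]; apply: h; rewrite cabs_pt.
Qed.

Lemma circcD F G : circc F -> circc G -> circc (fun w => F w + G w).
Proof.
move=> [f1 f2] [g1 g2]; split.
- by under eq_fun do rewrite ReD; exact: rcontD.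
- by under eq_fun do rewrite ImD; exact: rcontD.
Qed.

Lemma circcM F G : circc F -> circc G -> circc (fun w => F w * G w).
Proof.
move=> [f1 f2] [g1 g2]; split.
- under eq_fun do rewrite ReM; apply: rcontD; first exact: rcontM.
  by apply: rcontN; exact: rcontM.
- by under eq_fun do rewrite ImM; apply: rcontD; exact: rcontM.
Qed.

Lemma circc_cst k : circc (fun=> k).
Proof. by split; exact: rcont_cst. Qed.

Lemma circc_conj F : circc F -> circc (fun w => conjc (F w)).
Proof.
move=> [f1 f2]; split.
- by rewrite (_ : (fun t => _) = fun t => complex.Re (F (pt r t)))//; apply/funext => t; case: (F _).
- rewrite (_ : (fun t => _) = fun t => - complex.Im (F (pt r t))); first exact: rcontN.
  by apply/funext => t; case: (F _).
Qed.

Lemma cmean_eq F G : (forall w, cabs w = r -> F w = G w) -> cmean F = cmean G.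
Proof.
have rp : `|r| = r by rewrite gtr0_norm//; case/andP: r01.
by move=> h; rewrite /cmean; congr (Complex (_ / _) (_ / _)); apply: eq_rint => t _; rewrite h// cabs_pt.
Qed.

Lemma cmeanD F G : circc F -> circc G -> cmean (fun w => F w + G w) = cmean F + cmean G.
Proof.
move=> [f1 f2] [g1 g2]; rewrite /cmean; apply: complex_ext; rewrite ?ReD ?ImD /=.
- by rewrite -mulrDl -rintD//; congr (_ / _); apply: eq_rint => t _; rewrite ReD.
- by rewrite -mulrDl -rintD//; congr (_ / _); apply: eq_rint => t _; rewrite ImD.
Qed.

Lemma cmeanZ k F : circc F -> cmean (fun w => k * F w) = k * cmean F.
Proof.
move=> [f1 f2]; rewrite /cmean; apply: complex_ext; rewrite ?ReM ?ImM /=.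
- rewrite !mulrA -mulrBl -!rintZ// -rintB; try by apply: rcontM => //; exact: rcont_cst.
  by congr (_ / _); apply: eq_rint => t _; rewrite ReM.
- rewrite !mulrA -mulrDl -!rintZ// -rintD; try by apply: rcontM => //; exact: rcont_cst.
  by congr (_ / _); apply: eq_rint => t _; rewrite ImM.
Qed.

Lemma cmean_cst k : cmean (fun=> k) = k.
Proof.
have p2 := twopi_gt0; rewrite /cmean !rint_cst ?subr0 ?(ltW p2)//.
by case: k => a b /=; rewrite !mulfK// gt_eqF.
Qed.

Lemma cmean_sum n (F : nat -> R[i] -> R[i]) : (forall k, circc (F k)) ->
  circc (fun w => \sum_(k < n) F k w) /\
  cmean (fun w => \sum_(k < n) F k w) = \sum_(k < n) cmean (F k).
Proof.
move=> h; elim: n => [|n [IH1 IH2]].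
  rewrite big_ord0 (_ : (fun w => _) = fun=> 0); last by apply/funext => w; rewrite big_ord0.
  by split; [exact: circc_cst|exact: cmean_cst].
rewrite (_ : (fun w => _) = fun w => \sum_(k < n) F k w + F n w); last first.
  by apply/funext => w; rewrite big_ord_recr.
by split; [exact: circcD|rewrite cmeanD// IH2 big_ord_recr].
Qed.

Lemma cmean_conj F : circc F -> cmean (fun w => conjc (F w)) = conjc (cmean F).
Proof.
move=> [f1 f2]; rewrite /cmean/=; congr (Complex (_ / _) _).
  by apply: eq_rint => t _; case: (F _).
rewrite -mulNr -mulN1r -rintZ//; congr (_ / _); apply: eq_rint => t _.
by rewrite mulN1r; case: (F _).
Qed.

(** The factor 2 comes from bounding real and imaginary parts separately; it is harmless for the
    convergence and growth estimates below. *)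
Lemma cmean_bound F M : circc F -> (forall w, cabs w = r -> cabs (F w) <= M) ->
  cabs (cmean F) <= 2 * M.
Proof.
have rp : `|r| = r by rewrite gtr0_norm//; case/andP: r01.
move=> [f1 f2] hM; have p2 := twopi_gt0.
have h (g : R -> R) : rcont 0 (2 * pi) g -> (forall t, `|g t| <= M) ->
    `|rint 0 (2 * pi) g / (2 * pi)| <= M.
  move=> cg hg; rewrite normrM normfV (gtr0_norm p2) ler_pdivrMr//.
  by have := rint_bound (ltW p2) cg (fun t _ => hg t); rewrite subr0.
apply: le_trans (cabs_le_ReIm _) _; rewrite mulr_natl mulr2n; apply: lerD; apply: h => // t.
- by apply: le_trans (Re_le_cabs _) (hM _ _); rewrite cabs_pt.
- by apply: le_trans (Im_le_cabs _) (hM _ _); rewrite cabs_pt.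
Qed.

Lemma cmean_value F K (z0 : R[i]) : cabs z0 < 1 ->
  (forall w, cabs w < 1 -> ccont F w) ->
  (forall w, cabs w < 1 -> cabs (F w) <= K) ->
  (forall w, cabs w < 1 -> w != z0 -> exists d, cdiff F w d) ->
  cmean F = F 0.
Proof.
have /andP[r0 r1] := r01; have p2 := twopi_gt0.
have rr : 0 <= r < 1 by rewrite ltW.
move=> z1 cF bF dF.
have e2 : rint 0 (2 * pi) (fun t => complex.Im (F (pt r t))) = complex.Im (F 0) * (2 * pi).
  exact: (imean_value z1 cF bF dF).
have ii (z : R[i]) : complex.Im ('i%C * z) = complex.Re z by case: z => a b /=; ring.
have iabs (z : R[i]) : cabs ('i%C * z) = cabs z.
  by rewrite cabsM -[RHS]mul1r; congr (_ * _); rewrite /= expr0n expr1n add0r sqrtr1.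
(* The real part of F is the imaginary part of i F. *)
have e1 : rint 0 (2 * pi) (fun t => complex.Re (F (pt r t))) = complex.Re (F 0) * (2 * pi).
  rewrite -ii -(@imean_value (fun w => 'i%C * F w) K z0 z1 _ _ _ r rr).
  - by apply: eq_rint => t _; rewrite ii.
  - move=> w /cF h e /h[d d0 H]; exists d => // k /H.
    by rewrite -mulrBr iabs.
  - by move=> w /bF; rewrite iabs.
  - move=> w w1 wz; have [d hd] := dF w w1 wz; exists ('i%C * d) => e /hd[dl dl0 H].
    exists dl => // k /H; move=> hk.
    rewrite (_ : 'i%C * _ - _ - _ = 'i%C * (F (w + k) - F w - k * d)) ?iabs//.
    by ring.
by rewrite /cmean e1 e2 !mulfK ?gt_eqF//; case: (F 0).
Qed.

End cmean.
End circle_mean.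

(** * Power series expansion of bounded analytic functions *)

Section cauchy.
Context {R : realType}.

Lemma cdiff_local (f g : R[i] -> R[i]) w d (rho : R) : 0 < rho ->
  (forall h, cabs h < rho -> f (w + h) = g (w + h)) -> cdiff f w d -> cdiff g w d.
Proof.
move=> rho0 fg hf e /hf[dl dl0 H]; exists (Num.min rho dl); first by rewrite lt_min rho0.
move=> h; rewrite lt_min => /andP[/fg <- /H].
by have := fg 0; rewrite cabs0 addr0 => /(_ rho0) <-.
Qed.

Lemma derivable_ex_cdiff (f : Cplx R -> Cplx R) (w : Cplx R) :
  derivable f w 1 -> exists d, cdiff f w d.
Proof. by move=> h; exists (derive1 f w); exact: derivable_cdiff. Qed.

Lemma derivable_quot (f : Cplx R -> Cplx R) (k z0 w : Cplx R) : derivable f w 1 -> w != z0 ->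
  derivable (fun w : Cplx R => w * (f w - k) * (w - z0)^-1 : Cplx R) w 1.
Proof.
move=> df wz.
have hid : derivable (id : Cplx R -> Cplx R) w 1 by exact: derivable_id.
have hb := derivableB df (derivable_cst k w 1).
have hb' := derivableB hid (derivable_cst z0 w 1).
have wz0 : ((id : Cplx R -> Cplx R) - cst z0) w != 0 by rewrite /= subr_eq0.
exact: (derivableM (derivableM hid hb) (derivableV wz0 hb')).
Qed.

Lemma derivable_pow (f : Cplx R -> Cplx R) n (w : Cplx R) : derivable f w 1 ->
  derivable (fun w : Cplx R => f w ^+ n : Cplx R) w 1.
Proof.
move=> df; elim: n => [|n IH]; first exact: (derivable_cst (1 : Cplx R) w 1).
have h := derivableM df IH.
rewrite (_ : (fun w => _) = f * (fun w : Cplx R => f w ^+ n : Cplx R))//.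
by apply/funext => v; rewrite exprS.
Qed.

Lemma derivable_monom n (w : Cplx R) : derivable (fun w : Cplx R => w ^+ n : Cplx R) w 1.
Proof.
have hid : derivable (id : Cplx R -> Cplx R) w 1 by exact: derivable_id.
exact: (@derivable_pow (id : Cplx R -> Cplx R) n w hid).
Qed.

Lemma ccont_pow n (w : R[i]) : ccont (fun w => w ^+ n) w.
Proof. by have [d] := derivable_ex_cdiff (@derivable_monom n w); exact: cdiff_ccont. Qed.

Section expansion.
Variables (f : Cplx R -> Cplx R) (M : R).
Hypothesis df : analytic_on_disc f.
Hypothesis fM : forall w, cabs w < 1 -> cabs (f w) <= M.

Let cf w : cabs w < 1 -> ccont f w.
Proof. by move=> w1; apply: cdiff_ccont; apply: derivable_cdiff; exact: df. Qed.

Let M0 : 0 <= M.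
Proof. by apply: le_trans (cabs_ge0 _) (fM (w := 0) _); rewrite cabs0. Qed.

Variable z0 : R[i].
Hypothesis z1 : cabs z0 < 1.

Let d0 := derive1 f z0.
(** The factor w turns a circle mean into a contour integral of the difference quotient, and gives
    the value 0 at w = 0. Hence its mean vanishes, which is Cauchy's formula for f at z0. The value
    at z0 is the continuous extension. *)
Definition diffquot (w : R[i]) : R[i] :=
  if w == z0 then z0 * d0 else w * (f w - f z0) * (w - z0)^-1.

Lemma diffquot_cdiff w : cabs w < 1 -> w != z0 -> exists d, cdiff diffquot w d.
Proof.
move=> w1 wz.
have [d hd] := derivable_ex_cdiff (@derivable_quot f (f z0) z0 w (df w1) wz).
exists d; have wz0 : 0 < cabs (w - z0) by rewrite cabs_gt0 subr_eq0.
apply: cdiff_local wz0 _ hd => h hw; rewrite /diffquot ifF//.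
apply/negP => /eqP e; move: hw; rewrite (_ : w - z0 = - h) ?cabsN ?ltxx//.
by rewrite -e; ring.
Qed.

(** Small e gives continuity of [diffquot] at z0; e = 1 gives boundedness near z0. *)
Let near_quot e : 0 < e -> exists2 dl : R, 0 < dl & forall h, cabs h < dl ->
  cabs (diffquot (z0 + h) - z0 * d0) <= e * cabs z0 + cabs h * (e + cabs d0).
Proof.
move=> e0; have [dl dl0 H] := derivable_cdiff (df z1) e0.
exists dl => // h /H hh; rewrite /diffquot.
have z0h : 0 <= cabs z0 := cabs_ge0 _; have h0 : 0 <= cabs h := cabs_ge0 _.
have d00 : 0 <= cabs d0 := cabs_ge0 _.
have [hE|hN] := eqVneq (z0 + h) z0.
  by rewrite subrr cabs0 addr_ge0 ?mulr_ge0 ?addr_ge0// ltW.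
have hne : h != 0 by apply: contraNneq hN => ->; rewrite addr0.
pose E := (f (z0 + h) - f z0 - h * d0) / h.
have Ee : cabs E <= e by rewrite /E cabsM cabsV ler_pdivrMr// cabs_gt0.
have -> : (z0 + h) * (f (z0 + h) - f z0) * (z0 + h - z0)^-1 - z0 * d0 =
   z0 * E + h * (E + d0).
  by rewrite /E (_ : z0 + h - z0 = h); [field|ring].
apply: le_trans (cabsD _ _) _; rewrite (cabsM z0 E) (cabsM h); apply: lerD.
  by rewrite [leLHS]mulrC; apply: ler_wpM2r.
by apply: ler_wpM2l => //; rewrite (le_trans (cabsD _ _))// lerD2r.
Qed.

Lemma diffquot_ccont w : cabs w < 1 -> ccont diffquot w.
Proof.
move=> w1; have [->|wz] := eqVneq w z0; last first.
  by have [d] := diffquot_cdiff w1 wz; exact: cdiff_ccont.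
move=> e e0; have d00 : 0 <= cabs d0 := cabs_ge0 _.
have e2 : 0 < e / 2 by rewrite divr_gt0.
have [dl dl0 H] := near_quot e2.
have dd : 0 < e / 2 + cabs d0 by rewrite ltr_pwDl.
exists (Num.min dl (e / 2 / (e / 2 + cabs d0))); first by rewrite lt_min dl0 divr_gt0.
move=> h; rewrite lt_min ltr_pdivlMr// => /andP[/H h1 h2].
have -> : diffquot z0 = z0 * d0 by rewrite /diffquot eqxx.
apply: (le_trans h1); rewrite [leRHS](splitr e); apply: lerD; last exact: ltW.
by rewrite -[leRHS]mulr1; apply: ler_wpM2l; rewrite ltW.
Qed.

Lemma near_quot_bound (z w d m : R) : 0 <= z -> z <= 1 -> w <= 2 -> 0 <= d -> 0 <= m ->
  1 * z + w * (1 + d) + z * d <= 3 + 3 * d + m.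
Proof. by move=> z0' z1' w2 dp mp; nra. Qed.

Lemma diffquot_bounded : exists K, forall w, cabs w < 1 -> cabs (diffquot w) <= K.
Proof.
have [dl dl0 H] := near_quot ltr01.
exists (3 + 3 * cabs d0 + 2 * M / dl) => w w1; have d00 : 0 <= cabs d0 := cabs_ge0 _.
have Md : 0 <= 2 * M / dl by rewrite divr_ge0 ?mulr_ge0// ltW.
have [wn|wf] := ltP (cabs (w - z0)) dl.
  have := H _ wn; rewrite subrKC => hq.
  have := cabsD (diffquot w - z0 * d0) (z0 * d0); rewrite subrK cabsM => h.
  apply: le_trans h (le_trans (lerD hq (lexx _)) _).
  apply: near_quot_bound => //; first exact: cabs_ge0; first exact: ltW.
  by apply: le_trans (cabsB _ _) _; rewrite mulr2n lerD// ltW.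
rewrite /diffquot ifF; last first.
  by apply: contraTF wf => /eqP ->; rewrite subrr cabs0 -ltNge.
rewrite cabsM cabsV cabsM.
apply: (@le_trans _ _ (2 * M / dl)); last by lra.
apply: ler_pM; rewrite ?mulr_ge0 ?invr_ge0 ?cabs_ge0//; last first.
  by rewrite lef_pV2 ?posrE// (lt_le_trans dl0).
rewrite -[leRHS]mul1r; apply: ler_pM; rewrite ?cabs_ge0 ?(ltW w1)//.
by apply: le_trans (cabsB _ _) _; rewrite mulr_natl mulr2n lerD// fM.
Qed.

Variable r : R.
Hypothesis r01 : 0 < r < 1.
Hypothesis zr : cabs z0 < r.

Let r0 : 0 < r. Proof. by case/andP: r01. Qed.
Let r1 : r < 1. Proof. by case/andP: r01. Qed.

Lemma cont_pow_inv w k : cabs w = r -> ccont (fun w => w^-1 ^+ k) w.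
Proof.
move=> wr; have w0 : w != 0 by rewrite -cabs_gt0 wr.
have h : derivable (fun w : Cplx R => w^-1 ^+ k : Cplx R) w 1.
  have hid : derivable (id : Cplx R -> Cplx R) w 1 by exact: derivable_id.
  have hv : derivable (fun w : Cplx R => w^-1 : Cplx R) w 1.
    exact: (derivableV (f := (id : Cplx R -> Cplx R)) w0 hid).
  exact: (@derivable_pow (fun w : Cplx R => w^-1 : Cplx R) k w hv).
by have [d] := derivable_ex_cdiff h; exact: cdiff_ccont.
Qed.

Lemma circc_invpow k : circc r (fun w => w^-1 ^+ k).
Proof. by apply: circc_cont => // w; exact: cont_pow_inv. Qed.

Lemma circc_f : circc r f.
Proof. by apply: circc_cont => // w wr; apply: cf; rewrite wr. Qed.

(** Cauchy's coefficient formula on the circle of radius r; [fcoefE] identifies it with the Taylor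
    coefficient for every r. *)
Definition fcoef k : R[i] := cmean r (fun w => f w * w^-1 ^+ k).

Lemma cmean_pow k : cmean r (fun w => w ^+ k) = (k == 0%N)%:R.
Proof.
rewrite (@cmean_value _ r r01 (fun w => w ^+ k) 1 0) ?cabs0 ?expr0n//.
- by move=> w _; exact: ccont_pow.
- by move=> w w1; rewrite cabsX exprn_ile1 ?cabs_ge0// ltW.
- by move=> w _ _; exact: derivable_ex_cdiff (@derivable_monom k w).
Qed.

Lemma circc_pow k : circc r (fun w => w ^+ k).
Proof. by apply: circc_cont => // w _; exact: ccont_pow. Qed.

Lemma conj_circle (w : R[i]) k : cabs w = r ->
  conjc (w ^+ k) = (r ^+ 2)%:C%C ^+ k * w^-1 ^+ k.
Proof.
move=> wr; have w0 : w != 0 by rewrite -cabs_gt0 wr.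
rewrite rmorphXn -exprMn; congr (_ ^+ _); apply: (mulfI w0).
rewrite mulrCA mulfV// mulr1 -wr cabs_sq; case: (w) => a b /=.
by apply: complex_ext => /=; ring.
Qed.

(** On |w| = r the conjugate of w is r^2 / w, so negative powers are multiples of conjugates of
    positive ones. *)
Lemma cmean_invpow k : cmean r (fun w => w^-1 ^+ k) = (k == 0%N)%:R.
Proof.
have r20 : r ^+ 2 != 0 by rewrite gt_eqF// exprn_gt0.
have -> : cmean r (fun w => w^-1 ^+ k) = cmean r (fun w => ((r ^+ 2)^-1%:C%C) ^+ k * conjc (w ^+ k)).
  apply: cmean_eq => // w wr.
  by rewrite conj_circle// mulrA -exprMn -rmorphM mulVf// expr1n mul1r.
rewrite cmeanZ; last exact: circc_conj (circc_pow k).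
rewrite cmean_conj ?cmean_pow ?conjc_nat; last exact: circc_pow.
by case: k => [|k]; rewrite ?expr0 ?mul1r// mulr0.
Qed.

Lemma partial_geom (w : R[i]) n : w != 0 -> w != z0 ->
  w * (w - z0)^-1 * (1 - (z0 / w) ^+ n) = \sum_(k < n) (z0 / w) ^+ k.
Proof.
move=> w0 wz; have w1 : 1 - z0 / w != 0.
  rewrite subr_eq0 eq_sym; apply: contraNneq wz => h.
  by rewrite -[z0](divfK w0) h mul1r.
apply: (mulfI w1).
rewrite -[in RHS](opprB (z0 / w) 1) mulNr -subrX1 opprB.
have e : (1 - z0 / w) * (w * (w - z0)^-1) = 1 by field; rewrite w0 subr_eq0 wz.
by rewrite mulrA e mul1r.
Qed.

(** [diffquot] is (f w - f z0) times the kernel w / (w - z0), and it has mean 0. Replacing the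
    kernel by its geometric partial sum leaves an error containing (z0 / w)^n. *)
Lemma fcoef_partial n : (0 < n)%N ->
  \sum_(k < n) fcoef k * z0 ^+ k - f z0 = - cmean r (fun w => diffquot w * (z0 / w) ^+ n).
Proof.
move=> n0.
have [K HK] := diffquot_bounded.
have v0 : cmean r diffquot = 0.
  rewrite (cmean_value r01 z1 diffquot_ccont HK diffquot_cdiff).
  by rewrite /diffquot; case: eqP => [<-|_]; rewrite ?mul0r.
have cq : circc r diffquot by apply: circc_cont => // w wr; apply: diffquot_ccont; rewrite wr.
have cz k : circc r (fun w => (z0 / w) ^+ k).
  by under eq_fun do rewrite exprMn; apply: circcM; [exact: circc_cst|exact: circc_invpow].
have cfz : circc r (fun w => f w - f z0) by apply: circcD; [exact: circc_f|exact: circc_cst].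
have cg k : circc r (fun w => z0 ^+ k * ((f w - f z0) * w^-1 ^+ k)).
  by apply: circcM; [exact: circc_cst|apply: circcM => //; exact: circc_invpow].
have [_ hs] := cmean_sum n cg.
have e1 : cmean r (fun w => \sum_(k < n) z0 ^+ k * ((f w - f z0) * w^-1 ^+ k)) =
    cmean r (fun w => diffquot w + (- 1) * (diffquot w * (z0 / w) ^+ n)).
  apply: cmean_eq => // w wr.
  have w0 : w != 0 by rewrite -cabs_gt0 wr.
  have wz : w != z0 by apply: contraTneq zr => <-; rewrite wr ltxx.
  rewrite mulN1r -[X in X - _ * _]mulr1 -mulrBr /diffquot (negbTE wz).
  rewrite (eq_bigr (fun k : 'I_n => (f w - f z0) * (z0 / w) ^+ k)); last first.
    by move=> k _; rewrite exprMn; ring.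
  by rewrite -mulr_sumr -partial_geom// !mulrA [in RHS](mulrC w).
rewrite hs cmeanD// in e1; last by apply: circcM; [exact: circc_cst|exact: circcM].
rewrite cmeanZ ?v0 ?add0r ?mulN1r in e1; last exact: circcM.
have one : \sum_(k < n) z0 ^+ k * (k == 0%N :> nat)%:R = 1.
  case: n n0 {hs e1} => // n _; rewrite big_ord_recl/= expr0 mulr1 big1 ?addr0// => k _.
  by rewrite mulr0.
rewrite -e1 -[X in _ - X = _]mulr1 -[X in _ - _ * X = _]one.
rewrite mulr_sumr -sumrB; apply: eq_bigr => k _.
rewrite cmeanZ; last by apply: circcM cfz (circc_invpow k).
have -> : cmean r (fun w => (f w - f z0) * w^-1 ^+ k) = fcoef k - f z0 * (k == 0%N :> nat)%:R.
  rewrite -cmean_invpow -[RHS]/(fcoef k - _) -mulNr -cmeanZ; last exact: circc_invpow.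
  rewrite -cmeanD.
  - by apply: cmean_eq => // w _; ring.
  - by apply: circcM; [exact: circc_f|exact: circc_invpow].
  - by apply: circcM; [exact: circc_cst|exact: circc_invpow].
by ring.
Qed.

Lemma fcoef_psum : psum fcoef z0 (f z0).
Proof.
have [K HK] := diffquot_bounded.
have K0 : 0 <= K by apply: le_trans (cabs_ge0 _) (HK 0 _); rewrite cabs0.
pose q := cabs z0 / r.
have q0 : 0 <= q by rewrite divr_ge0 ?cabs_ge0// ltW.
have q1 : q < 1 by rewrite ltr_pdivrMr// mul1r.
have hb n : (0 < n)%N -> cabs (\sum_(k < n) fcoef k * z0 ^+ k - f z0) <= 2 * (K * q ^+ n).
  move=> n0; rewrite fcoef_partial// cabsN; apply: cmean_bound => //.
    apply: circcM; first by apply: circc_cont => // w wr; apply: diffquot_ccont; rewrite wr.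
    by under eq_fun do rewrite exprMn; apply: circcM; [exact: circc_cst|exact: circc_invpow].
  move=> w wr; rewrite cabsM cabsX cabsM cabsV wr -/q.
  by apply: ler_wpM2r; [exact: exprn_ge0|apply: HK; rewrite wr].
move=> e e0.
have : 2 * K * q ^+ n @[n --> \oo] --> 2 * K * 0.
  by apply: cvgM; [exact: cvg_cst|apply: cvg_expr; rewrite ger0_norm].
rewrite mulr0 => /cvgrPdist_le/(_ e e0)[N _ HN].
exists N.+1 => n Nn; apply: le_trans (hb n (leq_trans _ Nn)) _ => //.
have := HN n (ltnW Nn); rewrite sub0r normrN ger0_norm ?mulrA//.
by rewrite !mulr_ge0// exprn_ge0.
Qed.

Lemma fcoef_bound k : cabs (fcoef k) * r ^+ k <= 2 * M.
Proof.
have rk : 0 < r ^+ k by rewrite exprn_gt0.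
rewrite -ler_pdivlMr// -mulrA; apply: cmean_bound => //.
  by apply: circcM; [exact: circc_f|exact: circc_invpow].
move=> w wr; rewrite cabsM cabsX cabsV wr exprVn; apply: ler_wpM2r; first by rewrite invr_ge0 ltW.
by apply: fM; rewrite wr.
Qed.

End expansion.

Lemma fcoefE (f : Cplx R -> Cplx R) (M r : R) : analytic_on_disc f ->
  (forall w, cabs w < 1 -> cabs (f w) <= M) -> 0 < r < 1 -> taylor_coef f = fcoef f r.
Proof.
move=> df fM r01; have /andP[r0 r1] := r01; apply/funext => k.
apply: (taylor_coefE (rho := r)) => //.
  move=> s /andP[s0 sr]; exists (2 * M) => n; apply: le_trans (fcoef_bound df fM r01 n).
  by rewrite ler_wpM2l ?cabs_ge0// lerXn2r ?nnegrE// ltW.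
by move=> w wr; apply: (fcoef_psum df fM _ r01) => //; exact: lt_trans r1.
Qed.

Lemma taylor_expansion (f : Cplx R -> Cplx R) (M : R) : analytic_on_disc f ->
  (forall w, cabs w < 1 -> cabs (f w) <= M) ->
  cgrow (taylor_coef f) 1 /\ forall z, cabs z < 1 -> psum (taylor_coef f) z (f z).
Proof.
move=> df fM; have key r := fcoefE df fM (r := r).
split.
  by move=> r r01; exists (2 * M) => k; rewrite (key r r01); exact: fcoef_bound.
move=> z z1; pose r := (cabs z + 1) / 2.
have z0 := cabs_ge0 z.
have r01 : 0 < r < 1 by rewrite /r; apply/andP; split; lra.
by rewrite (key r r01); apply: (fcoef_psum df fM _ r01) => //; rewrite /r; lra.
Qed.

End cauchy.

(** * Orthogonality on circles: Bessel's inequality and the Hardy space bound *)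

Section square_mean.
Context {R : realType}.
Implicit Types (F : R[i] -> R[i]) (c : nat -> R[i]).

Definition sqmean (r : R) F : R := complex.Re (cmean r (fun w => F w * conjc (F w))).

Lemma mul_conjc (z : R[i]) : z * conjc z = (cabs z ^+ 2)%:C%C.
Proof. by rewrite cabs_sq; case: z => a b; apply: complex_ext => /=; ring. Qed.

Lemma sqmean_rint r F :
  sqmean r F = rint 0 (2 * pi) (fun t => cabs (F (pt r t)) ^+ 2) / (2 * pi).
Proof. by rewrite /sqmean/=; congr (_ / _); apply: eq_rint => t _; rewrite mul_conjc. Qed.

Lemma sqmean_ge0 r F : 0 <= sqmean r F.
Proof.
rewrite sqmean_rint divr_ge0 ?mulr_ge0 ?pi_ge0// /rint.
by apply: Rintegral_ge0 => t _; exact: sqr_ge0.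
Qed.

Section circle.
Variable r : R.
Hypothesis r01 : 0 < r < 1.

Let r0 : 0 < r. Proof. by case/andP: r01. Qed.

Lemma rcont_sq F : circc r F -> rcont 0 (2 * pi) (fun t => cabs (F (pt r t)) ^+ 2).
Proof.
move=> hF; have [h _] := circcM hF (circc_conj hF).
rewrite (_ : (fun t => _) = fun t => complex.Re (F (pt r t) * conjc (F (pt r t))))//.
by apply/funext => t; rewrite mul_conjc.
Qed.

Lemma sqmean_le F (B : R) : circc r F -> (forall w, cabs w = r -> cabs (F w) ^+ 2 <= B) ->
  sqmean r F <= B.
Proof.
move=> hF hB; have p2 := @twopi_gt0 R.
rewrite sqmean_rint ler_pdivrMr//.
have := @rint_cst R 0 (2 * pi) B (ltW p2); rewrite subr0 => <-.
apply: rint_le; [exact: rcont_sq|exact: rcont_cst|move=> t _].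
by apply: hB; rewrite cabs_pt gtr0_norm.
Qed.

Lemma cmean_monom j k : cmean r (fun w => w ^+ j * conjc (w ^+ k)) =
  ((j == k)%:R * (r ^+ 2) ^+ k)%:C%C.
Proof.
have [kj|jk] := leqP k j.
  rewrite (@cmean_eq _ _ r01 _ (fun w => (r ^+ 2)%:C%C ^+ k * w ^+ (j - k))); last first.
    move=> w wr; have w0 : w != 0 by rewrite -cabs_gt0 wr.
    rewrite (conj_circle r01 _ wr) -{1}(subnK kj) exprD mulrCA -!mulrA -exprMn mulfV// expr1n.
    by rewrite mulr1.
  rewrite cmeanZ; last exact: circc_pow.
  rewrite cmean_pow// subn_eq0 [(j <= k)%N in LHS](_ : _ = (j == k)); last first.
    by rewrite eqn_leq kj andbT.
  by rewrite -rmorphXn mulrC rmorphM rmorph_nat.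
rewrite (@cmean_eq _ _ r01 _ (fun w => (r ^+ 2)%:C%C ^+ k * w^-1 ^+ (k - j))); last first.
  move=> w wr; have w0 : w != 0 by rewrite -cabs_gt0 wr.
  rewrite (conj_circle r01 _ wr) -{2}(subnK (ltnW jk)) exprD mulrCA; congr (_ * _).
  by rewrite [X in _ * X = _]mulrC mulrA -exprMn mulfV// expr1n mul1r.
rewrite cmeanZ; last exact: circc_invpow.
by rewrite cmean_invpow// subn_eq0 leqNgt jk ltn_eqF// mulr0 mul0r.
Qed.

(** Pythagoras: by the hypothesis c w^n is the orthogonal projection of F on w^n, and |w^n|^2 has
    mean r^(2n). *)
Lemma sqmean_sub F (c : R[i]) n : circc r F ->
  cmean r (fun w => F w * conjc (w ^+ n)) = c * ((r ^+ 2) ^+ n)%:C%C ->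
  sqmean r (fun w => F w - c * w ^+ n) = sqmean r F - cabs c ^+ 2 * (r ^+ 2) ^+ n.
Proof.
move=> hF hc; rewrite /sqmean.
have hw := circc_pow r01 n; have hm := circcM hF (circc_conj hw).
have cc k : circc r (fun=> k) by exact: circc_cst.
rewrite (@cmean_eq _ _ r01 _ (fun w => F w * conjc (F w) +
  ((- conjc c) * (F w * conjc (w ^+ n)) + ((- c) * conjc (F w * conjc (w ^+ n)) +
   (c * conjc c) * (w ^+ n * conjc (w ^+ n)))))); last first.
  by move=> w _; rewrite rmorphB !rmorphM/= conjcK; ring.
have hww := circcM hw (circc_conj hw); have hmc := circc_conj hm.
have h1 := circcM (cc (- conjc c)) hm; have h2 := circcM (cc (- c)) hmc.
have h3 := circcM (cc (c * conjc c)) hww.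
rewrite (cmeanD (circcM hF (circc_conj hF)) (circcD h1 (circcD h2 h3))).
rewrite (cmeanD h1 (circcD h2 h3)) (cmeanD h2 h3) (cmeanZ _ hm) (cmeanZ _ hmc) (cmeanZ _ hww).
rewrite cmean_conj// hc cmean_monom eqxx mul1r rmorphM/=.
rewrite [X in complex.Re (_ + X)](_ : _ = - (cabs c ^+ 2 * (r ^+ 2) ^+ n)%:C%C).
  by rewrite ReD ReN.
rewrite rmorphM/= -mul_conjc oppr0.
rewrite (_ : Complex _ 0 = ((r ^+ 2) ^+ n)%:C%C)//; ring.
Qed.

Lemma cmean_poly c n k : cmean r (fun w => (\sum_(j < n) c j * w ^+ j) * conjc (w ^+ k)) =
  (k < n)%:R * c k * ((r ^+ 2) ^+ k)%:C%C.
Proof.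
have hm j : circc r (fun w => c j * (w ^+ j * conjc (w ^+ k))).
  apply: circcM; first exact: circc_cst.
  by apply: circcM; [exact: circc_pow|apply: circc_conj; exact: circc_pow].
rewrite (@cmean_eq _ _ r01 _ (fun w => \sum_(j < n) c j * (w ^+ j * conjc (w ^+ k)))); last first.
  by move=> w _; rewrite mulr_suml; apply: eq_bigr => j _; rewrite mulrA.
have [_ ->] := cmean_sum n hm.
have e (j : 'I_n) : cmean r (fun w => c j * (w ^+ j * conjc (w ^+ k))) =
    (j == k :> nat)%:R * (c k * ((r ^+ 2) ^+ k)%:C%C).
  rewrite cmeanZ; last by apply: circcM; [exact: circc_pow|apply: circc_conj; exact: circc_pow].
  rewrite cmean_monom rmorphM/= rmorph_nat; case: eqP => [->|_]; first by rewrite !mul1r.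
  by rewrite !mul0r mulr0.
rewrite (eq_bigr _ (fun j _ => e j)) -mulr_suml -mulrA; congr (_ * _).
have [kn|nk] := ltnP k n.
  rewrite (bigD1 (Ordinal kn))//= eqxx big1 ?addr0// => j.
  by rewrite -val_eqE/= => /negbTE ->.
by rewrite big1// => j _; rewrite ltn_eqF// (leq_trans (ltn_ord j)).
Qed.

Lemma circc_poly c n : circc r (fun w => \sum_(j < n) c j * w ^+ j).
Proof.
have hm j : circc r (fun w => c j * w ^+ j) by apply: circcM; [exact: circc_cst|exact: circc_pow].
by have [] := cmean_sum n hm.
Qed.

Lemma sqmean_poly c n : sqmean r (fun w => \sum_(j < n) c j * w ^+ j) =
  \sum_(j < n) cabs (c j) ^+ 2 * (r ^+ 2) ^+ j.
Proof.
elim: n => [|n IH].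
  rewrite big_ord0; apply/eqP; rewrite eq_le sqmean_ge0 andbT.
  by apply: sqmean_le; [exact: circc_poly|move=> w _; rewrite big_ord0 cabs0 expr0n].
have := @sqmean_sub (fun w => \sum_(j < n.+1) c j * w ^+ j) (c n) n (circc_poly c n.+1).
rewrite cmean_poly ltnSn mul1r => /(_ erefl).
rewrite (_ : (fun w => _ - _) = fun w => \sum_(j < n) c j * w ^+ j); last first.
  by apply/funext => w; rewrite big_ord_recr/= addrK.
by rewrite IH big_ord_recr/= => ->; rewrite subrK.
Qed.

Lemma bessel F c n : circc r F ->
  (forall k, cmean r (fun w => F w * conjc (w ^+ k)) = c k * ((r ^+ 2) ^+ k)%:C%C) ->
  sqmean r (fun w => F w - \sum_(j < n) c j * w ^+ j) =
  sqmean r F - \sum_(j < n) cabs (c j) ^+ 2 * (r ^+ 2) ^+ j.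
Proof.
move=> hF hc; elim: n => [|n IH].
  by rewrite big_ord0 subr0; congr sqmean; apply/funext => w; rewrite big_ord0 subr0.
pose Q w := F w - \sum_(j < n) c j * w ^+ j.
have cN : circc r (fun w => (- 1) * \sum_(j < n) c j * w ^+ j).
  by apply: circcM; [exact: circc_cst|exact: circc_poly].
have hQ : circc r Q.
  rewrite (_ : Q = fun w => F w + (- 1) * \sum_(j < n) c j * w ^+ j); first exact: circcD.
  by apply/funext => w; rewrite mulN1r.
have hw k := circc_conj (circc_pow r01 k).
rewrite (_ : (fun w => _) = fun w => Q w - c n * w ^+ n); last first.
  by apply/funext => w; rewrite big_ord_recr/= opprD addrA.
rewrite sqmean_sub// ?IH ?big_ord_recr/= ?opprD ?addrA//.
rewrite (@cmean_eq _ _ r01 _ (fun w => F w * conjc (w ^+ n) +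
   (- 1) * ((\sum_(j < n) c j * w ^+ j) * conjc (w ^+ n)))); last first.
  by move=> w _; rewrite /Q; ring.
have hp := circcM (circc_poly c n) (hw n).
rewrite cmeanD ?cmeanZ ?hc ?cmean_poly ?ltnn//; last 2 first.
- exact: circcM.
- by apply: circcM => //; exact: circc_cst.
by rewrite !mul0r mulr0 addr0.
Qed.

End circle.

(** Bessel's inequality on |w| = r, then r tends to 1 from the left in the finite sum. *)
Lemma coef_sq_sum (f : Cplx R -> Cplx R) (M : R) : analytic_on_disc f ->
  (forall w, cabs w < 1 -> cabs (f w) <= M) ->
  forall n, \sum_(k < n) cabs (taylor_coef f k) ^+ 2 <= M ^+ 2.
Proof.
move=> df fM n.
have hr r : 0 < r < 1 -> \sum_(k < n) cabs (taylor_coef f k) ^+ 2 * (r ^+ 2) ^+ k <= M ^+ 2.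
  move=> r01; have /andP[r0 r1] := r01; have cf := circc_f df r01.
  have := @bessel r r01 f (taylor_coef f) n cf.
  rewrite (fcoefE df fM r01) => H.
  rewrite -subr_ge0; apply: (@le_trans _ _ (sqmean r f -
     \sum_(k < n) cabs (fcoef f r k) ^+ 2 * (r ^+ 2) ^+ k)); last first.
    rewrite lerB// (sqmean_le r01)// => w wr.
    by rewrite lerXn2r ?nnegrE ?cabs_ge0 ?fM ?wr// (le_trans (cabs_ge0 _) (fM w _)) ?wr.
  rewrite -H ?sqmean_ge0// => k.
  rewrite (@cmean_eq _ _ r01 _ (fun w => (r ^+ 2)%:C%C ^+ k * (f w * w^-1 ^+ k))); last first.
    by move=> w wr; rewrite (conj_circle r01 _ wr) mulrCA.
  rewrite cmeanZ ?rmorphXn 1?[RHS]mulrC//.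
  by apply: circcM => //; exact: circc_invpow.
pose g r : R := \sum_(k < n) cabs (taylor_coef f k) ^+ 2 * (r ^+ 2) ^+ k.
have cg : g r @[r --> 1^'-] --> \sum_(k < n) cabs (taylor_coef f k) ^+ 2.
  have -> : \sum_(k < n) cabs (taylor_coef f k) ^+ 2 = g 1.
    by apply: eq_bigr => k _; rewrite !expr1n mulr1.
  apply: cvg_at_left_filter; rewrite /g.
  elim: n {hr g} => [|m IH].
    rewrite big_ord0 (_ : (fun r => _) = fun=> 0); first exact: cvg_cst.
    by apply/funext => r; rewrite big_ord0.
  rewrite big_ord_recr/= (_ : (fun r => _) = fun r : R =>
    \sum_(k < m) cabs (taylor_coef f k) ^+ 2 * (r ^+ 2) ^+ k + cabs (taylor_coef f m) ^+ 2 * r ^+ (2 * m)).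
    apply: cvgD; first exact: IH.
    apply: cvgM; first exact: cvg_cst.
    by rewrite -exprM; exact: exprn_continuous.
  by apply/funext => r; rewrite big_ord_recr/= exprM.
rewrite -(cvg_lim _ cg)//; apply: limr_le; first by apply/cvg_ex; eexists; exact: cg.
near=> r; apply: hr; apply/andP; split; near: r; first exact: nbhs_left_gt.
exact: nbhs_left_lt.
Unshelve. all: by end_near. Qed.

Lemma sq_le_double (x y z : R) : 0 <= x -> 0 <= y -> x <= z + y -> z <= 1 ->
  x ^+ 2 <= 2 * y ^+ 2 + 2.
Proof. by move=> x0 y0 h1 h2; have := sqr_ge0 (y - 1); nra. Qed.

(** On the circle g differs from a partial sum P by at most 1, so |g|^2 <= 2 |P|^2 + 2, and the mean
    of |P|^2 is a finite sum. This crude bound suffices for membership in H^2. *)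
Lemma circle_mean2_bound (g : Cplx R -> Cplx R) c (C r : R) :
  (forall n, \sum_(k < n) cabs (c k) ^+ 2 <= C) ->
  (forall w, cabs w < 1 -> psum c w (g w)) -> 0 <= r < 1 ->
  (circle_mean2 g r <= (2 * C + 2)%:E)%E.
Proof.
move=> hC hg /andP[r0 r1].
have C0 : 0 <= C by apply: le_trans (hC 0%N); rewrite big_ord0.
have cC k : cabs (c k) ^+ 2 <= C.
  apply: le_trans (hC k.+1); rewrite big_ord_recr/= lerDr sumr_ge0// => j _; exact: sqr_ge0.
have p2 := @twopi_gt0 R.
(* The orthogonality lemmas need r > 0; at r = 0 the mean is |c 0|^2. *)
have [re|rN] := eqVneq r 0.
  have p0 t : Complex (r * cos t) (r * sin t) = 0 :> R[i] by rewrite re !mul0r.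
  rewrite /circle_mean2; under eq_integral do rewrite p0.
  rewrite integral_cst//= lebesgue_measure_itv/= lte_fin p2 -EFinB subr0 -!EFinM lee_fin.
  have := cC 0%N; rewrite -(psum0 (hg 0 _)) ?cabs0// => h.
  rewrite mulrCA mulVf ?gt_eqF// mulr1; lra.
have rp : 0 < r by rewrite lt_neqAle eq_sym rN.
have r01 : 0 < r < 1 by rewrite rp.
have gr : cgrow c 1.
  move=> s /andP[s0 s1]; exists (C + 1) => k.
  apply: (@le_trans _ _ (cabs (c k))); first by rewrite ler_piMr ?cabs_ge0// exprn_ile1// ltW.
  by have := cC k; have := cabs_ge0 (c k); move: (cabs _) => x x0 xC; nra.
have gc w : cabs w = r -> ccont g w.
  move=> wr; have w1 : cabs w < 1 by rewrite wr.
  have [d hd] := psum_exists (cgrow_dcoef gr) w1.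
  exact: (cdiff_ccont (psum_cdiff gr hg w1 hd)).
have cg : circc r g by exact: circc_cont.
have -> : circle_mean2 g r = (sqmean r g)%:E.
  rewrite sqmean_rint mulrC EFinM /circle_mean2; congr (_ * _)%E.
  rewrite /rint /Rintegral fineK//.
  by apply: integrable_fin_num => //; exact: (rint_integrable (rcont_sq cg)).
rewrite lee_fin.
have rr : 0 <= r < 1 by rewrite r0.
have [D [q [D0 q01 HD]]] := cgrow_bound gr rr.
have /andP[q0 q1] := q01.
have iq : 0 < 1 - q by rewrite subr_gt0.
have : D * (1 - q)^-1 * q ^+ n @[n --> \oo] --> D * (1 - q)^-1 * 0.
  by apply: cvgM; [exact: cvg_cst|apply: cvg_expr; rewrite ger0_norm].
rewrite mulr0 => /cvgrPdist_le/(_ 1 ltr01)[N _ /(_ N (leqnn _))]/=.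
rewrite sub0r normrN => /(le_trans (ler_norm _)) HN.
pose P w := \sum_(k < N) c k * w ^+ k.
have hP : circc r P by exact: circc_poly.
have tail w : cabs w = r -> cabs (g w - P w) <= 1.
  move=> wr; apply: le_trans HN; apply: csums_tail (hg w _) _; first by rewrite wr.
  move=> n; apply: (@le_trans _ _ (\sum_(k < n) D * q ^+ N * q ^+ k)).
    apply: ler_sum => k _; rewrite cabsM cabsX wr -mulrA -exprD; exact: HD.
  rewrite -mulr_sumr [leRHS]mulrAC; apply: ler_wpM2l; first by rewrite mulr_ge0// exprn_ge0.
  exact: geo_sum0.
apply: (@le_trans _ _ (2 * sqmean r P + 2)).
  rewrite [leLHS]sqmean_rint ler_pdivrMr// [leRHS]mulrDl sqmean_rint -mulrA divfK ?gt_eqF//.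
  have := @rint_cst R 0 (2 * pi) 2 (ltW p2); rewrite subr0 => <-.
  rewrite -rintZ; last exact: rcont_sq.
  have cP := rcont_sq hP.
  have c2 : rcont 0 (2 * pi) (fun t => 2 * cabs (P (pt r t)) ^+ 2).
    by apply: rcontM => //; exact: rcont_cst.
  rewrite -rintD//; last exact: rcont_cst.
  apply: rint_le; [exact: rcont_sq|by apply: rcontD => //; exact: rcont_cst|move=> t _].
  set w := pt r t; have wr : cabs w = r by rewrite cabs_pt gtr0_norm.
  have := tail w wr; have := cabsD (g w - P w) (P w); rewrite subrK.
  have := cabs_ge0 (P w); have := cabs_ge0 (g w).
  exact: sq_le_double.
rewrite lerD2r ler_wpM2l// sqmean_poly//.
apply: le_trans (hC N); apply: ler_sum => k _.
by rewrite ler_piMr ?sqr_ge0// exprn_ile1 ?exprn_ge0// exprn_ile1// ltW.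
Qed.

End square_mean.

(** * The Hilbert matrix operator on bounded functions *)

Section cdiff_calculus.
Context {R : realType}.
Implicit Types (F G : R[i] -> R[i]) (z d e : R[i]).

Lemma is_derive_cdiff (F : Cplx R -> Cplx R) (z d : Cplx R) : is_derive z 1 F d -> cdiff F z d.
Proof.
move=> h; have := derivable_cdiff (@ex_derive _ _ _ _ _ _ _ h).
by rewrite derive1E derive_val.
Qed.

Lemma cdiff_eqd F z d e : cdiff F z d -> d = e -> cdiff F z e.
Proof. by move=> h <-. Qed.

Lemma cdiff_cst k z : cdiff (fun=> k : R[i]) z 0.
Proof. by move=> e e0; exists 1 => // h _; rewrite mulr0 subr0 subrr cabs0 mulr_ge0// ?cabs_ge0// ltW. Qed.

Lemma cdiff_id z : cdiff id z 1.
Proof.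
move=> e e0; exists 1 => // h _; rewrite mulr1 (addrC z) addrK subrr cabs0.
by rewrite mulr_ge0 ?cabs_ge0// ltW.
Qed.

Lemma cdiffD F G z d e : cdiff F z d -> cdiff G z e -> cdiff (fun w => F w + G w) z (d + e).
Proof.
move=> hF hG e' e0; have e2 : 0 < e' / 2 by rewrite divr_gt0.
have [dl dl0 H] := hF _ e2; have [dm dm0 K] := hG _ e2.
exists (Num.min dl dm); first by rewrite lt_min dl0.
move=> h; rewrite lt_min => /andP[/H h1 /K h2].
rewrite (_ : _ - _ = F (z + h) - F z - h * d + (G (z + h) - G z - h * e)); last by ring.
by rewrite (le_trans (cabsD _ _))// (le_trans (lerD h1 h2))// -mulrDl -splitr.
Qed.

Lemma cdiffM F G z d e : cdiff F z d -> cdiff G z e ->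
  cdiff (fun w => F w * G w) z (F z * e + G z * d).
Proof.
move=> /cdiff_is_derive hF /cdiff_is_derive hG.
pose f : Cplx R -> Cplx R := F; pose g : Cplx R -> Cplx R := G.
have h : is_derive (z : Cplx R) 1 (fun w : Cplx R => f w * g w : Cplx R) (f z * e + g z * d).
  exact: (@is_deriveM _ _ f g (z : Cplx R) 1 d e hF hG).
exact: (@is_derive_cdiff (fun w : Cplx R => f w * g w : Cplx R) z _ h).
Qed.

Lemma cdiffZ k F z d : cdiff F z d -> cdiff (fun w => k * F w) z (k * d).
Proof. by move=> hF; apply: cdiff_eqd (cdiffM (cdiff_cst k z) hF) _; rewrite mulr0 addr0. Qed.

Lemma cdiffX F z d n : cdiff F z d -> cdiff (fun w => F w ^+ n.+1) z (n.+1%:R * F z ^+ n * d).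
Proof.
move=> hF; elim: n => [|n IH]; first by rewrite expr0 !mul1r.
under eq_fun do rewrite exprS.
by apply: cdiff_eqd (cdiffM hF IH) _; rewrite -[in RHS]natr1 exprS; ring.
Qed.

Lemma cdiffV F z d : F z != 0 -> cdiff F z d -> cdiff (fun w => (F w)^-1) z (- d / F z ^+ 2).
Proof.
move=> F0 /cdiff_is_derive hF.
have hd := @ex_derive _ _ _ _ _ _ _ hF.
pose f : Cplx R -> Cplx R := F.
have dv : derivable (fun w : Cplx R => (f w)^-1 : Cplx R) (z : Cplx R) 1 by exact: (derivableV (f := f) F0 hd).
have e := @deriveV _ _ f (z : Cplx R) 1 F0 hd.
have := derivable_cdiff dv; rewrite derive1E e derive_val => h.
by apply: cdiff_eqd h _; rewrite scaleNr /GRing.scale/= mulNr mulrC.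
Qed.

Lemma cdiff_sum n (F : nat -> R[i] -> R[i]) (d : nat -> R[i]) z :
  (forall k, cdiff (F k) z (d k)) ->
  cdiff (fun w => \sum_(k < n) F k w) z (\sum_(k < n) d k).
Proof.
move=> h; elim: n => [|n IH].
  rewrite big_ord0 (_ : (fun w => _) = fun=> 0); last by apply/funext => w; rewrite big_ord0.
  exact: cdiff_cst.
rewrite big_ord_recr/= (_ : (fun w => _) = fun w => \sum_(k < n) F k w + F n w); first exact: cdiffD.
by apply/funext => w; rewrite big_ord_recr.
Qed.

Lemma is_derive_Re F (u d : R[i]) (t : R) : cdiff F t%:C%C d ->
  is_derive t 1 (fun t => complex.Re (u * F t%:C%C)) (complex.Re (u * d)).
Proof.
move=> hF.
have h : (h : R)^-1 *: (complex.Re (u * F (h *: (1 : R) + t)%:C%C) - complex.Re (u * F t%:C%C))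
    @[h --> (0 : R)^'] --> complex.Re (u * d).
  apply/cvgrPdist_le => e e0.
  have u1 : 0 < cabs u + 1 by rewrite ltr_wpDl ?cabs_ge0.
  have e1 : 0 < e / (cabs u + 1) by rewrite divr_gt0.
  have [dl dl0 H] := hF _ e1.
  exists dl => // k; rewrite /ball_/= sub0r normrN => kd kN.
  have kp : 0 < `|k| by rewrite normr_gt0.
  have := H k%:C%C; rewrite cabs_real => /(_ kd) hk.
  rewrite /GRing.scale/= mulr1.
  have -> : complex.Re (u * d) - k^-1 * (complex.Re (u * F (k + t)%:C%C) - complex.Re (u * F t%:C%C))
     = - (k^-1 * complex.Re (u * (F (t%:C%C + k%:C%C) - F t%:C%C - k%:C%C * d))).
    rewrite -rmorphD (addrC t); move: (F _) (F _) => A B.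
    by clear -kN; case: A B u d => a1 a2 [b1 b2] [u1 u2] [d1 d2] /=; field.
  rewrite normrN normrM normfV mulrC ler_pdivrMr//.
  apply: le_trans (Re_le_cabs _) _; rewrite cabsM.
  apply: (@le_trans _ _ ((cabs u + 1) * (e / (cabs u + 1) * `|k|))).
    by apply: ler_pM; rewrite ?cabs_ge0// lerDl.
  by rewrite mulrA mulrCA divff ?gt_eqF// mulr1.
split; first by apply/cvg_ex; exists (complex.Re (u * d)); exact: h.
by apply/cvg_lim => //; exact: h.
Qed.

(** Pairing F with the conjugate u of F 1 - F 0 reduces to a real function: |u| b - Re (u F) has
    nonnegative derivative, and u (F 1 - F 0) = |u|^2. *)
Lemma mean_value_inequality F (F' : R -> R[i]) (b b' : R -> R) :
  (forall t : R, 0 <= t <= 1 -> cdiff F t%:C%C (F' t)) ->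
  (forall t : R, 0 <= t <= 1 -> is_derive t (1 : R) b (b' t)) ->
  (forall t : R, 0 <= t <= 1 -> cabs (F' t) <= b' t) ->
  b 0 <= b 1 -> cabs (F 1 - F 0) <= b 1 - b 0.
Proof.
move=> hF hb Fb b01; pose u := conjc (F 1 - F 0).
pose psi (t : R) := cabs u * b t - complex.Re (u * F t%:C%C).
have dpsi (t : R) : 0 <= t <= 1 -> is_derive t 1 psi (cabs u * b' t - complex.Re (u * F' t)).
  move=> t01; have h1 := hb t t01; have h2 := is_derive_Re u (hF t t01).
  by apply: is_deriveB.
have cpsi : {within `[0, 1], continuous psi}.
  apply: continuous_in_subspaceT => t; rewrite inE/= in_itv/= => t01.
  apply: differentiable_continuous; apply/derivable1_diffP.
  exact: (@ex_derive _ _ _ _ _ _ _ (dpsi t t01)).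
have dpsi' (t : R) : t \in `]0, 1[ -> is_derive t 1 psi (cabs u * b' t - complex.Re (u * F' t)).
  by rewrite in_itv/= => /andP[t0 t1]; apply: dpsi; rewrite !ltW.
have [c /[!in_itv]/= c01 e] := MVT_segment ler01 dpsi' cpsi.
have uu : cabs u = cabs (F 1 - F 0).
  by rewrite /u; case: (F 1 - F 0) => x y /=; rewrite sqrrN.
have pos : 0 <= psi 1 - psi 0.
  rewrite e subr0 mulr1 subr_ge0; apply: le_trans (ler_norm _) _.
  apply: le_trans (Re_le_cabs _) _; rewrite cabsM; apply: ler_wpM2l; [exact: cabs_ge0|exact: Fb].
move: pos; rewrite /psi.
have -> : cabs u * b 1 - complex.Re (u * F 1%:C%C) - (cabs u * b 0 - complex.Re (u * F 0%:C%C))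
   = cabs u * (b 1 - b 0) - cabs u ^+ 2.
  rewrite uu cabs_sq /u; case: (F 1) (F 0) => x y [x' y'] /=; ring.
rewrite subr_ge0 expr2; rewrite -uu; have [->|u0] := eqVneq (cabs u) 0; last first.
  by rewrite ler_pM2l// lt_neqAle eq_sym u0 cabs_ge0.
by move=> _; rewrite subr_ge0.
Qed.

End cdiff_calculus.

(** * The path deformation for polynomials *)

Section hilbert_polynomial.
Context {R : realType}.
Variables (p : nat -> R[i]) (K : nat) (M : R).
Let P w : R[i] := \sum_(k < K) p k * w ^+ k.
Hypothesis PM : forall w, cabs w <= 1 -> cabs (P w) <= M.

Let M0 : 0 <= M.
Proof. by apply: le_trans (cabs_ge0 _) (PM (w := 0) _); rewrite cabs0. Qed.

Lemma cdiff_monomial (c : R[i]) n z : cdiff (fun w => c / n.+1%:R * w ^+ n.+1) z (c * z ^+ n).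
Proof.
have n0 : n.+1%:R != 0 :> R[i] by rewrite pnatr_eq0.
by apply: cdiff_eqd (cdiffZ _ (cdiffX n (cdiff_id z))) _; field.
Qed.

(** The sum is the integral of t^n P(t) over [0, 1], which is at most M times the integral of t^n;
    [F] and [b] are the two antiderivatives. *)
Lemma hilbert_coef_poly_le n : cabs (\sum_(k < K) p k / (k + n + 1)%:R) <= M / n.+1%:R.
Proof.
pose F w := \sum_(k < K) p k / (k + n).+1%:R * w ^+ (k + n).+1.
have hF z : cdiff F z (\sum_(k < K) p k * z ^+ (k + n)).
  exact: (cdiff_sum K (fun k => cdiff_monomial (p k) (k + n) z)).
pose b (t : R) := complex.Re (1 * (M%:C%C / n.+1%:R * t%:C%C ^+ n.+1)).
have hb (t : R) : is_derive t 1 b _ := is_derive_Re 1 (cdiff_monomial M%:C%C n t%:C%C).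
have F1 : \sum_(k < K) p k / (k + n + 1)%:R = F 1 - F 0.
  rewrite -sumrB; apply: eq_bigr => k _.
  by rewrite expr1n expr0n/= mulr1 mulr0 subr0 addn1.
have b1 : b 1 = M / n.+1%:R.
  by rewrite /b rmorph1 expr1n mul1r mulr1 -(rmorph_nat (real_complex R)) -fmorphV -rmorphM.
have b0 : b 0 = 0.
  by rewrite /b rmorph0 expr0n/= !mulr0.
have -> : M / n.+1%:R = b 1 - b 0 by rewrite b1 b0 subr0.
rewrite F1; apply: (mean_value_inequality (fun t _ => hF t%:C%C) (fun t _ => hb t)); last first.
  by rewrite b1 b0 divr_ge0.
move=> t /andP[t0 t1]; rewrite mul1r -rmorphXn -rmorphM/=.
rewrite (eq_bigr (fun k : 'I_K => t%:C%C ^+ n * (p k * t%:C%C ^+ k))); last first.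
  by move=> k _; rewrite exprD; ring.
rewrite -mulr_sumr cabsM -rmorphXn cabs_real ger0_norm ?exprn_ge0// mulrC.
by apply: ler_wpM2r; [exact: exprn_ge0|apply: PM; rewrite cabs_real ger0_norm].
Qed.

Lemma geometric_deriv_sum (x : R[i]) N : (1 - x) ^+ 2 * \sum_(n < N) n.+1%:R * x ^+ n =
  1 - N.+1%:R * x ^+ N + N%:R * x ^+ N.+1.
Proof.
elim: N => [|N IH]; first by rewrite big_ord0 expr0 mul0r; ring.
by rewrite big_ord_recr/= mulrDr IH -!natr1 !exprS; ring.
Qed.

Variable z : R[i].
Hypothesis z1 : cabs z < 1.

(* The curve phi joins 0 to 1 inside the disc and satisfies
   (1 - z) phi' = (1 - z phi)^2, which cancels the singular kernel. *)
Let den (s : R[i]) : R[i] := 1 - (1 - s) * z.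
Let phi s : R[i] := s / den s.

(** The inequality |den t| >= t keeps [phi] in the closed unit disc, where the bound on P
    applies. *)
Let den_ge (t : R) : 0 <= t <= 1 -> t <= cabs (den t%:C%C) /\ den t%:C%C != 0.
Proof.
move=> /andP[t0 t1].
have h : 1 - (1 - t) * cabs z <= cabs (den t%:C%C).
  have e : cabs (1 - t%:C%C : R[i]) = 1 - t.
    by rewrite -(rmorph1 (real_complex R)) -rmorphB cabs_real ger0_norm ?subr_ge0.
  by have := cabs_dist 1 ((1 - t%:C%C) * z); rewrite cabs1 cabsM e.
have z0 := cabs_ge0 z; have t10 : 0 <= 1 - t by rewrite subr_ge0.
split.
  by apply: le_trans h; rewrite lerBrDl -lerBrDr ler_piMr// ltW.
rewrite -cabs_gt0; apply: lt_le_trans h; rewrite subr_gt0; apply: le_lt_trans z1.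
by rewrite ler_piMl// lerBlDr lerDl.
Qed.

(** [F] is a polynomial antiderivative composed with [phi], so its increment depends only on [phi] 0
    = 0 and [phi] 1 = 1, while its derivative is estimated along the curve. Truncation at N leaves
    the two last terms of [geometric_deriv_sum], at most (2 N + 1) |z|^N. *)
Lemma hilbert_deriv_poly_le N :
  cabs ((1 - z) * \sum_(n < N) n.+1%:R * z ^+ n * \sum_(k < K) p k / (k + n.+1 + 1)%:R)
  <= M * (1 + (2 * N%:R + 1) * cabs z ^+ N).
Proof.
pose F s := (1 - z) * \sum_(n < N) n.+1%:R * z ^+ n *
  \sum_(k < K) p k / (k + n.+1).+1%:R * phi s ^+ (k + n.+1).+1.
set B := M * _.
have B0 : 0 <= B by rewrite mulr_ge0// addr_ge0// mulr_ge0 ?exprn_ge0 ?cabs_ge0// addr_ge0 ?mulr_ge0.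
pose q s := (1 - z) / den s ^+ 2.
have hphi s : den s != 0 -> cdiff phi s (q s).
  move=> d0; have hd : cdiff den s z.
    have h := cdiffZ (- z) (cdiffD (cdiff_cst 1 s) (cdiffZ (-1) (cdiff_id s))).
    have := cdiffD (cdiff_cst 1 s) h.
    rewrite (_ : (fun w => _) = den); last by apply/funext => w; rewrite /den; ring.
    by move=> /cdiff_eqd; apply; ring.
  apply: cdiff_eqd (cdiffM (cdiff_id s) (cdiffV d0 hd)) _.
  by move: d0; rewrite /q /den => d0; field.
have hF s : den s != 0 -> cdiff F s ((1 - z) * \sum_(n < N) n.+1%:R * z ^+ n *
    \sum_(k < K) (p k * phi s ^+ (k + n.+1) * q s)).
  move=> d0; apply: cdiffZ.
  pose G n w := n.+1%:R * z ^+ n * \sum_(k < K) p k / (k + n.+1).+1%:R * phi w ^+ (k + n.+1).+1.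
  pose dG n := n.+1%:R * z ^+ n * \sum_(k < K) (p k * phi s ^+ (k + n.+1) * q s).
  apply: (@cdiff_sum _ N G dG s) => n; apply: cdiffZ.
  pose H k w := p k / (k + n.+1).+1%:R * phi w ^+ (k + n.+1).+1.
  apply: (@cdiff_sum _ K H (fun k => p k * phi s ^+ (k + n.+1) * q s) s) => k.
  have n0 : (k + n.+1).+1%:R != 0 :> R[i] by rewrite pnatr_eq0.
  by apply: cdiff_eqd (cdiffZ _ (cdiffX _ (hphi s d0))) _; field.
(* The outer factor 1 - z and q = phi' combine to (1 - z phi)^2, which is the factor in
   [geometric_deriv_sum]. *)
have e s : den s != 0 -> (1 - z) * (\sum_(n < N) n.+1%:R * z ^+ n *
    \sum_(k < K) (p k * phi s ^+ (k + n.+1) * q s)) =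
    phi s * P (phi s) * (1 - N.+1%:R * (z * phi s) ^+ N + N%:R * (z * phi s) ^+ N.+1).
  move=> d0; rewrite -geometric_deriv_sum.
  have d1 : 1 - z * phi s = (1 - z) / den s.
    by move: d0; rewrite /phi /den => d0; field.
  rewrite (eq_bigr (fun n : 'I_N => (phi s * P (phi s) * q s) * (n.+1%:R * (z * phi s) ^+ n))).
    by rewrite -mulr_sumr d1 /q; field.
  move=> n _.
  have -> : \sum_(k < K) (p k * phi s ^+ (k + n.+1) * q s) = P (phi s) * (phi s ^+ n.+1 * q s).
    by rewrite mulr_suml; apply: eq_bigr => k _; rewrite exprD; ring.
  by move: (phi s) (q s) => x y; rewrite exprMn (exprS x); ring.
pose b (t : R) := complex.Re (B%:C%C * t%:C%C).
have hb (t : R) : is_derive t 1 b _ := is_derive_Re B%:C%C (cdiff_id t%:C%C).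
have p1 : phi 1 = 1 by rewrite /phi /den subrr mul0r subr0 divr1.
have p0 : phi 0 = 0 by rewrite /phi mul0r.
have -> : (1 - z) * \sum_(n < N) n.+1%:R * z ^+ n * \sum_(k < K) p k / (k + n.+1 + 1)%:R = F 1 - F 0.
  rewrite -mulrBr -sumrB; congr (_ * _); apply: eq_bigr => n _.
  rewrite -mulrBr -sumrB; congr (_ * _); apply: eq_bigr => k _.
  by rewrite p1 p0 expr1n expr0n/= mulr1 mulr0 subr0 addn1.
have bE t : b t = B * t by rewrite /b -rmorphM.
have -> : B = b 1 - b 0 by rewrite !bE mulr1 mulr0 subr0.
apply: (mean_value_inequality (fun t t01 => hF _ (den_ge t01).2) (fun t _ => hb t)); last first.
  by rewrite !bE mulr1 mulr0.
move=> t t01; have [dt d0] := den_ge t01; rewrite e//.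
have -> : complex.Re (B%:C%C * 1) = B by rewrite mulr1.
have /andP[t0 t1] := t01.
have ph1 : cabs (phi t%:C%C) <= 1.
  by rewrite /phi cabsM cabsV cabs_real ger0_norm// ler_pdivrMr ?mul1r// cabs_gt0.
have ph0 := cabs_ge0 (phi t%:C%C); have z0 := cabs_ge0 z.
rewrite cabsM cabsM /B; apply: ler_pM; rewrite ?mulr_ge0 ?cabs_ge0//.
  by rewrite -[leRHS]mul1r; apply: ler_pM; rewrite ?cabs_ge0// PM.
have x1 m : cabs ((z * phi t%:C%C) ^+ m) <= cabs z ^+ m.
  rewrite cabsX cabsM lerXn2r ?nnegrE ?mulr_ge0//.
  by rewrite ler_piMr.
apply: (le_trans (cabsD _ _)).
have h1 : cabs (N%:R * (z * phi t%:C%C) ^+ N.+1) <= N%:R * cabs z ^+ N.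
  rewrite cabsM cabs_nat; apply: ler_wpM2l => //; apply: (le_trans (x1 _)).
  by rewrite exprS ler_piMl ?exprn_ge0// ltW.
have h2 : cabs (1 - N.+1%:R * (z * phi t%:C%C) ^+ N) <= 1 + N.+1%:R * cabs z ^+ N.
  apply: (le_trans (cabsB _ _)); rewrite cabs1 lerD2l cabsM cabs_nat.
  by apply: ler_wpM2l.
apply: le_trans (lerD h2 h1) _; rewrite -natr1 le_eqVlt; apply/orP; left; apply/eqP; ring.
Qed.

End hilbert_polynomial.

(** * Bounds for H f by polynomial approximation *)

Section hilbert_bounded.
Context {R : realType}.

Lemma sum_inv_sq (m : nat) : \sum_(k < m) k.+1%:R ^- 2 <= 2 :> R.
Proof.
have h : \sum_(k < m.+1) k.+1%:R ^- 2 <= 2 - m.+1%:R^-1 :> R.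
  elim: m => [|m IH]; first by rewrite big_ord_recr big_ord0/= add0r expr1n invr1; lra.
  rewrite big_ord_recr/=; apply: le_trans (lerD IH (lexx _)) _.
  have m0 : 0 < m.+1%:R :> R by rewrite ltr0n.
  rewrite -[m.+2%:R]natr1; move: (m.+1%:R : R) m0 => x x0.
  have -> : 2 - (x + 1)^-1 = 2 - x^-1 + (x * (x + 1))^-1 by field; lra.
  rewrite lerD2l lef_pV2 ?posrE ?exprn_gt0 ?mulr_gt0 ?addr_gt0//.
  by rewrite expr2 ler_wpM2r ?addr_ge0 ?ltW// ltrDl.
apply: (@le_trans _ _ (2 - m.+1%:R^-1)); last by rewrite gerBl.
by apply: le_trans h; rewrite big_ord_recr/= lerDl invr_ge0 exprn_ge0.
Qed.

Lemma nonneg_sum_tail (v : nat -> R) (B e : R) : (forall k, 0 <= v k) ->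
  (forall n, \sum_(k < n) v k <= B) -> 0 < e ->
  exists N, forall n, \sum_(k < n) v (N + k)%N <= e.
Proof.
move=> v0 vB e0.
have [n|s hs] := @real_sum_cvg _ v B.
  by apply: le_trans (vB n); apply: ler_sum => k _; rewrite ger0_norm.
have le_s n : \sum_(k < n) v k <= s.
  rewrite -(cvg_lim _ hs)//; apply: limr_ge; first by apply/cvg_ex; exists s.
  exists n => // m /= nm; rewrite -(subnKC nm) big_split_ord/= lerDl.
  by apply: sumr_ge0.
move/cvgrPdist_le : hs => /(_ e e0)[N _ /(_ N (leqnn _))] hN.
exists N => n; have := le_s (N + n)%N; rewrite big_split_ord/=.
have := le_trans (ler_norm _) hN; lra.
Qed.

Lemma nonneg_sum_tail_leq (v : nat -> R) (e : R) N m n : (forall k, 0 <= v k) ->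
  (forall n, \sum_(k < n) v (N + k)%N <= e) -> \sum_(k < n) v (N + m + k)%N <= e.
Proof.
move=> v0 h; apply: le_trans (h (m + n)%N); rewrite big_split_ord/=.
under [X in _ <= _ + X]eq_bigr do rewrite addnA.
by rewrite lerDr sumr_ge0.
Qed.

(** With x = s^2, one factor s^n keeps (n + 1) s^n bounded and the other tends to 0. *)
Lemma mul_pow_cvg0 (x e : R) : 0 <= x < 1 -> 0 < e ->
  exists N, forall n, (N <= n)%N -> (2 * n%:R + 1) * x ^+ n <= e.
Proof.
move=> /andP[x0 x1] e0; pose s := Num.sqrt x.
have s0 : 0 <= s := sqrtr_ge0 _.
have s1 : s < 1 by rewrite -sqrtr1 ltr_sqrt.
have xs : x = s ^+ 2 by rewrite sqr_sqrtr.
have s01 : 0 <= s < 1 by rewrite s0.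
have b n : n.+1%:R * s ^+ n <= (1 - s)^-2.
  have := geo_sum1 s01 n.+1; rewrite big_ord_recr/=; apply: le_trans.
  by rewrite lerDr sumr_ge0// => k _; rewrite mulr_ge0 ?exprn_ge0.
have : 2 * (1 - s)^-2 * s ^+ n @[n --> \oo] --> 2 * (1 - s)^-2 * 0.
  by apply: cvgM; [exact: cvg_cst|apply: cvg_expr; rewrite ger0_norm].
rewrite mulr0 => /cvgrPdist_le/(_ e e0)[N _ HN].
exists N => n /HN; rewrite sub0r normrN => /(le_trans (ler_norm _)); apply: le_trans.
rewrite xs -exprM mulnC exprM expr2 mulrA; apply: ler_wpM2r; first exact: exprn_ge0.
apply: (@le_trans _ _ (2 * (n.+1%:R * s ^+ n))); last by rewrite ler_wpM2l.
rewrite mulrA; apply: ler_wpM2r; first exact: exprn_ge0.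
by rewrite -natr1; lra.
Qed.

Lemma le_of_all_eps (x a c : R) : (forall e, 0 < e -> x <= a + e * c) -> x <= a.
Proof.
move=> h; apply/ler_addgt0Pr => e e0.
have c1 : 0 < `|c| + 1 by rewrite ltr_wpDl.
apply: le_trans (h (e / (`|c| + 1)) _) _; first by rewrite divr_gt0.
rewrite lerD2l mulrAC ler_pdivrMr//; apply: ler_wpM2l; first exact: ltW.
by apply: le_trans (ler_norm c) _; rewrite lerDl.
Qed.

Lemma coef_approx_le (x y v a b e : R) : y <= a -> v <= 3 * e -> x - y <= v -> a <= b + e ->
  x <= b + e * 4.
Proof. by lra. Qed.

Lemma deriv_approx_le (x y v u N e T S : R) : y <= (N + e) * T -> v <= u * (S * (3 * e)) ->
  x - y <= v -> x <= N * T + e * (T + 3 * (u * S)).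
Proof. by lra. Qed.

Lemma csums_limn (u : nat -> Cplx R) (s : Cplx R) : csums u s -> limn (series u) = s.
Proof.
move=> hs; apply: ctends_limn; apply: ctends_eq hs => n.
by rewrite /series/= big_mkord.
Qed.

Variables (f : Cplx R -> Cplx R) (M : R).
Hypothesis df : analytic_on_disc f.
Hypothesis fM : forall w, cabs w < 1 -> cabs (f w) <= M.
Let a := taylor_coef f.
Let h := hilbert_coef f.

Let M0 : 0 <= M.
Proof. by apply: le_trans (cabs_ge0 _) (fM (w := 0) _); rewrite cabs0. Qed.

(** Dominates the series of every Hilbert coefficient uniformly in n. It is summable because both |a
    k| and 1 / (k+1) are square summable. *)
Let wgt k : R := cabs (a k) / k.+1%:R.

Let wgt0 k : 0 <= wgt k.
Proof. by rewrite divr_ge0 ?cabs_ge0. Qed.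

Let wgt_sum n : \sum_(k < n) wgt k <= M ^+ 2 + 2.
Proof.
apply: le_trans (lerD (coef_sq_sum df fM n) (sum_inv_sq n)); rewrite -big_split/=.
apply: ler_sum => k _; rewrite /wgt -exprVn.
have := cabs_ge0 (a k); have : 0 <= k.+1%:R^-1 :> R by [].
by move: (cabs _) (k.+1%:R^-1) => x y x0 y0; nra.
Qed.

Let term_le n k (x : R) : 0 <= x -> x / (k + n + 1)%:R <= x / k.+1%:R.
Proof.
move=> x0; apply: ler_wpM2l => //; rewrite lef_pV2 ?posrE ?ltr0n ?addn1//.
by rewrite ler_nat ltnS leq_addr.
Qed.

Let termE n k : cabs (a k / (k + n + 1)%:R) <= wgt k.
Proof. by rewrite cabsM cabsV cabs_nat; apply: term_le; exact: cabs_ge0. Qed.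

Let hilbert_coef_csums n : csums (fun k => a k / (k + n + 1)%:R) (h n).
Proof.
have [|s hs] := @csums_exists _ (fun k => a k / (k + n + 1)%:R) (M ^+ 2 + 2).
  by move=> m; apply: le_trans (wgt_sum m); apply: ler_sum => k _; exact: termE.
by rewrite /h /hilbert_coef (csums_limn hs).
Qed.

(** p is a Taylor polynomial of the dilation f(r w), which converges uniformly on the closed disc.
    The error 3 e has three sources: the terms beyond K, the dilation on the first N0 terms, and the
    terms between N0 and K. *)
Let polynomial_approx (e : R) : 0 < e -> exists (p : nat -> R[i]) K,
  (forall w, cabs w <= 1 -> cabs (\sum_(k < K) p k * w ^+ k) <= M + e) /\
  forall n, cabs (h n - \sum_(k < K) p k / (k + n + 1)%:R) <= 3 * e.
Proof.
move=> e0; have [N0 tail] := nonneg_sum_tail wgt0 wgt_sum e0.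
have B0 : 0 < M ^+ 2 + 2 by rewrite ltr_wpDl ?sqr_ge0.
(* N0 is fixed by the tail of [wgt]; then r is taken so near 1 that the first N0 terms barely
   change, and only afterwards K is chosen, depending on r. *)
have [r r01 hr] : exists2 r : R, 0 < r < 1 & (M ^+ 2 + 2) * (1 - r ^+ N0) <= e.
  have c : r ^+ N0 @[r --> (1 : R)^'-] --> (1 : R) ^+ N0.
    by apply: cvg_at_left_filter; exact: exprn_continuous.
  have eB : 0 < e / (M ^+ 2 + 2) by rewrite divr_gt0.
  move/cvgrPdist_le : c => /(_ _ eB) c.
  near (1 : R)^'- => r; exists r.
    by apply/andP; split; near: r; [exact: nbhs_left_gt|exact: nbhs_left_lt].
  have : `|1 ^+ N0 - r ^+ N0| <= e / (M ^+ 2 + 2) by near: r; exact: c.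
  rewrite expr1n => /(le_trans (ler_norm _)); rewrite ler_pdivlMr// mulrC; exact.
have /andP[r0 r1] := r01.
have [ga ha] := taylor_expansion df fM.
have rr : 0 <= r < 1 by rewrite ltW.
have [D [q [D0 q01 HD]]] := cgrow_bound ga rr.
have /andP[q0 q1] := q01.
have : D * (1 - q)^-1 * q ^+ n @[n --> \oo] --> D * (1 - q)^-1 * 0.
  by apply: cvgM; [exact: cvg_cst|apply: cvg_expr; rewrite ger0_norm].
rewrite mulr0 => /cvgrPdist_le/(_ e e0)[N1 _ HN].
pose K := (N0 + N1)%N.
have {}HN : D * (1 - q)^-1 * q ^+ K <= e.
  by have := HN K (leq_addl _ _); rewrite sub0r normrN => /(le_trans (ler_norm _)).
exists (fun k => a k * r%:C%C ^+ k), K; split=> [w w1|n].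
  have rw : cabs (r%:C%C * w) <= r.
    by rewrite cabsM cabs_real gtr0_norm// ler_piMr// ltW.
  have rw1 : cabs (r%:C%C * w) < 1 := le_lt_trans rw r1.
  have -> : \sum_(k < K) a k * r%:C%C ^+ k * w ^+ k = \sum_(k < K) a k * (r%:C%C * w) ^+ k.
    by apply: eq_bigr => k _; rewrite exprMn mulrA.
  have := csums_tail (N := K) (t := e) (ha _ rw1).
  set S := \sum_(k < K) _ => H.
  rewrite (_ : S = f (r%:C%C * w) - (f (r%:C%C * w) - S)); last by ring.
  apply: le_trans (cabsB _ _) _; apply: lerD; first exact: fM.
  apply: H => m; apply: le_trans HN.
  apply: (@le_trans _ _ (\sum_(k < m) D * q ^+ K * q ^+ k)).
    apply: ler_sum => k _; rewrite cabsM cabsX -mulrA -exprD; apply: le_trans (HD _).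
    by apply: ler_wpM2l; [exact: cabs_ge0|rewrite lerXn2r ?nnegrE ?cabs_ge0// ltW].
  rewrite -mulr_sumr [leRHS]mulrAC; apply: ler_wpM2l; first by rewrite mulr_ge0// exprn_ge0.
  exact: geo_sum0.
have t1 : cabs (h n - \sum_(k < K) a k / (k + n + 1)%:R) <= e.
  apply: csums_tail (hilbert_coef_csums n) _ => m.
  apply: le_trans (nonneg_sum_tail_leq N1 m wgt0 tail).
  by apply: ler_sum => k _; exact: termE.
have t2 : cabs (\sum_(k < K) a k / (k + n + 1)%:R -
    \sum_(k < K) a k * r%:C%C ^+ k / (k + n + 1)%:R) <= e + e.
  rewrite -sumrB; apply: le_trans (cabs_sum _ _ _) _.
  apply: (@le_trans _ _ (\sum_(k < K) wgt k * (1 - r ^+ k))).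
    apply: ler_sum => k _.
    have -> : a k / (k + n + 1)%:R - a k * r%:C%C ^+ k / (k + n + 1)%:R =
      a k / (k + n + 1)%:R * (1 - r ^+ k)%:C%C by rewrite rmorphB rmorph1 rmorphXn; ring.
    have rk : 0 <= 1 - r ^+ k by rewrite subr_ge0 exprn_ile1// ltW.
    by rewrite cabsM cabs_real ger0_norm//; apply: ler_wpM2r.
  rewrite big_split_ord/=; apply: lerD; last first.
    apply: le_trans (tail N1); apply: ler_sum => k _; rewrite ler_piMr//.
    by rewrite gerBl exprn_ge0// ltW.
  apply: le_trans hr.
  apply: (@le_trans _ _ (\sum_(k < N0) wgt k * (1 - r ^+ N0))).
    apply: ler_sum => k _; apply: ler_wpM2l => //; rewrite lerB//.
    by apply: ler_wiXn2l; [exact: ltW|exact: ltW|exact: ltnW].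
  rewrite -mulr_suml; apply: ler_wpM2r => //.
  by rewrite subr_ge0 exprn_ile1// ltW.
have := le_trans (cabsD _ _) (lerD t1 t2); rewrite addrA subrK => /le_trans; apply.
by rewrite le_eqVlt; apply/orP; left; apply/eqP; ring.
Unshelve. all: by end_near. Qed.

Lemma hilbert_coef_le n : cabs (h n) <= M / n.+1%:R.
Proof.
apply: (@le_of_all_eps _ _ 4) => e e0.
have [p [K [pM ph]]] := polynomial_approx e0.
have h1 := hilbert_coef_poly_le pM n; have h2 := ph n.
have h3 := cabs_dist (h n) (\sum_(k < K) p k / (k + n + 1)%:R).
have h4 : (M + e) / n.+1%:R <= M / n.+1%:R + e.
  by rewrite mulrDl lerD2l ler_pdivrMr ?ltr0n// ler_peMr ?ler1n// ltW.
exact: coef_approx_le h1 h2 h3 h4.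
Qed.

Lemma cgrow_hilbert : cgrow h 1.
Proof.
move=> r /andP[r0 r1]; exists M => k; apply: (@le_trans _ _ (cabs (h k))).
  by rewrite ler_piMr ?cabs_ge0// exprn_ile1// ltW.
apply: le_trans (hilbert_coef_le k) _; rewrite ler_piMr//.
by rewrite invf_le1 ?ltr0n// ler1n.
Qed.

Lemma hilbert_psum z : cabs z < 1 -> psum h z (hilbert f z).
Proof.
move=> z1; have [s hs] := psum_exists cgrow_hilbert z1.
by rewrite /hilbert (csums_limn hs).
Qed.

Lemma hilbert_cdiff z : cabs z < 1 ->
  psum (dcoef h) z (derive1 (hilbert f) z) /\ cdiff (hilbert f) z (derive1 (hilbert f) z).
Proof.
move=> z1; have [d hd] := psum_exists (cgrow_dcoef cgrow_hilbert) z1.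
have hc := psum_cdiff cgrow_hilbert hilbert_psum z1 hd.
by rewrite (cdiff_derive1 hc).
Qed.

Lemma hilbert_analytic : analytic_on_disc (hilbert f).
Proof. by move=> z z1; exact: cdiff_derivable (hilbert_cdiff z1).2. Qed.

Lemma hilbert0_le : cabs (hilbert f 0) <= M.
Proof.
have h0 := hilbert_psum (z := 0); rewrite cabs0 in h0.
by rewrite (psum0 (h0 ltr01)) (le_trans (hilbert_coef_le 0))// divr1.
Qed.

(** Two limits in a fixed order: for each N the approximation error tends to 0 with e, although its
    constant grows with N; then N tends to infinity. *)
Lemma hilbert_deriv_le z : cabs z < 1 -> cabs ((1 - z) * derive1 (hilbert f) z) <= M.
Proof.
move=> z1; have z0 := cabs_ge0 z.
have key N : cabs ((1 - z) * \sum_(n < N) dcoef h n * z ^+ n)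
    <= M * (1 + (2 * N%:R + 1) * cabs z ^+ N).
  set T : R := 1 + _.
  pose c : R := T + 3 * (cabs (1 - z) * \sum_(n < N) n.+1%:R).
  apply: (@le_of_all_eps _ _ c) => e e0.
  have [p [K [pM ph]]] := polynomial_approx e0.
  have h1 := hilbert_deriv_poly_le pM z1 N.
  set Q := _ * \sum_(n < N) n.+1%:R * _ * _ in h1.
  have h2 : cabs ((1 - z) * \sum_(n < N) dcoef h n * z ^+ n - Q) <=
      cabs (1 - z) * \sum_(n < N) n.+1%:R * (3 * e).
    rewrite -mulrBr cabsM; apply: ler_wpM2l; first exact: cabs_ge0.
    rewrite -sumrB; apply: le_trans (cabs_sum _ _ _) _; apply: ler_sum => n _.
    rewrite (_ : _ - _ = n.+1%:R * z ^+ n * (h n.+1 - \sum_(k < K) p k / (k + n.+1 + 1)%:R)).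
      rewrite cabsM; apply: ler_pM; rewrite ?cabs_ge0//.
      by rewrite cabsM cabs_nat cabsX ler_piMr// exprn_ile1// ltW.
    by rewrite /dcoef; ring.
  have h3 := cabs_dist ((1 - z) * \sum_(n < N) dcoef h n * z ^+ n) Q.
  move: h2; rewrite -mulr_suml => h2.
  exact: deriv_approx_le h1 h2 h3.
have [hd _] := hilbert_cdiff z1.
apply: (@le_of_all_eps _ _ M) => e e0.
have z01 : 0 <= cabs z < 1 by rewrite z0.
have [N HN] := mul_pow_cvg0 z01 e0.
apply: (ctends_cabs_le (N := N) (ctendsZ (1 - z) hd)) => n Nn.
apply: le_trans (key n) _; rewrite mulrDr mulr1 lerD2l mulrC.
by apply: ler_wpM2r => //; exact: HN.
Qed.

Lemma hilbert_coef_sq_sum n : \sum_(k < n) cabs (h k) ^+ 2 <= 2 * M ^+ 2.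
Proof.
rewrite mulrC; apply: le_trans (ler_wpM2l (sqr_ge0 M) (sum_inv_sq n)).
rewrite mulr_sumr; apply: ler_sum => k _; rewrite -exprVn -exprMn.
by rewrite lerXn2r ?nnegrE ?cabs_ge0 ?divr_ge0// hilbert_coef_le.
Qed.

End hilbert_bounded.

(** * The extremal function f = 1 *)

Section hilbert_one.
Context {R : realType}.
Let one : Cplx R -> Cplx R := fun=> 1.
Let g := hilbert one.

Lemma analytic_cst (k : Cplx R) : analytic_on_disc (fun=> k).
Proof. by move=> z _; exact: (derivable_cst k z 1). Qed.

Let one_le w : cabs w < 1 -> cabs (one w) <= 1.
Proof. by rewrite cabs1. Qed.

Let one_an : analytic_on_disc one. Proof. exact: analytic_cst. Qed.

Lemma csums_head (u : nat -> R[i]) : (forall k, u k.+1 = 0) -> csums u (u 0%N).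
Proof.
move=> u0 e e0; exists 1%N => -[//|n] _.
by rewrite big_ord_recl big1 ?addr0 ?subrr ?cabs0 ?ltW// => k _; rewrite u0.
Qed.

Let taylor_one k : taylor_coef one k = (k == 0%N)%:R.
Proof.
apply: (@taylor_coefE _ (fun k => (k == 0%N)%:R) 1) => //.
  move=> r /andP[r0 r1]; exists 1 => n; rewrite cabs_nat.
  by case: n => [|n]; rewrite ?mul1r ?expr0// mul0r.
move=> w _; rewrite /psum; have h : forall k, (k.+1 == 0%N)%:R * w ^+ k.+1 = 0.
  by move=> j; rewrite mul0r.
by have := @csums_head (fun k => (k == 0%N)%:R * w ^+ k) h; rewrite eqxx expr0 mul1r.
Qed.

Let hilbert_coef_one n : hilbert_coef one n = n.+1%:R^-1.
Proof.
have h : csums (fun k => taylor_coef one k / (k + n + 1)%:R) n.+1%:R^-1.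
  have := @csums_head (fun k => taylor_coef one k / (k + n + 1)%:R).
  rewrite taylor_one eqxx mul1r add0n addn1; apply => k.
  by rewrite taylor_one mul0r.
by rewrite /hilbert_coef (csums_limn h).
Qed.

Lemma hilbert_one0 : g 0 = 1.
Proof.
have h := @hilbert_psum _ _ 1 one_an one_le 0; rewrite cabs0 in h.
by rewrite /g (psum0 (h ltr01)) hilbert_coef_one invr1.
Qed.

(** Summation by parts: the coefficients b are decreasing, so the differences telescope to b 0 - b
    m, and the two end terms contribute b 0 and b m. *)
Lemma abel_bound (b : nat -> R) (z : R[i]) m : (forall k, 0 <= b k.+1 <= b k) -> cabs z <= 1 ->
  cabs ((1 - z) * \sum_(k < m) (b k)%:C%C * z ^+ k) <= 2 * b 0%N.
Proof.
move=> hb z1; have b0 : 0 <= b 0%N by have /andP[/le_trans] := hb 0%N; apply.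
case: m => [|m]; first by rewrite big_ord0 mulr0 cabs0 mulr_ge0.
have zn n : cabs (z ^+ n) <= 1 by rewrite cabsX exprn_ile1 ?cabs_ge0.
have e : (1 - z) * (\sum_(k < m.+1) (b k)%:C%C * z ^+ k) =
   (b 0%N)%:C%C - \sum_(k < m) (b k - b k.+1)%:C%C * z ^+ k.+1 - (b m)%:C%C * z ^+ m.+1.
  elim: m => [|m IH].
    by rewrite big_ord_recr !big_ord0/= expr0 expr1; ring.
  rewrite big_ord_recr mulrDr IH big_ord_recr/= rmorphB (exprS z m.+1) (exprS z m); ring.
have bp k : 0 <= b k by case: k => // k; case/andP: (hb k).
have tel : \sum_(k < m) (b k - b k.+1) = b 0%N - b m.
  by elim: m {e} => [|m IH]; rewrite ?big_ord0 ?subrr// big_ord_recr IH/=; ring.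
have h : cabs (\sum_(k < m) (b k - b k.+1)%:C%C * z ^+ k.+1) <= b 0%N - b m.
  rewrite -tel; apply: le_trans (cabs_sum _ _ _) _; apply: ler_sum => k _.
  have d0 : 0 <= b k - b k.+1 by rewrite subr_ge0; case/andP: (hb k).
  by rewrite cabsM cabs_real ger0_norm// ler_piMr.
rewrite e; apply: le_trans (cabsB _ _) _.
have h' : cabs ((b m)%:C%C * z ^+ m.+1) <= b m by rewrite cabsM cabs_real ger0_norm ?ler_piMr.
have h0 : cabs (b 0%N)%:C%C = b 0%N by rewrite cabs_real ger0_norm.
apply: le_trans (lerD (le_trans (cabsB _ _) (lerD (lexx _) h)) h') _; rewrite h0.
by rewrite -addrA subrK mulr2n mulrDl !mul1r.
Qed.

(** Young's inequality (x + N)^2 <= (1 + e/4) (x^2 + 4 N^2 / e) together with (1 + e/4) (1 - e) <=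
    (1 - e/4)^2. *)
Lemma sq_ge_of_linear_ge (x y N e : R) : 0 < e < 1 -> 0 <= x -> 0 <= y -> 0 <= N ->
  (1 - e / 4) * y - N <= x -> (1 - e) * y ^+ 2 - 4 * N ^+ 2 / e <= x ^+ 2.
Proof.
move=> /andP[e0 e1] x0 y0 N0 h.
pose A := (1 - e / 4) * y.
have A0 : 0 <= A by rewrite mulr_ge0// subr_ge0; lra.
have h1 : A ^+ 2 <= (x + N) ^+ 2.
  by rewrite lerXn2r ?nnegrE ?addr_ge0// -lerBlDr.
have h2 : (x + N) ^+ 2 <= (1 + e / 4) * (x ^+ 2 + 4 * N ^+ 2 / e).
  have -> : (1 + e / 4) * (x ^+ 2 + 4 * N ^+ 2 / e) =
     (x + N) ^+ 2 + (e * x - 4 * N) ^+ 2 / (4 * e) by field; lra.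
  by rewrite lerDl divr_ge0 ?sqr_ge0// mulr_ge0// ltW.
have h3 : (1 + e / 4) * ((1 - e) * y ^+ 2) <= A ^+ 2.
  rewrite /A exprMn mulrA; apply: ler_wpM2r; first exact: sqr_ge0.
  by nra.
have e4 : 0 < 1 + e / 4 by lra.
by rewrite lerBlDr -(ler_pM2l e4) (le_trans h3)// (le_trans h1).
Qed.

Let gpsum z : cabs z < 1 -> psum (dcoef (hilbert_coef one)) z (derive1 g z).
Proof. by move=> z1; exact: (hilbert_cdiff one_an one_le z1).1. Qed.

(** The coefficients of g' are 1 - 1/(k+2), so (1 - z) g' - 1 = - (1 - z) times the sum of z^k /
    (k+2). The first N terms cost at most |1 - z| N, the others at most 2 / (N+2) by
    [abel_bound]. *)
Lemma hilbert_one_deriv_near (e : R) : 0 < e ->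
  exists2 N : R, 0 <= N & forall z, cabs z < 1 -> cabs ((1 - z) * derive1 g z - 1) <= e + cabs (1 - z) * N.
Proof.
move=> e0; have e4 : 0 < e / 4 by rewrite divr_gt0.
pose N := Num.truncn (4 / e).
have hN : 2 * N.+2%:R^-1 <= e / 2 :> R.
  have : 4 / e < N.+2%:R by apply: lt_trans (truncnS_gt _) _; rewrite ltr_nat.
  rewrite ltr_pdivrMr// ler_pdivrMr ?ltr0n//; lra.
exists N%:R => // z z1.
pose b k : R := (N + k).+2%:R^-1.
have hb k : 0 <= b k.+1 <= b k.
  by rewrite /b invr_ge0 ler0n/= lef_pV2 ?posrE ?ltr0n// ler_nat addnS.
have part m : cabs ((1 - z) * \sum_(k < N + m) dcoef (hilbert_coef one) k * z ^+ k - 1) <=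
    cabs z ^+ (N + m) + cabs (1 - z) * N%:R + e / 2.
  rewrite (eq_bigr (fun k : 'I_(N + m) => z ^+ k - k.+2%:R^-1 * z ^+ k)); last first.
    move=> k _; rewrite /dcoef hilbert_coef_one -[k.+2%:R]natr1.
    have n0 : k.+1%:R + 1 != 0 :> R[i] by rewrite natr1 pnatr_eq0.
    by field.
  rewrite sumrB mulrBr.
  have -> : (1 - z) * (\sum_(k < N + m) z ^+ k) = 1 - z ^+ (N + m).
    by rewrite -opprB mulNr -subrX1 opprB.
  rewrite big_split_ord/= mulrDr.
  set S1 := (1 - z) * _; set S2 := (1 - z) * _.
  have -> : 1 - z ^+ (N + m) - (S1 + S2) - 1 = - (z ^+ (N + m) + S1 + S2) by ring.
  rewrite cabsN; apply: le_trans (cabsD _ _) (lerD (le_trans (cabsD _ _) (lerD _ _)) _).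
  - by rewrite cabsX.
  - rewrite /S1 cabsM; apply: ler_wpM2l; first exact: cabs_ge0.
    apply: le_trans (cabs_sum _ _ _) _.
    rewrite -[X in _ <= X%:R]card_ord -sum1_card natr_sum; apply: ler_sum => k _.
    rewrite cabsM cabsV cabs_nat cabsX mulr_ile1 ?invr_ge0 ?exprn_ge0 ?cabs_ge0//.
      by rewrite invf_le1 ?ltr0n// ler1n.
    by rewrite exprn_ile1 ?cabs_ge0// ltW.
  - apply: le_trans hN; have -> : S2 = z ^+ N * ((1 - z) * \sum_(k < m) (b k)%:C%C * z ^+ k).
      rewrite /S2 [RHS]mulrCA; congr (_ * _); rewrite mulr_sumr; apply: eq_bigr => k _.
      by rewrite exprD /b fmorphV rmorph_nat; ring.
    rewrite cabsM -[leRHS]mul1r; apply: ler_pM; rewrite ?cabs_ge0//.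
      by rewrite cabsX exprn_ile1 ?cabs_ge0// ltW.
    by have := @abel_bound b z m hb (ltW z1); rewrite /b addn0.
have [N1 HN1] : exists N1, forall m, (N1 <= m)%N -> cabs z ^+ m <= e / 2.
  have : cabs z ^+ n @[n --> \oo] --> 0 by apply: cvg_expr; rewrite ger0_norm ?cabs_ge0.
  move=> /cvgrPdist_le/(_ (e / 2)); rewrite divr_gt0// => /(_ isT)[N1 _ H].
  by exists N1 => m /H; rewrite sub0r normrN => /(le_trans (ler_norm _)).
apply: (@ctends_cabs_le _ (fun m => (1 - z) * (\sum_(k < m) dcoef (hilbert_coef one) k * z ^+ k) - 1) _ _ (N + N1)).
  by apply: ctendsB (ctendsZ _ (gpsum z1)) (ctends_cst _).
move=> m Nm; have NM : (N <= m)%N by apply: leq_trans Nm; exact: leq_addr.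
have := part (m - N)%N; rewrite subnKC// => /le_trans; apply.
rewrite [leRHS](_ : _ = e / 2 + cabs (1 - z) * N%:R + e / 2); last by field.
rewrite !lerD2r; apply: HN1; apply: leq_trans Nm; exact: leq_addl.
Qed.

(** Dividing [hilbert_one_deriv_near] by |1 - z| gives |g'| >= (1 - e/4) / |1 - z| - N, which is
    then squared. The result has the form required by [green_potential_ge]. *)
Lemma hilbert_one_deriv_ge (e : R) : 0 < e < 1 -> exists2 C : R, 0 <= C &
  forall z, cabs z < 1 -> (1 - e) * (cabs (1 - z) ^+ 2)^-1 - C <= cabs (derive1 g z) ^+ 2.
Proof.
move=> e01; have /andP[e0 e1] := e01; have e4 : 0 < e / 4 by rewrite divr_gt0.
have [N N0 HN] := hilbert_one_deriv_near e4.
exists (4 * N ^+ 2 / e) => [|z z1].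
  by rewrite divr_ge0 ?mulr_ge0 ?sqr_ge0// ltW.
rewrite -exprVn; apply: sq_ge_of_linear_ge => //; [exact: cabs_ge0|by rewrite invr_ge0 cabs_ge0|].
have r0 : 0 < cabs (1 - z).
  rewrite cabs_gt0 subr_eq0 eq_sym; apply: contraTneq z1 => ->; by rewrite cabs1 ltxx.
rewrite -(ler_pM2l r0) mulrBr mulrCA divff ?gt_eqF// mulr1 -cabsM.
have h := HN z z1; have := cabs_dist 1 ((1 - z) * derive1 g z).
rewrite cabs1 cabs_distC; move: h; move: (cabs (_ - 1)) => x; lra.
Qed.

End hilbert_one.

(** * The BMOA norm *)

Section bmoa.
Context {R : realType}.
Implicit Types (f g : Cplx R -> Cplx R).
Notation mu2 := ((@lebesgue_measure R) \x (@lebesgue_measure R))%E.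

Let toC (w : R * R) : Cplx R := Complex w.1 w.2.

Lemma unit_discE : [set w : R * R | unit_disc (Complex w.1 w.2)] = rdisc.
Proof.
apply/seteqP; split=> w; rewrite /unit_disc /rdisc/= => h.
  by rewrite -(@ltr_sqrt _ _ 1) ?ltr01// sqrtr1.
by rewrite -sqrtr1 ltr_sqrt.
Qed.

Lemma rdisc_unit_disc w : rdisc w -> cabs (toC w) < 1.
Proof. by rewrite -unit_discE. Qed.

Lemma Rho_cabs w : Rho 1 w = (cabs (1 - toC w) ^+ 2)^-1.
Proof. by rewrite cabs_sq /Rho ReD ImD ReN ImN/= sub0r sqrrN. Qed.

Lemma log_moebius (p q : R) w : p ^+ 2 + q ^+ 2 < 1 -> rdisc w ->
  ln (cabs ((1 - conjc (Complex p q) * toC w) / (Complex p q - toC w)) ^+ 2) =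
  - ln (1 - Xi p q w).
Proof.
move=> A1 wd; have wc := rdisc_sub wd.
have N0 := Minv_gt0 A1 wc.
have -> : cabs ((1 - conjc (Complex p q) * toC w) / (Complex p q - toC w)) ^+ 2 =
    (1 - Xi p q w)^-1.
  rewrite (oneB_XiE A1 wc) invfM /Minv invrK cabsM cabsV exprMn exprVn !cabs_sq mulrC.
  congr (_^-1 * _); first by rewrite /toC/=; ring.
  by rewrite /Nden /toC/=; ring.
(* At w = a the conventions 0^-1 = 0 and [ln] 0 = 0 make both sides 0. *)
have [->|x0] := eqVneq (1 - Xi p q w) 0; first by rewrite invr0 ln0// oppr0.
by rewrite lnV// posrE lt_neqAle eq_sym x0 subr_ge0 (Xi_le1 A1).
Qed.

Lemma BMOA_integralE f (p q : R) : p ^+ 2 + q ^+ 2 < 1 ->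
  BMOA_integral f (Complex p q) = ((pi^-1)%:E *
    \int[mu2]_(w in rdisc) (cabs (derive1 f (toC w)) ^+ 2 * - ln (1 - Xi p q w))%:E)%E.
Proof.
move=> A1; rewrite /BMOA_integral /disc_area_integral unit_discE; congr (_ * _)%E.
by apply: eq_integral => w; rewrite inE => wd; rewrite log_moebius.
Qed.

Lemma measurable_partial_sum (c : nat -> R[i]) n :
  measurable_fun setT (fun w => cabs (\sum_(k < n) c k * toC w ^+ k) ^+ 2).
Proof.
pose mC (F : R * R -> R[i]) := measurable_fun setT (fun w => complex.Re (F w)) /\
  measurable_fun setT (fun w => complex.Im (F w)).
have mk a : mC (fun=> a) by split; exact: measurable_cst.
have mM F G : mC F -> mC G -> mC (fun w => F w * G w).
  move=> [f1 f2] [g1 g2]; split.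
    by under eq_fun do rewrite ReM; apply: measurable_funB; exact: measurable_funM.
  by under eq_fun do rewrite ImM; apply: measurable_funD; exact: measurable_funM.
have mz : mC toC by split; [exact: measurable_fst|exact: measurable_snd].
have mX k : mC (fun w => toC w ^+ k).
  elim: k => [|k IH]; first exact: mk.
  by under eq_fun do rewrite exprS; exact: mM.
have [h1 h2] : mC (fun w => \sum_(k < n) c k * toC w ^+ k).
  elim: n => [|n [h1 h2]].
    by rewrite (_ : (fun w => _) = fun=> 0)//; apply/funext => w; rewrite big_ord0.
  rewrite (_ : (fun w => _) = fun w => \sum_(k < n) c k * toC w ^+ k + c n * toC w ^+ n).
    have [m1 m2] := mM _ _ (mk (c n)) (mX n).
    split; first by under eq_fun do rewrite ReD; exact: measurable_funD.
    by under eq_fun do rewrite ImD; exact: measurable_funD.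
  by apply/funext => w; rewrite big_ord_recr.
under eq_fun do rewrite cabs_sq.
by apply: measurable_funD; exact: measurable_funX.
Qed.

Lemma ctends_cabs_sq (u : nat -> R[i]) l : ctends u l ->
  cabs (u n) ^+ 2 @[n --> \oo] --> cabs l ^+ 2.
Proof.
move=> ul; have h : cabs (u n) @[n --> \oo] --> cabs l.
  apply/cvgrPdist_le => e e0; have [N HN] := ul _ e0; exists N => // n /= /HN.
  apply: le_trans; rewrite distrC ler_norml cabs_dist andbT.
  by rewrite lerNl opprB (le_trans (cabs_dist _ _))// cabs_distC.
by rewrite expr2; under eq_fun do rewrite expr2; exact: cvgM.
Qed.

(** A pointwise limit of polynomials on the disc is measurable there. *)
Lemma measurable_psum_sq (c : nat -> R[i]) f :
  (forall z, cabs z < 1 -> psum c z (f z)) ->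
  measurable_fun rdisc (fun w => cabs (f (toC w)) ^+ 2).
Proof.
move=> hf; apply: (@measurable_fun_cvg _ _ _ _
  (fun n w => cabs (\sum_(k < n) c k * toC w ^+ k) ^+ 2)) => [n|w wd].
  by apply: measurable_funTS; exact: measurable_partial_sum.
by apply: ctends_cabs_sq; apply: hf; exact: rdisc_unit_disc.
Qed.

Section bounded.
Variables (f : Cplx R -> Cplx R) (M : R).
Hypothesis df : analytic_on_disc f.
Hypothesis fM : forall w, cabs w < 1 -> cabs (f w) <= M.

Let M0 : 0 <= M.
Proof. by apply: le_trans (cabs_ge0 _) (fM (w := 0) _); rewrite cabs0. Qed.

Lemma measurable_hilbert_deriv_sq :
  measurable_fun rdisc (fun w => cabs (derive1 (hilbert f) (toC w)) ^+ 2).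
Proof.
apply: (@measurable_psum_sq (dcoef (hilbert_coef f))) => z z1.
exact: (hilbert_cdiff df fM z1).1.
Qed.

Lemma BMOA_integral_hilbert_le a : unit_disc a ->
  (BMOA_integral (hilbert f) a <= (M ^+ 2 * (pi ^+ 2 / 2))%:E)%E.
Proof.
case: a => p q ad.
have A1 : p ^+ 2 + q ^+ 2 < 1 by have : rdisc (p, q) by rewrite -unit_discE.
have pi0 := @pi_gt0 R.
have mG := measurable_green A1; have mR := @measurable_Rho R 1.
rewrite BMOA_integralE//.
(* The normalisation of dA by pi^-1 turns the pi^3/2 of [green_potential_le] into pi^2/2. *)
have -> : M ^+ 2 * (pi ^+ 2 / 2) = pi^-1 * (M ^+ 2 * (pi ^+ 3 / 2)).
  by rewrite [RHS]mulrCA; congr (_ * _); rewrite (exprS _ 2) -mulrA mulKf// lt0r_neq0.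
rewrite [leRHS]EFinM.
suff h : (\int[mu2]_(w in rdisc) (cabs (derive1 (hilbert f) (toC w)) ^+ 2 * - ln (1 - Xi p q w))%:E
    <= (M ^+ 2 * (pi ^+ 3 / 2))%:E)%E.
  by apply: lee_wpmul2l h; rewrite lee_fin invr_ge0 ltW.
have h1 : (\int[mu2]_(w in rdisc) (cabs (derive1 (hilbert f) (toC w)) ^+ 2 * - ln (1 - Xi p q w))%:E
    <= \int[mu2]_(w in rdisc) ((M ^+ 2)%:E * (Rho 1 w * - ln (1 - Xi p q w))%:E))%E.
  apply: ge0_le_integral => //.
  - exact: measurable_rdisc.
  - by move=> w wd; rewrite lee_fin mulr_ge0 ?sqr_ge0 ?(green_ge0 A1).
  - apply/measurable_EFinP; apply: measurable_funM; first exact: measurable_hilbert_deriv_sq.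
    exact: measurable_funTS.
  - apply/measurable_EFinP; apply: measurable_funTS.
    by apply: measurable_funM => //; exact: measurable_funM.
  - move=> w wd; rewrite -EFinM lee_fin mulrA; apply: ler_wpM2r; first exact: (green_ge0 A1).
    have z1 := rdisc_unit_disc wd.
    have := hilbert_deriv_le df fM z1.
    have r0 : 0 < cabs (1 - toC w).
      by rewrite cabs_gt0 subr_eq0 eq_sym; apply: contraTneq z1 => ->; rewrite cabs1 ltxx.
    rewrite mulrC => h; rewrite Rho_cabs ler_pdivlMr ?exprn_gt0// -exprMn -cabsM.
    by rewrite lerXn2r ?nnegrE ?cabs_ge0.
apply: (le_trans h1); rewrite ge0_integralZl//.
- rewrite [leRHS]EFinM; apply: lee_wpmul2l; first by rewrite lee_fin sqr_ge0.
  exact: green_potential_le.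
- exact: measurable_rdisc.
- by apply/measurable_EFinP; apply: measurable_funTS; exact: measurable_funM.
- by move=> w wd; rewrite lee_fin mulr_ge0 ?(green_ge0 A1)// Rho_cabs invr_ge0 sqr_ge0.
- by rewrite lee_fin sqr_ge0.
Qed.

Lemma BMOA_norm_hilbert_le : (BMOA_norm (hilbert f) <= (M * (1 + pi / Num.sqrt 2))%:E)%E.
Proof.
have pi0 := @pi_gt0 R.
rewrite mulrDr mulr1 EFinD; apply: leeD; first by rewrite lee_fin hilbert0_le.
have -> : (M * (pi / Num.sqrt 2))%:E = sqrte (M ^+ 2 * (pi ^+ 2 / 2))%:E.
  rewrite /sqrte; congr EFin; rewrite sqrtrM ?sqr_ge0// sqrtr_sqr ger0_norm//.
  by rewrite sqrtrM ?sqr_ge0// sqrtr_sqr ger0_norm ?(ltW pi0)// sqrtrV.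
rewrite lee_sqrt; last by rewrite lee_fin mulr_ge0 ?sqr_ge0// divr_ge0 ?sqr_ge0.
by apply: ge_ereal_sup => _ [a ad <-]; exact: BMOA_integral_hilbert_le.
Qed.

Lemma hilbert_H2 : H2 (hilbert f).
Proof.
split; first exact: hilbert_analytic df fM.
apply: (@le_lt_trans _ _ (2 * (2 * M ^+ 2) + 2)%:E); last exact: ltry.
apply: ge_ereal_sup => _ [r /= + <-]; rewrite in_itv/= => r01.
apply: (@circle_mean2_bound _ _ (hilbert_coef f)) => // [n|w w1].
  exact: hilbert_coef_sq_sum df fM n.
exact: hilbert_psum df fM w w1.
Qed.

End bounded.

Lemma Hinfty_bound f : (Hinfty_norm f < +oo)%E ->
  exists M, (forall w, cabs w < 1 -> cabs (f w) <= M).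
Proof.
move=> h; exists (fine (Hinfty_norm f)) => w w1.
have le v : cabs v < 1 -> ((cabs (f v))%:E <= Hinfty_norm f)%E.
  by move=> v1; apply: ereal_sup_ubound; exists v.
have fin : Hinfty_norm f \is a fin_num.
  by rewrite ge0_fin_numE// (le_trans _ (le 0 _)) ?cabs0// lee_fin cabs_ge0.
by rewrite -lee_fin fineK// le.
Qed.

Lemma BMOA_norm_hilbert_one : ((1 + pi / Num.sqrt 2)%:E <= BMOA_norm (hilbert (fun=> 1%R : Cplx R)))%E.
Proof.
have pi0 := @pi_gt0 R.
have one_an := @analytic_cst R 1.
have one_le (w : R[i]) : cabs w < 1 -> cabs (1 : R[i]) <= 1 by rewrite cabs1.
rewrite /BMOA_norm hilbert_one0 cabs1 EFinD leeD2l//.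
have -> : (pi / Num.sqrt 2)%:E = sqrte (pi ^+ 2 / 2)%:E :> \bar R.
  by rewrite /sqrte; congr EFin; rewrite sqrtrM ?sqr_ge0// sqrtr_sqr ger0_norm ?(ltW pi0)// sqrtrV.
set S := ereal_sup _.
suff hS : ((pi ^+ 2 / 2)%:E <= S)%E.
  by rewrite lee_sqrt// (le_trans _ hS)// lee_fin divr_ge0 ?sqr_ge0.
have key e : 0 < e < 1 -> (((1 - e) * pi ^+ 2 / 2 - 3 * e)%:E <= S)%E.
  move=> e01; have [C C0 hC] := @hilbert_one_deriv_ge R e e01.
  have [p p01 hp] := green_potential_ge e01 C0.
  have A1 : p ^+ 2 + 0 ^+ 2 < 1 by rewrite expr0n addr0; case/andP: p01 => *; nra.
  apply: (@le_trans _ _ (BMOA_integral (hilbert (fun=> 1%R : Cplx R)) (Complex p 0))); last first.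
    apply: ereal_sup_ubound; exists (Complex p 0) => //.
    by have : rdisc (p, 0) by []; rewrite -unit_discE.
  rewrite BMOA_integralE//.
  pose D0 w := cabs (derive1 (hilbert (fun=> 1%R : Cplx R)) (toC w)) ^+ 2.
  (* [green_potential_ge] asks for a function measurable on the whole plane, so |g'|^2 is extended
     by 0 outside the disc. *)
  have mD : measurable_fun setT (D0 \_ rdisc).
    have m0 : measurable_fun rdisc D0 := measurable_hilbert_deriv_sq one_an one_le.
    by apply: (measurable_restrictT _ _).1 m0; exact: measurable_rdisc.
  have DE w : rdisc w -> (D0 \_ rdisc) w = D0 w by move=> wd; rewrite patchE mem_set.
  have := hp _ mD.
  have -> : (\int[mu2]_(w in rdisc) ((D0 \_ rdisc) w * - ln (1 - Xi p 0 w))%:E =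
    \int[mu2]_(w in rdisc) (D0 w * - ln (1 - Xi p 0 w))%:E)%E.
    by apply: eq_integral => w; rewrite inE => wd; rewrite DE.
  have h1 w : rdisc w -> 0 <= (D0 \_ rdisc) w by move=> wd; rewrite DE// sqr_ge0.
  have h2 w : rdisc w -> (1 - e) * Rho 1 w - C <= (D0 \_ rdisc) w.
    by move=> wd; rewrite DE// Rho_cabs; apply: hC; exact: rdisc_unit_disc.
  move=> /(_ h1 h2) h.
  rewrite -[X in X%:E](mulKf (lt0r_neq0 pi0)) EFinM; apply: lee_wpmul2l => //.
  by rewrite lee_fin invr_ge0 ltW.
(* The supremum may a priori be infinite: at +oo the bound is trivial, and -oo contradicts [key]. *)
case: S key => [s||] key; last 2 first.
- exact: leey.
- by have := key 2^-1; rewrite leeNy_eq => /(_ _)/eqP; rewrite invr_gt0 invf_lt1// ltr0n ltr1n => /(_ isT).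
(* The constant pi^2/2 + 3 is the loss per unit of e in [key]; for e >= 1, outside the range of
   [key], the instance 1/2 suffices. *)
rewrite lee_fin; apply: (@le_of_all_eps _ _ _ (pi ^+ 2 / 2 + 3)) => e e0.
have [e1|e1] := ltP e 1.
  by have := key e; rewrite e0 e1 lee_fin => /(_ isT); lra.
have := key 2^-1; rewrite invr_gt0 invf_lt1// ltr0n ltr1n lee_fin => /(_ isT).
have := sqr_ge0 (pi : R); nra.
Qed.

End bmoa.

Theorem theorem1p1 (R : realType) :
  (forall f : Cplx R -> Cplx R, Hinfty f -> BMOA (hilbert f)) /\
  Hinfty_BMOA_opnorm (@hilbert R) = (1 + pi / Num.sqrt 2)%:E.
Proof.
split=> [f [df /Hinfty_bound[M fM]]|].
  split; first exact: hilbert_H2 df fM.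
  by apply: le_lt_trans (BMOA_norm_hilbert_le df fM) _; exact: ltry.
apply/eqP; rewrite eq_le; apply/andP; split.
  apply: ge_ereal_sup => _ [f [[df _] f1] <-].
  have fM w : cabs w < 1 -> cabs (f w) <= 1.
    by move=> w1; rewrite -lee_fin (le_trans _ f1)//; apply: ereal_sup_ubound; exists w.
  by have := BMOA_norm_hilbert_le df fM; rewrite mul1r.
apply: le_trans (@BMOA_norm_hilbert_one R) _.
have n1 : (Hinfty_norm (fun=> 1%R : Cplx R) <= 1)%E.
  by apply: ge_ereal_sup => _ [w _ <-]; rewrite cabs1.
apply: ereal_sup_ubound; exists (fun=> 1 : Cplx R) => //; split=> //; split; first exact: analytic_cst.
by apply: le_lt_trans n1 _; exact: ltry.
Qed.
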